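(* Assume the standing assumptions (A) on $W$, let $\chi>0$, and assume $p_\chi^+<\infty$, $p_\chi^->-\infty$ and $\tau(p_\chi^+)>0$. Let $h\in(h_\chi^+,h_\chi^-)$ and, for $\varepsilon>0$ and $j\ge0$, let $$C_j(\varepsilon)=\#\big\{k\in\{0,\dots,N-1\}: 2^{-j(h+\varepsilon)}\le\tilde\mu(I_{j,k})\le 2^{-j(h-\varepsilon)}\big\}.$$ Then almost surely $$\lim_{\varepsilon\to0}\liminf_{j\to\infty}\frac1j\log_2 C_j(\varepsilon)=\chi+D(h)\quad\text{and}\quad\lim_{\varepsilon\to0}\limsup_{j\to\infty}\frac1j\log_2 C_j(\varepsilon)=\chi+D(h).$$
   Context: Let $W$ be a real random variable and fix $T>0$. Standing assumptions (A): $\mathbb E[W]=1$, $\mathbb E[W\log_2 W]<1$, $\mathbb P(W=1)<1$, $\mathbb P(W>0)=1$, and $\mathbb E[W^p]<\infty$ for all $p\in\mathbb R$. Define $\tau(p)=p-\log_2\mathbb E[W^p]-1$ and its Legendre transform $D(h)=\inf_{p\in\mathbb R}(ph-\tau(p))$. For words $r=(r_1,\dots,r_j)\in\{0,1\}^j$ write $r|i=(r_1,\dots,r_i)$ and $\bar r=2^j\sum_{i=1}^j r_i2^{-i}$ ($\bar r=0$ for the empty word). Let $I_{j,k}=[k2^{-j}T,(k+1)2^{-j}T]$. Given i.i.d. copies $(W_r)$ of $W$ indexed by nonempty finite words, the cascade measure $\mu_\infty$ on $[0,T]$ is the almost sure weak limit of the measures $\mu_j$ with density $\prod_{i=1}^jW_{r|i}$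 on $I_{j,\bar r}$, $r\in\{0,1\}^j$. Mixed asymptotics: $(\mu^{(m)}_\infty)_{m\ge0}$ are i.i.d. cascade measures on $[0,T]$ (built from independent families of i.i.d. copies of $W$); $\tilde\mu(A)=\sum_{m\ge0}\mu^{(m)}_\infty((A-mT)\cap[0,T])$ on $[0,\infty)$. For $\chi>0$ and $j\ge0$: $N_T=\lfloor 2^{j\chi}\rfloor$, $N=N_T2^j$. Critical exponents: $p_\chi^+=\inf\{p\ge1: p\tau'(p)-\tau(p)\le-\chi\}\in(1,+\infty]$, $p_\chi^-=\sup\{p\le0: p\tau'(p)-\tau(p)\le-\chi\}\in[-\infty,0)$ (with $\inf\emptyset=+\infty$, $\sup\emptyset=-\infty$); when finite, $h_\chi^\pm=\tau'(p_\chi^\pm)$. *)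

(* Defs.v *)
From HB Require Import structures.
From mathcomp Require Import all_boot all_order all_algebra.
From mathcomp Require Import all_classical all_reals all_analysis.
Set Implicit Arguments. Unset Strict Implicit. Unset Printing Implicit Defensive.
Import Order.TTheory GRing.Theory Num.Theory.
Import numFieldNormedType.Exports.
Local Open Scope classical_set_scope.
Local Open Scope ring_scope.

Section Defs.
Context {R : realType}.

Definition log2 (x : R) : R := ln x / ln 2.

Definition log2n (n : nat) : \bar R :=
  if n == 0%N then -oo%E else (log2 n%:R)%:E.

(* the binary word r of length j with \bar r = k (most significant bit first):
   r_i = i-th binary digit of k, i = 1..j *)
Definition word (j k : nat) : seq bool :=
  [seq odd (k %/ 2 ^ (j - i)) | i <- iota 1 j].

Definition Ijk (T : R) (j k : nat) : set R :=
  `[k%:R * (2 ^+ j)^-1 * T, k.+1%:R * (2 ^+ j)^-1 * T]%classic.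

Context {d : measure_display} {Om : measurableType d} (P : probability Om R).

Definition mutually_independent {I : eqType} (J : set I) (X : I -> Om -> R) :=
  forall (s : seq I) (B : I -> set R),
    uniq s -> {in s, forall i, J i} -> (forall i, measurable (B i)) ->
    P (\bigcap_(i in [set` s]) (X i @^-1` B i)) =
    (\prod_(i <- s) P (X i @^-1` B i))%E.

Definition Emom (W : Om -> R) (p : R) : R := fine (\int[P]_x ((W x) `^ p)%:E)%E.

Definition tau (W : Om -> R) (p : R) : R := p - log2 (Emom W p) - 1.

Definition Dleg (W : Om -> R) (h : R) : \bar R :=
  ereal_inf [set (p * h - tau W p)%:E | p in [set: R]].

Definition pplus (W : Om -> R) (chi : R) : \bar R :=
  ereal_inf [set p%:E | p in
    [set p : R | 1 <= p /\ p * derive1 (tau W) p - tau W p <= - chi]].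

Definition pminus (W : Om -> R) (chi : R) : \bar R :=
  ereal_sup [set p%:E | p in
    [set p : R | p <= 0 /\ p * derive1 (tau W) p - tau W p <= - chi]].

Definition assumptionsA (W : Om -> R) : Prop :=
  measurable_fun setT W /\
  [/\ 
(\int[P]_x (W x)%:E = 1)%E,
      (\int[P]_x (W x * log2 (W x))%:E < 1%:E)%E,
      (P (W @^-1` [set 1%R]) < 1%:E)%E,
      P [set x | 0 < W x] = 1%E &
      forall p : R, (\int[P]_x ((W x) `^ p)%:E < +oo)%E].

Definition cweight (Wm : nat -> seq bool -> Om -> R) (om : Om) (m j k : nat) : R :=
  \prod_(i <- iota 1 j) Wm m (take i (word j k)) om.

(* the measures mu_j^{(m)}(om) (density prod W on I_{j,k}) converge weakly to nu:
   for every bounded continuous f, int f d mu_j -> int f d nu *)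
Definition cascade_weak_limit (T : R) (Wm : nat -> seq bool -> Om -> R)
    (om : Om) (m : nat) (nu : {measure set R -> \bar R}) : Prop :=
  forall f : R -> R, continuous f -> (exists M : R, forall x, `|f x| <= M) ->
    (fun j : nat => (\sum_(k < 2 ^ j)
        cweight Wm om m j k * Rintegral lebesgue_measure (Ijk T j k) f)%:E)
      @ \oo --> (\int[nu]_x (f x)%:E)%E.

Definition mutilde (T : R) (mu : nat -> {measure set R -> \bar R}) (A : set R)
  : \bar R :=
  (\sum_(0 <= m <oo) mu m ([set x : R | A (x + m%:R * T)%R] `&` `[0%R, T]%classic))%E.

Definition Nj (chi : R) (j : nat) : nat := (Num.truncn (2 `^ (j%:R * chi)) * 2 ^ j)%N.

Definition Cj (T chi h : R) (mu : nat -> {measure set R -> \bar R}) (j : nat) (eps : R)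
  : nat :=
  count (fun k => `[< ((2 `^ (- (j%:R * (h + eps))))%:E <= mutilde T mu (Ijk T j k))%E
                     /\ (mutilde T mu (Ijk T j k) <= (2 `^ (- (j%:R * (h - eps))))%:E)%E >])
        (iota 0 (Nj chi j)).

Definition rate (T chi h : R) (mu : nat -> {measure set R -> \bar R}) (eps : R) (j : nat)
  : \bar R :=
  ((j%:R)^-1)%:E * log2n (Cj T chi h mu j eps).

End Defs.

(* Main.v *)
Require Import Defs.
From HB Require Import structures.
From mathcomp Require Import all_boot all_order all_algebra.
From mathcomp Require Import all_classical all_reals all_analysis.
From mathcomp Require Import measurable_realfun ring lra.
Import Order.TTheory GRing.Theory Num.Theory.
Import numFieldNormedType.Exports.
Local Open Scope classical_set_scope.
Local Open Scope ring_scope.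

(** Almost surely no measure charges a dyadic point, so the mass of a cell is the limit of
    [2^-j T] times the product of the weights on its path times the total mass [Y_n] of the
    subcascade below it. Concavity of [tau] and [tau(p_chi^+) > 0] give moments of [Y_n] of
    all orders up to [p_chi^+], uniformly in [n]. Let [p] be the point of
    [(p_chi^-, p_chi^+)] where [tau' = h]; then [D(h) = p h - tau(p) > - chi].

    Upper bound: Markov's inequality and Borel-Cantelli for the sum of the [p]-th powers of
    all the cell masses.

    Lower bound: tilt the weights to [W^p / E W^p]. The tilted masses of the [N_T] independent
    cascades, restricted to cells below which [Y] stays bounded away from [0] and infinity, have
    mean at least [1/2] and a moment of some order [q > 1] growing slower than
    [2^(j (q - 1) chi)], because [D(h) > - chi]; a Laplace transform estimate then shows that
    their sum is at least [N_T / 4] for large [j]. The cells whose path weight does not have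
    exponent [h] contribute exponentially less, by the moments of orders [p + eta] and
    [p - eta], and each remaining cell contributes about [2^(- j D(h))]. *)

(** The limits of the total masses [Y_n] are never constructed. Estimates are proved at finite [n],
    with constants independent of [n], and reach the limit through Fatou's lemma and lower limits in
    [n]; the reason is also that [mu] comes without measurability in the sample point. The condition
    [tau(p_chi^+) > 0] enters because [2 E[(W/2)^q] = 2^(- tau(q))] is, up to an arbitrarily small
    factor, the slope of the recursion for the moments of order [q], and a slope below one keeps
    them bounded. In the lower bound the second moment of a tilted mass may grow too fast, so an
    order [q] slightly above one is used. The moment of order [q] grows essentially like
    [2^(j (q tau(p) - tau(p q)))], and the derivative of that exponent at [q = 1] is
    [tau(p) - p h = - D(h) < chi]: the number of independent cascades outweighs it. The restriction
    to good cells depends only on weights strictly below the cell, so it is independent of the path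
    weight and costs at most a factor [1/2] in the mean. *)

Section independence.
Set Implicit Arguments.
Unset Strict Implicit.
Unset Printing Implicit Defensive.
Context {R : realType} {d : measure_display} {Om : measurableType d}
  (P : probability Om R).
Implicit Types (A B : set Om) (G : set (set Om)).

(** Dynkin's argument: the probability of [A] intersected with [B], and [P B] times the probability
    of [A], are finite measures in [A] that agree on the pi-system [G], hence on the sigma-algebra
    it generates. *)
Lemma indep_sigma_algebra G B : G `<=` measurable -> G setT -> setI_closed G ->
  measurable B -> (forall A, G A -> P (A `&` B) = P A * P B)%E ->
  forall A, <<s G >> A -> (P (A `&` B) = P A * P B)%E.
Proof.
move=> Gm GT GI mB GB A sA.
have pB0 : 0 <= fine (P B) by exact/fine_ge0.
have := @g_sigma_algebra_measure_unique _ R _ G Gm (fun=> setT) (fun=> GT) _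
  (mrestr P mB) (mscale (NngNum pB0) P) GI.
have -> : (\bigcup_(k in @setT nat) (@setT Om)) = setT.
  by apply/seteqP; split => // x _; exists 0%N.
move=> /(_ erefl) H.
have mE C : (mscale (NngNum pB0) P C = P C * P B)%E.
  by rewrite /mscale /= fineK ?fin_num_measure// muleC.
rewrite -mE -(H _ _ A sA)// => [C GC|k].
  exact: (etrans (GB _ GC) (esym (mE C))).
by rewrite /mrestr ltey_eq fin_num_measure//; apply: measurableI.
Qed.

Definition indep_systems G1 G2 := forall A B, <<s G1 >> A -> <<s G2 >> B ->
  (P (A `&` B) = P A * P B)%E.

Lemma sigma_algebra_measurable G : G `<=` measurable -> <<s G >> `<=` measurable.
Proof.
by move=> Gm; apply: smallest_sub => //; exact: sigma_algebra_measurable.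
Qed.

Lemma measurable_fun_sub_sigma G d' (T' : measurableType d') (f : Om -> T') :
  G `<=` measurable -> measurable_fun setT (f : g_sigma_algebraType G -> T') ->
  measurable_fun setT f.
Proof.
move=> Gm mf _ B mB.
exact: (sigma_algebra_measurable Gm (mf measurableT B mB)).
Qed.

(** Independence makes the joint law of [f] and [g] the product of their laws, and Tonelli's theorem
    splits the integral. *)
Lemma ge0_expectationM_pair d1 d2 (T1 : measurableType d1) (T2 : measurableType d2)
    (f : {mfun Om >-> T1}) (g : {mfun Om >-> T2}) (u : T1 -> R) (v : T2 -> R) :
  (forall (A : set T1) (B : set T2), measurable A -> measurable B ->
     P (f @^-1` A `&` g @^-1` B) = P (f @^-1` A) * P (g @^-1` B))%E ->
  measurable_fun setT u -> measurable_fun setT v ->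
  (forall x, 0 <= u x) -> (forall x, 0 <= v x) ->
  (\int[P]_x (u (f x) * v (g x))%:E =
   (\int[P]_x (u (f x))%:E) * (\int[P]_x (v (g x))%:E))%E.
Proof.
move=> ind mu mv u0 v0.
have mfg : measurable_fun setT (fun x => (f x, g x)) by exact/measurable_fun_pair.
pose fgm : {mfun Om >-> (T1 * T2)%type} :=
  HB.pack (fun x => (f x, g x)) (isMeasurableFun.Build _ _ _ _ _ mfg).
pose muf : probability T1 R := distribution P f.
pose mug : probability T2 R := distribution P g.
have E : forall X, measurable X -> (muf \x mug)%E X = pushforward P fgm X.
  by apply: product_measure_unique => A B mA mB /=; rewrite -ind.
have mphi : measurable_fun setT (fun z : T1 * T2 => (u z.1 * v z.2)%:E).
  by apply/measurable_EFinP; apply: measurable_funM; exact: measurableT_comp.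
transitivity (\int[pushforward P fgm]_z (u z.1 * v z.2)%:E)%E.
  rewrite ge0_integral_pushforward//= => z _.
  by rewrite lee_fin mulr_ge0.
transitivity (\int[muf \x mug]_z (u z.1 * v z.2)%:E)%E.
  by apply: eq_measure_integral => A mA _; exact/esym/E.
rewrite fubini_tonelli1//=; last by move=> z; rewrite lee_fin mulr_ge0.
transitivity (\int[muf]_x ((u x)%:E * \int[mug]_y (v y)%:E))%E.
  apply: eq_integral => x _; rewrite /fubini_F -ge0_integralZl//.
  - by apply/measurable_EFinP.
  - by move=> y _; rewrite lee_fin.
  - by rewrite lee_fin.
rewrite ge0_integralZr//; last 3 first.
- by apply/measurable_EFinP.
- by move=> x _; rewrite lee_fin.
- by apply: integral_ge0 => y _; rewrite lee_fin.
by congr (_ * _)%E; rewrite ge0_integral_pushforward//=;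
  (try exact/measurable_EFinP) => x _; rewrite lee_fin.
Qed.

Lemma ge0_expectationM_indep G1 G2 (f g : Om -> R) :
  G1 `<=` measurable -> G2 `<=` measurable -> indep_systems G1 G2 ->
  measurable_fun setT (f : g_sigma_algebraType G1 -> R) ->
  measurable_fun setT (g : g_sigma_algebraType G2 -> R) ->
  (forall x, 0 <= f x) -> (forall x, 0 <= g x) ->
  (\int[P]_x (f x * g x)%:E = (\int[P]_x (f x)%:E) * (\int[P]_x (g x)%:E))%E.
Proof.
move=> G1m G2m ind mf mg f0 g0.
have mid G : G `<=` measurable ->
    measurable_fun setT (id : Om -> g_sigma_algebraType G).
  by move=> Gm _ A mA; rewrite setTI; exact: (sigma_algebra_measurable Gm).
(* A function measurable for a smaller sigma-algebra is a function of the identity map into [Om]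
   equipped with it, so independent sigma-algebras reduce to a pair of random elements. *)
pose i1 : {mfun Om >-> g_sigma_algebraType G1} :=
  HB.pack (id : Om -> g_sigma_algebraType G1)
    (isMeasurableFun.Build _ _ _ _ _ (mid _ G1m)).
pose i2 : {mfun Om >-> g_sigma_algebraType G2} :=
  HB.pack (id : Om -> g_sigma_algebraType G2)
    (isMeasurableFun.Build _ _ _ _ _ (mid _ G2m)).
exact: (@ge0_expectationM_pair _ _ _ _ i1 i2).
Qed.

(** * Sigma-algebras generated by disjoint parts of an independent family *)

Context {I : choiceType} (J : set I) (X : I -> Om -> R).

(** Repeated indices are allowed in [s], so that concatenating index lists realises
    intersections. *)
Definition cylinders (D : set I) : set (set Om) :=
  [set A | exists (s : seq I) (B : I -> set R), [/\ {in s, forall i, D i /\ J i},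
     forall i, measurable (B i) & A = \bigcap_(i in [set` s]) (X i @^-1` B i)]].

Lemma cylindersT D : cylinders D setT.
Proof.
exists [::], (fun=> setT); split => //.
by rewrite set_nil bigcap_set0.
Qed.

Lemma cylinders_setI D : setI_closed (cylinders D).
Proof.
move=> _ _ [s [B [sD mB ->]]] [t [C [tD mC ->]]].
exists (s ++ t), (fun i => (if i \in s then B i else setT) `&`
                         (if i \in t then C i else setT)); split.
- by move=> i; rewrite mem_cat => /orP[/sD|/tD].
- by move=> i; apply: measurableI; case: ifP.
- apply/seteqP; split => x /=.
    move=> [h1 h2] i /= _; split; case: ifP => // hi; [exact: h1|exact: h2].
  move=> H; split => i /= hi; have := H i; rewrite /= mem_cat hi ?orbT.
    by case.
  by case.
Qed.

Lemma cylinders_preimage D i (B : set R) :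
  D i -> J i -> measurable B -> cylinders D (X i @^-1` B).
Proof.
move=> Di Ji mB; exists [:: i], (fun=> B); split => //.
- by move=> k; rewrite inE => /eqP ->.
- apply/seteqP; split => x /=; first by move=> ? k /=; rewrite inE => /eqP ->.
  by apply => /=; rewrite inE.
Qed.

Lemma measurable_fun_cylinders D i : D i -> J i ->
  measurable_fun setT (X i : g_sigma_algebraType (cylinders D) -> R).
Proof.
move=> Di Ji _ B mB; rewrite setTI; apply: sub_sigma_algebra.
exact: cylinders_preimage.
Qed.

Lemma subset_cylinders D D' : D `<=` D' -> cylinders D `<=` cylinders D'.
Proof.
move=> DD' _ [s [B [sD mB ->]]]; exists s, B; split => // i /sD[Di Ji].
by split => //; exact: DD'.
Qed.

Lemma measurable_fun_subset_cylinders D D' d' (T' : measurableType d') (f : Om -> T') :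
  D `<=` D' -> measurable_fun setT (f : g_sigma_algebraType (cylinders D) -> T') ->
  measurable_fun setT (f : g_sigma_algebraType (cylinders D') -> T').
Proof.
move=> DD' mf _ B mB.
by apply: (sub_sigma_algebra2 (subset_cylinders DD')); apply: mf.
Qed.

Hypothesis mX : forall i, J i -> measurable_fun setT (X i).
Hypothesis iX : mutually_independent P J X.

Lemma cylinders_measurable D : cylinders D `<=` measurable.
Proof.
move=> _ [s [B [sD mB ->]]].
rewrite bigcap_seq; elim: s sD => [|i s IH] sD; first by rewrite big_nil.
rewrite big_cons; apply: measurableI.
  have [_ Ji] := sD i (mem_head _ _).
  by have := mX Ji measurableT (mB i); rewrite setTI.
by apply: IH => k ks; apply: sD; rewrite inE ks orbT.
Qed.

(** The pi-system argument is applied once on each side. On the cylinders themselves the claim is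
    mutual independence for the joined index lists, first freed of repetitions because
    [mutually_independent] speaks of duplicate-free lists. *)
Lemma indep_cylinders D1 D2 : D1 `&` D2 `<=` set0 ->
  indep_systems (cylinders D1) (cylinders D2).
Proof.
move=> D12.
have base A B : cylinders D1 A -> cylinders D2 B -> (P (A `&` B) = P A * P B)%E.
  move=> [s [B1 [sD mB1 AE]]] [t [B2 [tD mB2 BE]]].
  have {}AE : A = \bigcap_(i in [set` undup s]) (X i @^-1` B1 i).
    by rewrite AE; congr bigcap; apply/seteqP; split => i /=; rewrite mem_undup.
  have {}BE : B = \bigcap_(i in [set` undup t]) (X i @^-1` B2 i).
    by rewrite BE; congr bigcap; apply/seteqP; split => i /=; rewrite mem_undup.
  have st i : i \in undup s -> i \notin undup t.
    rewrite !mem_undup => /sD[D1i _]; apply/negP => /tD[D2i _].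
    exact: (D12 i).
  have PA : P A = (\prod_(i <- undup s) P (X i @^-1` B1 i))%E.
    by rewrite AE iX ?undup_uniq// => i; rewrite mem_undup => /sD[].
  have PB : P B = (\prod_(i <- undup t) P (X i @^-1` B2 i))%E.
    by rewrite BE iX ?undup_uniq// => i; rewrite mem_undup => /tD[].
  pose C i := if i \in undup s then B1 i else B2 i.
  have -> : A `&` B = \bigcap_(i in [set` undup s ++ undup t]) (X i @^-1` C i).
    rewrite AE BE; apply/seteqP; split => x /=.
      move=> [h1 h2] i /=; rewrite mem_cat /C; case: ifPn => [hi _|_ /= hi].
        exact: h1.
      exact: h2.
    move=> H; split => i /= hi; have := H i; rewrite /= mem_cat /C hi ?orbT.
      by apply.
    case: ifPn => his; last by apply.
    by have := st _ his; rewrite hi.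
  rewrite iX.
  - rewrite big_cat /= PA PB; congr (_ * _)%E; apply: eq_big_seq => i hi.
      by rewrite /C hi.
    rewrite /C; case: ifPn => // his; by have := st _ his; rewrite hi.
  - rewrite cat_uniq !undup_uniq /= andbT; apply/hasPn => i hi.
    by apply/negP => his; have := st _ his; rewrite hi.
  - by move=> i; rewrite mem_cat !mem_undup => /orP[/sD[]|/tD[]].
  - by move=> i; rewrite /C; case: ifP.
have m1 A : <<s cylinders D1 >> A -> measurable A.
  exact/sigma_algebra_measurable/cylinders_measurable.
have m2 A : <<s cylinders D2 >> A -> measurable A.
  exact/sigma_algebra_measurable/cylinders_measurable.
move=> A B sA sB.
have step A' : cylinders D1 A' -> (P (A' `&` B) = P A' * P B)%E.
  move=> cA; rewrite setIC muleC.
  apply: (@indep_sigma_algebra (cylinders D2)) sB.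
  - exact: cylinders_measurable.
  - exact: cylindersT.
  - exact: cylinders_setI.
  - exact: cylinders_measurable cA.
  - by move=> B' cB; rewrite setIC muleC base.
apply: (@indep_sigma_algebra (cylinders D1)) sA => //.
- exact: cylinders_measurable.
- exact: cylindersT.
- exact: cylinders_setI.
- exact: m2.
Qed.

Lemma ge0_expectationM_cylinders D1 D2 (f g : Om -> R) :
  D1 `&` D2 `<=` set0 ->
  measurable_fun setT (f : g_sigma_algebraType (cylinders D1) -> R) ->
  measurable_fun setT (g : g_sigma_algebraType (cylinders D2) -> R) ->
  (forall x, 0 <= f x) -> (forall x, 0 <= g x) ->
  (\int[P]_x (f x * g x)%:E = (\int[P]_x (f x)%:E) * (\int[P]_x (g x)%:E))%E.
Proof.
move=> D12; apply: ge0_expectationM_indep.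
- exact: cylinders_measurable.
- exact: cylinders_measurable.
- exact: indep_cylinders.
Qed.

End independence.

(** * Binary words and the numbering of dyadic cells *)

Section words.
Set Implicit Arguments.
Unset Strict Implicit.
Unset Printing Implicit Defensive.

Lemma size_word j k : size (word j k) = j.
Proof. by rewrite size_map size_iota. Qed.

(** A shift by [n] bits leaves room for the digits of [l]; this is how a cell of level [j + n] sits
    below its ancestor of level [j]. *)
Lemma word_cat j n k l : (l < 2 ^ n)%N ->
  word (j + n) (k * 2 ^ n + l) = word j k ++ word n l.
Proof.
move=> ln; rewrite /word iotaD map_cat; congr (_ ++ _).
  apply/eq_in_map => i; rewrite mem_iota add1n ltnS => /andP[_ ij].
  rewrite -addnBAC// expnD; congr odd.
  by rewrite [(2 ^ (j - i) * _)%N]mulnC divnMA divnMDl ?expn_gt0// (divn_small ln) addn0.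
rewrite (addnC 1 j) iotaDl -map_comp; apply/eq_in_map => i.
rewrite mem_iota add1n ltnS => /andP[i0 in_] /=.
have -> : (j + n - (j + i) = n - i)%N by rewrite subnDl.
have -> : (k * 2 ^ n = (k * 2 ^ i) * 2 ^ (n - i))%N by rewrite -mulnA -expnD subnKC.
rewrite divnMDl ?expn_gt0// oddD oddM oddX.
by case: i i0 in_ => //= i _ _; rewrite andbF.
Qed.

Lemma word_consE n k (b : bool) : (k < 2 ^ n)%N ->
  word n.+1 (b * 2 ^ n + k) = b :: word n k.
Proof.
by move=> kn; rewrite -[n.+1]add1n word_cat// /word /= subnn expn0 divn1; case: b.
Qed.

(** Horner evaluation of the integer that the statement attaches to a word; it recovers the index of
    a cell from its path. *)
Definition bar (r : seq bool) : nat := foldl (fun a (b : bool) => a * 2 + b)%N 0 r.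

Lemma bar_word n k : (k < 2 ^ n)%N -> bar (word n k) = k.
Proof.
elim: n k => [|n IH] k kn; first by case: k kn.
have kd : (k %/ 2 < 2 ^ n)%N by rewrite ltn_divLR// -expnSr.
have km : (k %% 2 < 2 ^ 1)%N by rewrite ltn_pmod.
have := word_cat n (k %/ 2) km; rewrite expn1 -divn_eq addn1 => ->.
have -> r s : bar (r ++ s) = foldl (fun a (b : bool) => a * 2 + b)%N (bar r) s.
  exact: foldl_cat.
rewrite IH//.
rewrite [X in _ = X](divn_eq k 2) /word /= subnn expn0 divn1 modn2.
by case: (odd k).
Qed.

Lemma big_ordM {T : Type} {idx : T} (op : Monoid.law idx) a b (F : nat -> T) :
  \big[op/idx]_(k < a * b) F k =
  \big[op/idx]_(i < a) \big[op/idx]_(j < b) F (i * b + j)%N.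
Proof.
rewrite -(big_mkord xpredT) big_nat_mul big_mkord; apply: eq_bigr => i _.
rewrite -{1}[(i * b)%N]add0n big_addn mulSn addnK big_mkord.
by apply: eq_bigr => j _; rewrite addnC.
Qed.

(** Splitting on the first letter matches [casc], which branches at the root. *)
Lemma big_word {T : Type} {idx : T} (op : Monoid.law idx) n (F : seq bool -> T) :
  \big[op/idx]_(k < 2 ^ n.+1) F (word n.+1 k) =
  op (\big[op/idx]_(k < 2 ^ n) F (false :: word n k))
     (\big[op/idx]_(k < 2 ^ n) F (true :: word n k)).
Proof.
rewrite expnS (big_ordM op 2 (2 ^ n) (fun k => F (word n.+1 k))).
rewrite !big_ord_recl big_ord0 Monoid.mulm1.
by congr (op _ _); apply: eq_bigr => k _; rewrite -word_consE.
Qed.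

End words.

(** * Weighted sums over the binary tree and their expectations *)

Section cascade.
Set Implicit Arguments.
Unset Strict Implicit.
Unset Printing Implicit Defensive.
Context {R : realType} {d : measure_display} {Om : measurableType d}
  (P : probability Om R) (W : Om -> R) (Wm : nat -> seq bool -> Om -> R).
Implicit Types (f : R -> R) (g : seq bool -> Om -> R) (m n : nat) (r : seq bool).

(** One recursion for several objects: halved weights give total masses, powers of the weights give
    moment sums over cells, normalised powers give tilted masses. Branching at the root exposes two
    independent subtrees, on which the moment recursions rely. *)
Fixpoint casc f g m n r (om : Om) : R :=
  if n is n'.+1 then
    f (Wm m (rcons r false) om) * casc f g m n' (rcons r false) om +
    f (Wm m (rcons r true) om) * casc f g m n' (rcons r true) om
  else g r om.

Lemma casc_sum f g m n r om : casc f g m n r om =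
  \sum_(k < 2 ^ n) (\prod_(i <- iota 1 n) f (Wm m (r ++ take i (word n k)) om)) *
     g (r ++ word n k) om.
Proof.
elim: n r => [|n IH] r /=.
  by rewrite expn0 big_ord_recl big_ord0 addr0 big_nil mul1r cats0.
pose F w := (\prod_(i <- iota 1 n.+1) f (Wm m (r ++ take i w) om)) * g (r ++ w) om.
rewrite [RHS](big_word _ n F) !IH !mulr_sumr.
by congr (_ + _); apply: eq_bigr => k _; rewrite /F /= big_cons /= take0 cats1
   mulrA (iotaDl 1 1) big_map /= cat_rcons; congr (_ * _ * _);
   apply: eq_bigr => i _; rewrite cat_rcons.
Qed.

Lemma casc_ge0 f g m n r om : (forall x, 0 <= f x) -> (forall r, 0 <= g r om) ->
  0 <= casc f g m n r om.
Proof.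
move=> f0 g0; elim: n r => [|n IH] r //=.
by rewrite addr_ge0// mulr_ge0.
Qed.

Lemma casc_gt0 f g m n r om : (forall x, 0 < f x) -> (forall r, 0 < g r om) ->
  0 < casc f g m n r om.
Proof.
move=> f0 g0; elim: n r => [|n IH] r //=.
by rewrite addr_gt0// mulr_gt0.
Qed.

Lemma ler_casc f g g' m n r om : (forall x, 0 <= f x) ->
  (forall r, g r om <= g' r om) -> casc f g m n r om <= casc f g' m n r om.
Proof.
move=> f0 gg; elim: n r => [|n IH] r //=.
by rewrite lerD// ler_wpM2l.
Qed.

Let J := [set i : nat * seq bool | i.2 != [::]].
Let X (i : nat * seq bool) := Wm i.1 i.2.

(** [subtree] contains the node [r] itself and [descendants] does not: a cascade below [r] uses only
    the latter, so it is independent of the weight at [r]. *)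
Definition subtree m r : set (nat * seq bool) := [set i | i.1 = m /\ prefix r i.2].
Definition descendants m r : set (nat * seq bool) :=
  [set i | [/\ i.1 = m, prefix r i.2 & (size r < size i.2)%N]].
Definition wtype (D : set (nat * seq bool)) :=
  g_sigma_algebraType (cylinders J X D).

Lemma measurable_weight D m r f : measurable_fun setT f -> D (m, r) -> r != [::] ->
  measurable_fun setT ((fun om => f (Wm m r om)) : wtype D -> R).
Proof.
move=> mf Dr r0; apply: (measurableT_comp mf).
exact: (@measurable_fun_cylinders _ _ _ _ J X D (m, r)).
Qed.

Lemma measurable_wtypeS D D' d' (T' : measurableType d') (h : Om -> T') :
  D `<=` D' -> measurable_fun setT (h : wtype D -> T') ->
  measurable_fun setT (h : wtype D' -> T').
Proof. exact: measurable_fun_subset_cylinders. Qed.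

Lemma descendants_rcons m r b : descendants m (rcons r b) `<=` descendants m r.
Proof.
move=> [m' s] [/= -> ps ss]; split => //=.
- by apply: prefix_trans ps; exact: prefix_rcons.
- by rewrite (leq_trans _ ss)// size_rcons.
Qed.

Lemma descendants_subtree m r : descendants m r `<=` subtree m r.
Proof. by move=> i []. Qed.

Lemma measurable_casc f g m n r : measurable_fun setT f ->
  (forall r, measurable_fun setT (g r : wtype (descendants m r) -> R)) ->
  measurable_fun setT (casc f g m n r : wtype (descendants m r) -> R).
Proof.
move=> mf mg; elim: n r => [|n IH] r; first exact: mg.
have H b : measurable_fun setT ((fun om => f (Wm m (rcons r b) om) *
    casc f g m n (rcons r b) om) : wtype (descendants m r) -> R).
  apply: measurable_funM.
    apply: measurable_weight => //; last by case: (r).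
    by split => //=; [exact: prefix_rcons|rewrite size_rcons].
  exact: (measurable_wtypeS (@descendants_rcons m r b)).
exact: (measurable_funD (H false) (H true)).
Qed.

Hypothesis mWm : forall m r, r != [::] -> measurable_fun setT (Wm m r).
Hypothesis mW : measurable_fun setT W.
Hypothesis eqW : forall m r, r != [::] -> forall B : set R, measurable B ->
  P (Wm m r @^-1` B) = P (W @^-1` B).
Hypothesis iW : mutually_independent P J X.

Lemma measurable_wtype D d' (T' : measurableType d') (h : Om -> T') :
  measurable_fun setT (h : wtype D -> T') -> measurable_fun setT h.
Proof.
apply: measurable_fun_sub_sigma; apply: cylinders_measurable => i Ji.
exact: mWm.
Qed.

Lemma integral_weight f m r : measurable_fun setT f -> (forall x, 0 <= f x) ->
  r != [::] -> (\int[P]_x (f (Wm m r x))%:E = \int[P]_x (f (W x))%:E)%E.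
Proof.
move=> mf f0 r0.
have mE : measurable_fun setT (fun x => (f x)%:E) by exact/measurable_EFinP.
have H (V : {mfun Om >-> R}) :
    (\int[P]_x (f (V x))%:E = \int[distribution P V]_y (f y)%:E)%E.
  by rewrite ge0_integral_pushforward// => y _; rewrite lee_fin.
have mVm := mWm m r0.
pose V1 : {mfun Om >-> R} := HB.pack (Wm m r) (isMeasurableFun.Build _ _ _ _ _ mVm).
pose V2 : {mfun Om >-> R} := HB.pack W (isMeasurableFun.Build _ _ _ _ _ mW).
rewrite (H V1) (H V2); apply: eq_measure_integral => A mA _.
exact: eqW.
Qed.

Lemma expectation_disjoint D1 D2 (u v : Om -> R) : D1 `&` D2 `<=` set0 ->
  measurable_fun setT (u : wtype D1 -> R) -> measurable_fun setT (v : wtype D2 -> R) ->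
  (forall x, 0 <= u x) -> (forall x, 0 <= v x) ->
  (\int[P]_x (u x * v x)%:E = (\int[P]_x (u x)%:E) * (\int[P]_x (v x)%:E))%E.
Proof.
apply: ge0_expectationM_cylinders => // i Ji; exact: mWm.
Qed.

Lemma expectation_node f m r (h : Om -> R) : measurable_fun setT f ->
  (forall x, 0 <= f x) -> r != [::] ->
  measurable_fun setT (h : wtype (descendants m r) -> R) -> (forall x, 0 <= h x) ->
  (\int[P]_x (f (Wm m r x) * h x)%:E =
   (\int[P]_x (f (W x))%:E) * (\int[P]_x (h x)%:E))%E.
Proof.
move=> mf f0 r0 mh h0; rewrite -(integral_weight m mf f0 r0).
apply: (@expectation_disjoint [set (m, r)] (descendants m r)) => //.
  by move=> i [-> [/= _ _]]; rewrite ltnn.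
by apply: measurable_weight.
Qed.

Lemma subtree_disjoint m r : subtree m (rcons r false) `&` subtree m (rcons r true) `<=` set0.
Proof.
move=> [m' s] [[/= _ /prefixP[s1 ->]] [/= _ /prefixP[s2]]].
by rewrite !cat_rcons => /eqP; rewrite eqseq_cat// eqxx.
Qed.

Lemma measurable_branch f m r b (h : Om -> R) : measurable_fun setT f ->
  measurable_fun setT (h : wtype (descendants m (rcons r b)) -> R) ->
  measurable_fun setT ((fun om => f (Wm m (rcons r b) om) * h om)
     : wtype (subtree m (rcons r b)) -> R).
Proof.
move=> mf mh; apply: measurable_funM.
  apply: measurable_weight => //; last by case: (r).
  by split => //=; exact: prefix_refl.
exact: (measurable_wtypeS (@descendants_subtree m (rcons r b))).
Qed.

(** Many-to-one formula: each of the [2 ^ n] paths carries [n] independent weights, independent of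
    its leaf value. *)
Lemma expectation_casc f g m n r : measurable_fun setT f -> (forall x, 0 <= f x) ->
  (forall r, measurable_fun setT (g r : wtype (descendants m r) -> R)) ->
  (forall r x, 0 <= g r x) ->
  (\int[P]_x (casc f g m n r x)%:E = (\int[P]_x (f (W x))%:E) ^+ n *
     \sum_(k < 2 ^ n) (\int[P]_x (g (r ++ word n k) x)%:E))%E.
Proof.
move=> mf f0 mg g0; elim: n r => [|n IH] r.
  by rewrite expn0 big_ord_recl big_ord0 adde0 cats0 mul1e.
rewrite (big_word _ n (fun w => (\int[P]_x (g (r ++ w) x)%:E)%E)).
have mc b := @measurable_casc f g m n (rcons r b) mf mg.
have c0 b x : 0 <= casc f g m n (rcons r b) x by apply: casc_ge0.
have mm b : measurable_fun setT
    (fun x => (f (Wm m (rcons r b) x) * casc f g m n (rcons r b) x)%:E).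
  by apply/measurable_EFinP; apply: (measurable_wtype (measurable_branch mf (mc b))).
under eq_integral do rewrite /= EFinD.
rewrite ge0_integralD//; try by move=> x _; rewrite lee_fin mulr_ge0.
rewrite !expectation_node//; try by case: (r).
have S0 b : (0 <= \sum_(k < 2 ^ n) \int[P]_x (g (rcons r b ++ word n k) x)%:E)%E.
  by apply: sume_ge0 => k _; apply: integral_ge0 => x _; rewrite lee_fin.
have M0 : (0 <= \int[P]_x (f (W x))%:E)%E.
  by apply: integral_ge0 => x _; rewrite lee_fin.
rewrite !IH -ge0_muleDr ?mule_ge0 ?expe_ge0// -ge0_muleDr// expeS -muleA.
by do 2 congr (_ * _)%E; congr (_ + _)%E; apply: eq_bigr => k _; rewrite cat_rcons.
Qed.

End cascade.

(** * Expectations of nonnegative variables and affine bounds for them *)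

Section expectation.
Set Implicit Arguments.
Unset Strict Implicit.
Unset Printing Implicit Defensive.
Context {R : realType} {d : measure_display} {Om : measurableType d}
  (P : probability Om R).
Implicit Types u v : Om -> R.

Definition Ex u : \bar R := (\int[P]_x (u x)%:E)%E.

Lemma Ex_ge0 u : (forall x, 0 <= u x) -> (0 <= Ex u)%E.
Proof. by move=> u0; apply: integral_ge0 => x _; rewrite lee_fin. Qed.

Lemma Ex_cst c : Ex (fun=> c) = c%:E.
Proof. by rewrite /Ex integral_cst//= [P setT]probability_setT mule1. Qed.

Lemma ExD u v : measurable_fun setT u -> measurable_fun setT v ->
  (forall x, 0 <= u x) -> (forall x, 0 <= v x) ->
  Ex (fun x => u x + v x) = (Ex u + Ex v)%E.
Proof.
move=> mu mv u0 v0; rewrite /Ex; under eq_integral do rewrite EFinD.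
by rewrite ge0_integralD//; try (by move=> x _; rewrite lee_fin);
  exact/measurable_EFinP.
Qed.

Lemma ExZ c u : measurable_fun setT u -> (forall x, 0 <= u x) -> 0 <= c ->
  Ex (fun x => c * u x) = (c%:E * Ex u)%E.
Proof.
move=> mu u0 c0; rewrite /Ex; under eq_integral do rewrite EFinM.
by rewrite ge0_integralZl//; [exact/measurable_EFinP|move=> x _; rewrite lee_fin].
Qed.

Lemma Ex_le u v : measurable_fun setT u -> measurable_fun setT v ->
  (forall x, 0 <= u x) -> (forall x, u x <= v x) -> (Ex u <= Ex v)%E.
Proof.
move=> mu mv u0 uv; apply: ge0_le_integral => //.
- by move=> x _; rewrite lee_fin.
- exact/measurable_EFinP.
- exact/measurable_EFinP.
- by move=> x _; rewrite lee_fin.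
Qed.

Lemma measurable_powRf d' (T' : measurableType d') (u : T' -> R) p :
  measurable_fun setT u -> measurable_fun setT (fun x => u x `^ p).
Proof. by move=> mu; exact: (measurableT_comp (@measurable_powR R p) mu). Qed.

Lemma measurable_scale d' (T' : measurableType d') (u : T' -> R) c :
  measurable_fun setT u -> measurable_fun setT (fun x => c * u x).
Proof. by move=> mu; exact: measurable_funM. Qed.

Lemma Ex_le_lin2 (a b c K L : R) u v (w : Om -> R) :
  measurable_fun setT u -> measurable_fun setT v -> measurable_fun setT w ->
  (forall x, 0 <= u x) -> (forall x, 0 <= v x) -> (forall x, 0 <= w x) ->
  0 <= a -> 0 <= b -> 0 <= c ->
  (forall x, u x <= a + b * v x + c * w x) ->
  (Ex v <= K%:E)%E -> (Ex w <= L%:E)%E -> (Ex u <= (a + b * K + c * L)%:E)%E.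
Proof.
move=> mu mv mw u0 v0 w0 a0 b0 c0 uvw vK wL.
apply: (@le_trans _ _ (Ex (fun x => (a + b * v x) + c * w x))).
  apply: Ex_le => //.
  by apply: measurable_funD; [apply: measurable_funD => //; apply: measurable_scale
    |apply: measurable_scale].
rewrite ExD//; last 4 first.
- by apply: measurable_funD => //; apply: measurable_scale.
- exact: measurable_scale.
- by move=> x; rewrite addr_ge0// mulr_ge0.
- by move=> x; rewrite mulr_ge0.
rewrite ExD//; last 2 first.
- exact: measurable_scale.
- by move=> x; rewrite mulr_ge0.
rewrite Ex_cst !ExZ// !EFinD !EFinM.
by apply: leeD; [apply: leeD => //|]; apply: lee_wpmul2l; rewrite ?lee_fin.
Qed.

End expectation.

(** * Inequalities for real powers *)

Section powers.
Set Implicit Arguments.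
Unset Strict Implicit.
Unset Printing Implicit Defensive.
Context {R : realType}.
Implicit Types x y q t : R.

(** Convexity of the exponential between [ln x] and [0]. *)
Lemma powR_le_lin x t : 0 < x -> 0 <= t <= 1 -> x `^ t <= t * x + (1 - t).
Proof.
move=> x0 t01; rewrite /powR gt_eqF//.
have := @convex_expR R (Itv01 (proj1 (andP t01)) (proj2 (andP t01))) (ln x) 0.
by rewrite !convRE /= mulr0 addr0 expR0 mulr1 lnK ?posrE.
Qed.

Lemma powR_le_1D x q t : 0 < x -> 0 <= q -> q <= t -> x `^ q <= 1 + x `^ t.
Proof.
move=> x0 q0 qt; have [x1|x1] := leP x 1.
  rewrite (@le_trans _ _ 1)//; last by rewrite lerDl powR_ge0.
  by rewrite -[leRHS](powRr0 x) ger_powR// x0.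
rewrite (@le_trans _ _ (x `^ t))//; last by rewrite lerDr.
by rewrite ler_powR// ltW.
Qed.

Lemma powR_le_1DN x q t : 0 < x -> q <= 0 -> t <= q -> x `^ q <= 1 + x `^ t.
Proof.
move=> x0 q0 qt; have xi0 : 0 < x^-1 by rewrite invr_gt0.
have E z : x `^ z = x^-1 `^ (- z) by rewrite -powR_inv1 ?ltW// -powRrM mulN1r opprK.
by rewrite !E powR_le_1D// ?lerN2// oppr_ge0.
Qed.

Lemma ge0_powR_le x y q : 0 <= q -> 0 < x -> x <= y -> x `^ q <= y `^ q.
Proof.
move=> q0 x0 xy; apply: ge0_ler_powR => //; rewrite nnegrE ltW//.
exact: lt_le_trans xy.
Qed.

Lemma le0_powR_le x y q : q <= 0 -> 0 < x -> x <= y -> y `^ q <= x `^ q.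
Proof.
move=> q0 x0 xy; rewrite -[q]opprK [y `^ _]powRN [x `^ _]powRN.
rewrite lef_pV2 ?posrE ?powR_gt0//; last exact: lt_le_trans xy.
by rewrite ge0_powR_le// oppr_ge0.
Qed.

(** When [A] and [B] are the moments of orders [a] and [b], the right-hand side has expectation [1]:
    this is the pointwise form of the log-convexity of moments. *)
Lemma weighted_young A B y a b s : 0 < A -> 0 < B -> 0 < y -> 0 <= s <= 1 ->
  (A `^ s * B `^ (1 - s))^-1 * y `^ (s * a + (1 - s) * b) <=
  s / A * y `^ a + (1 - s) / B * y `^ b.
Proof.
move=> A0 B0 y0 s01.
pose u := y `^ a / A; pose v := y `^ b / B.
have u0 : 0 < u by rewrite divr_gt0// powR_gt0.
have v0 : 0 < v by rewrite divr_gt0// powR_gt0.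
have uv0 : 0 < u / v by exact: divr_gt0.
have -> : (A `^ s * B `^ (1 - s))^-1 * y `^ (s * a + (1 - s) * b) = v * (u / v) `^ s.
  have -> : v * (u / v) `^ s = expR (s * ln u + (1 - s) * ln v).
    have -> : (u / v) `^ s = expR (s * (ln u - ln v)).
      by rewrite [LHS]/powR (gt_eqF uv0) ln_div ?posrE.
    have {1}-> : v = expR (ln v) by rewrite lnK ?posrE.
    by rewrite -expRD; congr expR; ring.
  rewrite /u /v !ln_div ?posrE ?powR_gt0// !ln_powR.
  rewrite /powR !gt_eqF// -!expRD -expRN -expRD; congr expR.
  by ring.
have -> : s / A * y `^ a + (1 - s) / B * y `^ b = v * (s * (u / v) + (1 - s)).
  by rewrite /u /v; field; rewrite !gt_eqF ?powR_gt0.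
by rewrite ler_pM2l//; apply: powR_le_lin.
Qed.

Lemma ln_le_weighted (A B C s : R) : 0 < A -> 0 < B -> 0 < C -> 
  C <= A `^ s * B `^ (1 - s) -> ln C <= s * ln A + (1 - s) * ln B.
Proof.
move=> A0 B0 C0; rewrite -ler_ln ?posrE ?mulr_gt0 ?powR_gt0//.
by rewrite lnM ?posrE ?powR_gt0// !ln_powR.
Qed.

Lemma pow2E x : 2 `^ x = expR (x * ln 2).
Proof. by rewrite /powR pnatr_eq0. Qed.

Lemma pow2_gt0 x : 0 < 2 `^ x :> R.
Proof. exact: powR_gt0. Qed.

Lemma pow2D x y : 2 `^ (x + y) = 2 `^ x * 2 `^ y :> R.
Proof. by rewrite !pow2E mulrDl expRD. Qed.

Lemma ln2_gt0 : 0 < ln 2 :> R.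
Proof. by rewrite ln_gt0// ltr1n. Qed.

Lemma ler_pow2 x y : (2 `^ x <= 2 `^ y :> R) = (x <= y).
Proof. by rewrite !pow2E ler_expR ler_pM2r// ln2_gt0. Qed.

Lemma ltr_pow2 x y : (2 `^ x < 2 `^ y :> R) = (x < y).
Proof. by rewrite !pow2E ltr_expR ltr_pM2r// ln2_gt0. Qed.

Lemma pow2_log2 x : 0 < x -> 2 `^ log2 x = x.
Proof. by move=> x0; rewrite pow2E /log2 divfK ?lnK// gt_eqF// ln2_gt0. Qed.

(** Both ends are tested because the sign of [p], hence the direction of monotonicity of the power,
    is left open. *)
Lemma powR_ge_window x a b c p : 2 `^ a <= x -> x <= 2 `^ b -> c <= p * a -> c <= p * b ->
  2 `^ c <= x `^ p.
Proof.
move=> ax xb ca cb; have x0 : 0 < x by rewrite (lt_le_trans _ ax)// pow2_gt0.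
move: ax xb; rewrite -{1 2 3}(pow2_log2 x0) !ler_pow2 -powRrM ler_pow2 => ax xb.
by have [p0|p0] := leP 0 p; nra.
Qed.

Lemma powR_le_window x a b c p : 2 `^ a <= x -> x <= 2 `^ b -> p * a <= c -> p * b <= c ->
  x `^ p <= 2 `^ c.
Proof.
move=> ax xb ca cb; have x0 : 0 < x by rewrite (lt_le_trans _ ax)// pow2_gt0.
move: ax xb; rewrite -{1 2 3}(pow2_log2 x0) !ler_pow2 -powRrM ler_pow2 => ax xb.
by have [p0|p0] := leP 0 p; nra.
Qed.

Lemma near_pow2_le (a e : R) : a < 0 -> 0 < e -> \forall j \near \oo, 2 `^ (j%:R * a) <= e.
Proof.
move=> a0 e0; near=> j; rewrite -[leRHS]lnK ?posrE// pow2E ler_expR.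
rewrite -ler_pdivlMr ?ln2_gt0// -ler_ndivrMr//.
by near: j; exact: nbhs_infty_ger.
Unshelve. all: by end_near. Qed.

(** Either one number is at most a small multiple [t] of the other, and the sum costs only a factor
    [1 + e], or the two are comparable and the square of the sum is bounded by their product. The
    leading constant stays near [1], so it does not spoil the slope of a moment recursion, while the
    cross term has only order [q / 2] in each number. *)
Lemma powRD_le q e : 0 < q -> 0 < e -> exists2 C, 0 <= C &
  forall x y, 0 < x -> 0 < y ->
    (x + y) `^ q <= (1 + e) * (x `^ q + y `^ q) + C * (x * y) `^ (q / 2).
Proof.
move=> q0 e0.
have e1 : 0 < 1 + e by rewrite addr_gt0.
pose t := (1 + e) `^ q^-1 - 1.
have t0 : 0 < t.
  have qi0 : 0 < q^-1 by rewrite invr_gt0.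
  have := gt0_ltr_powR qi0 (_ : 1 \in Num.nneg) (_ : 1 + e \in Num.nneg).
  by rewrite !nnegrE powR1 subr_gt0; apply; rewrite ?ltrDl// ltW.
have tq : (1 + t) `^ q = 1 + e.
  by rewrite addrC subrK -powRrM mulVf ?gt_eqF// powRr1// ltW.
have key x y : 0 < x -> 0 < y -> y <= t * x -> (x + y) `^ q <= (1 + e) * x `^ q.
  move=> x0 y0 yx; rewrite -tq -powRM; [|exact: ltW (addr_gt0 _ _)|exact: ltW].
  apply: ge0_powR_le; [exact: ltW|exact: addr_gt0|].
  by rewrite mulrDl mul1r lerD2l.
(* In the comparable case [x <= y / t] and [y <= x / t], whence [(x + y) ^ 2] is at most [2 / t + 2]
   times the product. *)
have K0 : 0 < 2 / t + 2 by rewrite addr_gt0// divr_gt0.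
exists ((2 / t + 2) `^ (q / 2)); first exact: powR_ge0.
move=> x y x0 y0.
have C0 : 0 <= (2 / t + 2) `^ (q / 2) * (x * y) `^ (q / 2).
  by rewrite mulr_ge0 ?powR_ge0.
have [yx|xy] := leP y (t * x).
  apply: (le_trans (key _ _ x0 y0 yx)); rewrite mulrDr -addrA lerDl addr_ge0//.
  by rewrite mulr_ge0 ?powR_ge0// ltW.
have [yx'|xy'] := leP x (t * y).
  rewrite addrC; apply: (le_trans (key _ _ y0 x0 yx')).
  by rewrite mulrDr addrAC lerDr addr_ge0// mulr_ge0 ?powR_ge0// ltW.
have xy0 : 0 < x + y by rewrite addr_gt0.
have -> : (x + y) `^ q = ((x + y) ^+ 2) `^ (q / 2).
  by rewrite -powR_mulrn ?ltW// -powRrM mulrC divfK.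
rewrite -powRM; [|exact: ltW|exact: ltW (mulr_gt0 _ _)].
apply: (@le_trans _ _ (((2 / t + 2) * (x * y)) `^ (q / 2))); last first.
  by rewrite lerDr mulr_ge0// ?ltW// addr_gt0// powR_gt0.
apply: ge0_powR_le; [by rewrite divr_ge0// ltW|exact: exprn_gt0|].
have H1 : x * x <= t^-1 * (x * y).
  by rewrite mulrCA ler_wpM2l ?(ltW x0)// -ler_pdivrMl ?invr_gt0// invrK ltW.
have H2 : y * y <= t^-1 * (x * y).
  rewrite [x * y]mulrC mulrCA ler_wpM2l ?(ltW y0)// -ler_pdivrMl ?invr_gt0//.
  by rewrite invrK ltW.
have -> : (2 / t + 2) * (x * y) = t^-1 * (x * y) + t^-1 * (x * y) + 2 * (x * y).
  by ring.
by rewrite expr2; lra.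
Qed.

End powers.

(** * Moments of cascades, positive and negative, uniformly in the depth *)

Section moments.
Set Implicit Arguments.
Unset Strict Implicit.
Unset Printing Implicit Defensive.
Context {R : realType} {d : measure_display} {Om : measurableType d}
  (P : probability Om R) (W : Om -> R) (Wm : nat -> seq bool -> Om -> R).

Let J := [set i : nat * seq bool | i.2 != [::]].
Let X (i : nat * seq bool) := Wm i.1 i.2.

Hypothesis mWm : forall m r, r != [::] -> measurable_fun setT (Wm m r).
Hypothesis mW : measurable_fun setT W.
Hypothesis eqW : forall m r, r != [::] -> forall B : set R, measurable B ->
  P (Wm m r @^-1` B) = P (W @^-1` B).
Hypothesis iW : mutually_independent P J X.

(** The transform stays abstract because two cascades need these bounds: the one with halved
    weights, which gives the total masses, and the tilted one of the lower bound. *)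
Variable f : R -> R.
Hypothesis mf : measurable_fun setT f.
Hypothesis f0 : forall x, 0 < f x.

Notation U := (casc Wm f (fun _ _ => 1)).

Lemma casc1_gt0 m n r om : 0 < U m n r om.
Proof. exact: casc_gt0. Qed.

Lemma measurable_casc1 m n r :
  measurable_fun setT (U m n r : wtype Wm (descendants m r) -> R).
Proof. by apply: measurable_casc => // s; exact: measurable_cst. Qed.

Let mUp m n r p : measurable_fun setT
  ((fun x => U m n r x `^ p) : wtype Wm (descendants m r) -> R).
Proof. by apply: measurable_powRf; exact: measurable_casc1. Qed.

Lemma measurable_powR_casc1 m n r p : measurable_fun setT (fun x => U m n r x `^ p).
Proof. exact: (measurable_wtype mWm (@mUp m n r p)). Qed.

Let mfp p : measurable_fun setT (fun x => f x `^ p).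
Proof. exact: measurable_powRf. Qed.

Let rc (r : seq bool) b : rcons r b != [::]. Proof. by case: r. Qed.

Lemma Ex_branch p (h : Om -> R) m r b :
  measurable_fun setT (h : wtype Wm (descendants m (rcons r b)) -> R) ->
  (forall x, 0 <= h x) ->
  Ex P (fun x => f (Wm m (rcons r b) x) `^ p * h x)%R =
  (Ex P (fun x => f (W x) `^ p)%R * Ex P h)%E.
Proof.
move=> mh h0.
apply: (expectation_node mWm mW eqW iW (mfp p) _ _ mh h0) => //.
by move=> x; exact: powR_ge0.
Qed.

Lemma Ex_branches p (h0 h1 : Om -> R) m r :
  measurable_fun setT (h0 : wtype Wm (descendants m (rcons r false)) -> R) ->
  measurable_fun setT (h1 : wtype Wm (descendants m (rcons r true)) -> R) ->
  (forall x, 0 <= h0 x) -> (forall x, 0 <= h1 x) ->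
  Ex P (fun x => (f (Wm m (rcons r false) x) `^ p * h0 x) *
                 (f (Wm m (rcons r true) x) `^ p * h1 x))%R =
  ((Ex P (fun x => f (W x) `^ p)%R * Ex P h0) *
   (Ex P (fun x => f (W x) `^ p)%R * Ex P h1))%E.
Proof.
move=> mh0 mh1 h00 h10; rewrite -(Ex_branch p mh0 h00) -(Ex_branch p mh1 h10).
apply: (expectation_disjoint mWm iW (@subtree_disjoint m r)).
- exact: (measurable_branch (mfp p) mh0).
- exact: (measurable_branch (mfp p) mh1).
- by move=> x; rewrite mulr_ge0 ?powR_ge0.
- by move=> x; rewrite mulr_ge0 ?powR_ge0.
Qed.

Lemma measurable_branch_powR p (h : Om -> R) m r b :
  measurable_fun setT (h : wtype Wm (descendants m (rcons r b)) -> R) ->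
  measurable_fun setT (fun x => f (Wm m (rcons r b) x) `^ p * h x).
Proof.
by move=> mh; exact: (measurable_wtype mWm (measurable_branch (mfp p) mh)).
Qed.

Lemma Ex_casc1 m n r : Ex P (f \o W) = (2^-1)%:E -> Ex P (U m n r) = 1%E.
Proof.
move=> fW; rewrite /Ex (expectation_casc mWm mW eqW iW)//; last by move=> x; exact: ltW.
have -> : (\int[P]_x (f (W x))%:E)%E = (2^-1)%:E by [].
have Ex1 : (\int[P]_x 1%:E)%E = 1%:E by have := Ex_cst P 1.
rewrite (eq_bigr (fun=> 1%:E)); last by move=> k _.
rewrite sumEFin sumr_const card_ord -EFin_expe -EFinM natrX exprVn mulVf//.
Qed.

(** [powRD_le] at the root gives an affine recursion for the moment of order [q]. Its slope
    [(1 + e) * (2 * a)] is close to twice the moment of one weight, and its constant comes from the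
    cross term, which factorises over the two independent branches. [R0 = 1] yields bounded moments,
    [R0 > 1] measures their growth. *)
Lemma casc1_moment_growth q (R0 a b K1 : R) : 0 < q -> 1 <= R0 ->
  Ex P (fun x => f (W x) `^ q)%R = a%:E -> 2 * a < R0 ->
  Ex P (fun x => f (W x) `^ (q / 2))%R = b%:E ->
  (forall m n r, Ex P (fun x => U m n r x `^ (q / 2))%R <= K1%:E)%E ->
  exists2 K, 0 <= K &
    forall m n r, (Ex P (fun x => U m n r x `^ q)%R <= (K * R0 ^+ n)%:E)%E.
Proof.
move=> q0 R1 aE aR bE K1E.
have a0 : 0 <= a by rewrite -lee_fin -aE; apply: Ex_ge0 => x; exact: powR_ge0.
have b0 : 0 <= b by rewrite -lee_fin -bE; apply: Ex_ge0 => x; exact: powR_ge0.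
have K10 : 0 <= K1.
  rewrite -lee_fin; apply: le_trans (K1E 0%N 0%N [::]).
  by apply: Ex_ge0 => x; exact: powR_ge0.
have [e e0 eR] : exists2 e, 0 < e & (1 + e) * (2 * a) < R0.
  (* The requirement is [e * (2 * a) < R0 - 2 * a]; the [1] in the denominator covers [a = 0]. *)
  exists ((R0 - 2 * a) / (2 * (2 * a + 1))).
    by rewrite divr_gt0 ?subr_gt0// mulr_gt0// ltr_wpDl// mulr_ge0.
  have h : 0 < 2 * a + 1 by rewrite ltr_wpDl// mulr_ge0.
  set z := (R0 - 2 * a) / _.
  have zE : z * (2 * (2 * a + 1)) = R0 - 2 * a by rewrite /z divfK// mulf_neq0// gt_eqF.
  have z0 : 0 < z by rewrite /z divr_gt0 ?subr_gt0// mulr_gt0.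
  nra.
have [C C0 HC] := powRD_le q0 e0.
pose B := (1 + e) * (2 * a).
pose c := C * (b * K1) ^+ 2.
have c0 : 0 <= c by rewrite mulr_ge0// exprn_ge0// mulr_ge0.
have RB : 0 < R0 - B by rewrite subr_gt0.
have K0 : 0 <= 1 + c / (R0 - B) by rewrite addr_ge0// divr_ge0// ltW.
(* This constant satisfies [K * (R0 - B) >= c], that is [B * K + c <= R0 * K], which is what the
   induction step needs. *)
exists (1 + c / (R0 - B)) => // m n; elim: n => [|n IH] r.
  rewrite expr0 mulr1 /=.
  under [fun _ => _]eq_fun do rewrite powR1.
  by rewrite Ex_cst lee_fin lerDl divr_ge0// ltW.
set K := 1 + _ in IH K0 *.
have KE : K * (R0 - B) = (R0 - B) + c by rewrite /K mulrDl mul1r divfK// gt_eqF.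
pose u b x := f (Wm m (rcons r b) x) `^ q * U m n (rcons r b) x `^ q.
pose w x := (f (Wm m (rcons r false) x) `^ (q / 2) * U m n (rcons r false) x `^ (q / 2))
  * (f (Wm m (rcons r true) x) `^ (q / 2) * U m n (rcons r true) x `^ (q / 2)).
have p0 (x s : R) : 0 <= x `^ s by exact: powR_ge0.
have mu i : measurable_fun setT (u i) by exact: measurable_branch_powR.
have u0 i x : 0 <= u i x by rewrite mulr_ge0.
have Eu i : (Ex P (u i) <= (a * (K * R0 ^+ n))%:E)%E.
  by rewrite /u Ex_branch// aE EFinM lee_wpmul2l.
have Ew : (Ex P w <= ((b * K1) ^+ 2)%:E)%E.
  rewrite /w Ex_branches// bE expr2 EFinM.
  have H i : (b%:E * Ex P (fun x => U m n (rcons r i) x `^ (q / 2))%R <= (b * K1)%:E)%E.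
    by rewrite EFinM lee_wpmul2l.
  have G i : (0 <= b%:E * Ex P (fun x => U m n (rcons r i) x `^ (q / 2))%R)%E.
    by rewrite mule_ge0// Ex_ge0.
  exact: lee_pmul.
have Ev : (Ex P (fun x => u false x + u true x)%R <= (2 * a * (K * R0 ^+ n))%:E)%E.
  rewrite ExD// -mulrA mulr_natl mulr2n EFinD.
  exact: leeD.
have := @Ex_le_lin2 _ _ _ P 0 (1 + e) C _ _ (fun x => U m n.+1 r x `^ q)
   (fun x => u false x + u true x) w (@measurable_powR_casc1 m n.+1 r q) _ _ _ _ _ _ _ _ _ Ev Ew.
move=> H; apply: (le_trans (H _ _ _ _ _ _ _ _ _)) => //.
- exact: measurable_funD.
- apply: measurable_funM; exact: measurable_branch_powR.
- by move=> x; rewrite addr_ge0.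
- by move=> x; rewrite !mulr_ge0.
- by rewrite addr_ge0// ltW.
- move=> x; rewrite add0r /u /w /= -!powRM ?mulr_ge0 ?(ltW (f0 _)) ?(ltW (casc1_gt0 _ _ _ _))//.
  by apply: HC; rewrite mulr_gt0// casc1_gt0.
rewrite lee_fin add0r -/c mulrA -/B exprS.
have Rn : 1 <= R0 ^+ n by rewrite exprn_ege1.
have h2 : 0 <= K * (R0 - B) - c by rewrite KE addrK ltW.
have h1 : 0 <= (K * (R0 - B) - c) * R0 ^+ n by rewrite mulr_ge0// (le_trans _ Rn).
have h3 : 0 <= c * (R0 ^+ n - 1) by rewrite mulr_ge0// subr_ge0.
rewrite -subr_ge0 (_ : _ - _ = (K * (R0 - B) - c) * R0 ^+ n + c * (R0 ^+ n - 1)).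
  exact: addr_ge0.
by ring.
Qed.

Variable F : R -> R.
Hypothesis FE : forall p, Ex P (fun x => f (W x) `^ p) = (F p)%:E.
Hypothesis f12 : Ex P (f \o W) = (2^-1)%:E.

Let F0 p : 0 <= F p.
Proof. by rewrite -lee_fin -FE; apply: Ex_ge0 => x; exact: powR_ge0. Qed.

Definition bounded_moment q := exists2 K, 0 <= K &
  forall m n r, (Ex P (fun x => U m n r x `^ q)%R <= K%:E)%E.

Lemma Ex_le_lin1 (a b K : R) (u v : Om -> R) :
  measurable_fun setT u -> measurable_fun setT v ->
  (forall x, 0 <= u x) -> (forall x, 0 <= v x) -> 0 <= a -> 0 <= b ->
  (forall x, u x <= a + b * v x) ->
  (Ex P v <= K%:E)%E -> (Ex P u <= (a + b * K)%:E)%E.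
Proof.
move=> mu mv u0 v0 a0 b0 uv vK; rewrite -[a + _]addr0 -[0](mulr0 0).
apply: (@Ex_le_lin2 _ _ _ P a b 0 K 0 u v (cst 0)) => //.
- by move=> x; rewrite mulr0 addr0.
- by rewrite Ex_cst.
Qed.

Let p0 (x s : R) : 0 <= x `^ s. Proof. exact: powR_ge0. Qed.
Let U0 m n r x : 0 <= U m n r x. Proof. exact/ltW/casc1_gt0. Qed.

Lemma bounded_moment_interp q t : (0 <= q <= t) || (t <= q <= 0) ->
  bounded_moment t -> bounded_moment q.
Proof.
move=> qt [K K0 HK]; exists (1 + 1 * K) => [|m n r].
  by rewrite addr_ge0// mul1r.
apply: Ex_le_lin1 (HK m n r) => //; try exact: measurable_powR_casc1.
move=> x; rewrite mul1r; have := casc1_gt0 m n r x.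
by case/orP: qt => /andP[h1 h2] U1; [exact: powR_le_1D|exact: powR_le_1DN].
Qed.

Lemma bounded_moment1 : bounded_moment 1.
Proof.
exists 1 => // m n r; rewrite -(Ex_casc1 m n r f12).
by under [fun x => _ `^ _]eq_fun do rewrite powRr1//.
Qed.

(** The order is reached by doubling: at order [q] the cross term needs only order [q / 2], and
    orders up to [1] are settled by the mean. Above [1] the hypothesis leaves room for a slope below
    one. *)
Lemma bounded_moment_gt1 Q q : (forall q, 1 < q <= Q -> 2 * F q < 1) ->
  0 <= q <= Q -> bounded_moment q.
Proof.
move=> FQ; have [N] : exists N, q <= 2 ^+ N.
  exists (Num.truncn `|q|).+1; rewrite (le_trans (ler_norm q))//.
  rewrite (le_trans (ltW (truncnS_gt _)))// -natrX ler_nat.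
  exact/ltnW/ltn_expl.
elim: N q => [|N IH] q qN /andP[q0 qQ].
  apply: (bounded_moment_interp _ bounded_moment1).
  by rewrite q0 -(expr0 2) qN.
have [q1|q1] := leP q 1.
  by apply: (bounded_moment_interp _ bounded_moment1); rewrite q0 q1.
have [||K1 K10 HK1] := IH (q / 2).
- by rewrite ler_pdivrMr// -exprSr.
- rewrite divr_ge0//= (le_trans _ qQ)// ler_pdivrMr// ler_peMr//.
  by rewrite ler1n.
have q00 : 0 < q by exact: lt_trans q1.
have [|K K0 HK] := @casc1_moment_growth q 1 (F q) (F (q / 2)) K1 q00 (lexx _)
  (FE q) _ (FE _) HK1.
  by apply: FQ; rewrite q1.
by exists K => // m n r; have := HK m n r; rewrite expr1n mulr1.
Qed.

Definition below_half (y : R) : R := \1_(`]-oo, 2^-1]%classic : set R) y.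

Lemma measurable_below_half : measurable_fun setT below_half.
Proof. exact: measurable_indic. Qed.

Lemma below_halfE y : below_half y = (y <= 2^-1)%R%:R.
Proof.
rewrite /below_half indicE; congr (nat_of_bool _)%:R.
by apply/idP/idP; rewrite inE /= in_itv.
Qed.

Let bh0 y : 0 <= below_half y. Proof. by rewrite below_halfE. Qed.

(* Paley-Zygmund: [E U = 1] and a bounded moment of order [Q > 1] prevent
   [U] from being concentrated below [1/2]. *)
Lemma casc1_small_ball Q : 1 < Q -> bounded_moment Q ->
  exists2 th, 0 <= th < 1 &
    forall m n r, (Ex P (fun x => below_half (U m n r x)) <= th%:E)%E.
Proof.
move=> Q1 [K K0 HK].
have Q10 : 0 < Q - 1 by rewrite subr_gt0.
(* So large that, by the moment of order [Q], the values of [U] above [M] contribute at most [1/4]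
   to the mean. *)
pose M := 1 + (4 * K) `^ (Q - 1)^-1.
have M1 : 1 <= M by rewrite /M lerDl.
have M0 : 0 < M by exact: lt_le_trans M1.
have KM : M `^ (1 - Q) * K <= 4^-1.
  have -> : M `^ (1 - Q) = (M `^ (Q - 1))^-1 by rewrite -powRN opprB.
  have H : 4 * K <= M `^ (Q - 1).
    have K40 : 0 <= 4 * K by rewrite mulr_ge0.
    have -> : 4 * K = ((4 * K) `^ (Q - 1)^-1) `^ (Q - 1).
      by rewrite -powRrM mulVf ?powRr1// gt_eqF.
    apply: ge0_ler_powR; [exact: ltW|by rewrite nnegrE|by rewrite nnegrE ltW|].
    by rewrite /M lerDr.
  by rewrite ler_pdivrMl ?powR_gt0//; lra.
exists (1 - (4 * M)^-1).
  rewrite gtrBl invr_gt0 mulr_gt0// andbT subr_ge0 invf_le1 ?mulr_gt0//.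
  by lra.
move=> m n r.
(* On the ranges up to [1/2], from there to [M], and above [M], this is at most [1/2 + M], [M] and
   [M ^ (1 - Q) * U ^ Q]. As [E U = 1], integrating the sum of these bounds leaves probability at
   most [1 - 1 / (4 M)] for the first range. *)
pose u x := U m n r x + M * below_half (U m n r x).
have mU : measurable_fun setT (U m n r).
  exact: (measurable_wtype mWm (@measurable_casc1 m n r)).
have mb : measurable_fun setT (fun x => below_half (U m n r x)).
  exact: (measurableT_comp measurable_below_half mU).
have : (Ex P u <= (2^-1 + M + M `^ (1 - Q) * K)%:E)%E.
  apply: Ex_le_lin1 (HK m n r) => //.
  - by apply: measurable_funD => //; exact: measurable_scale.
  - exact: measurable_powR_casc1.
  - by move=> x; rewrite addr_ge0// mulr_ge0// ltW.
  - by rewrite addr_ge0// ltW.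
  move=> x; rewrite /u; set y := U m n r x.
  have y0 : 0 < y by exact: casc1_gt0.
  have H : 0 <= M `^ (1 - Q) * y `^ Q by rewrite mulr_ge0.
  rewrite below_halfE; case: (leP y 2^-1) => y2 /=; first by lra.
  have [yM|yM] := leP y M; first by lra.
  suff : y <= M `^ (1 - Q) * y `^ Q by lra.
  rewrite -(mulr_powRB1 (ltW y0) (lt_trans ltr01 Q1)) mulrCA ler_peMr//; first exact: ltW.
  have -> : M `^ (1 - Q) = (M `^ (Q - 1))^-1 by rewrite -powRN opprB.
  rewrite ler_pdivlMl ?powR_gt0// mulr1.
  by apply: ge0_powR_le => //; exact: ltW.
rewrite ExD//; last 2 first.
- exact: measurable_scale.
- by move=> x; rewrite mulr_ge0// ltW.
rewrite (Ex_casc1 m n r f12) ExZ//; last exact: ltW.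
move=> H.
have : (M%:E * Ex P (fun x => below_half (U m n r x)) <= (M * (1 - (4 * M)^-1))%:E)%E.
  have -> : M * (1 - (4 * M)^-1) = M - 4^-1 by field; rewrite gt_eqF.
  rewrite -(@leeD2lE _ 1%E)// (le_trans H)// -EFinD lee_fin.
  by lra.
by rewrite EFinM lee_pmul2l// lte_fin.
Qed.

(** If the mass below the left child exceeds [1/2], the left term alone bounds the negative power.
    Otherwise, an event of probability at most [th] that is independent of the right subtree, the
    right term does. The recursion then has slope [th * F (- q)], which is below one for small
    [q]. *)
Lemma bounded_moment_neg_small Q : 1 < Q -> bounded_moment Q ->
  exists2 q, 0 < q & bounded_moment (- q).
Proof.
move=> Q1 /(casc1_small_ball Q1)[th /andP[th0 th1] Hth].
(* Since [F (- q) <= 1 + q * F (-1)] by [powR_le_lin], this [q] makes [th * F (- q)] less than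
   [1]. *)
pose q := (1 - th) / (2 * (1 + F (-1))).
have F10 : 0 < 1 + F (-1) by rewrite ltr_pwDl.
have q0 : 0 < q by rewrite divr_gt0 ?subr_gt0// mulr_gt0.
have qE : q * (2 * (1 + F (-1))) = 1 - th by rewrite divfK// mulf_neq0// gt_eqF.
have Fm1 := F0 (-1).
have q1 : q <= 1 by nra.
have Fq : F (- q) <= 1 + q * F (-1).
  rewrite -lee_fin -(FE (- q)).
  apply: (@Ex_le_lin1 1 q (F (-1)) _ (fun x => f (W x) `^ (-1))) => //.
  - exact: (measurableT_comp (mfp (- q)) mW).
  - exact: (measurableT_comp (mfp (- 1)) mW).
  - exact: ltW.
  - move=> x; have fx := f0 (W x).
    have -> : f (W x) `^ (- q) = (f (W x) `^ (-1)) `^ q by rewrite -powRrM mulN1r.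
    have := @powR_le_lin _ (f (W x) `^ (-1)) q (powR_gt0 _ fx).
    by rewrite (ltW q0) q1 => /(_ isT); lra.
  - by rewrite FE.
have Fq0 := F0 (- q).
have BB : th * F (- q) < 1 by nra.
exists q => //.
pose B := th * F (- q); pose c := 2 `^ q * F (- q).
have c0 : 0 <= c by rewrite mulr_ge0.
have B1 : 0 < 1 - B by rewrite subr_gt0.
pose K := 1 + c / (1 - B).
have KE : K * (1 - B) = 1 - B + c by rewrite /K mulrDl mul1r divfK// gt_eqF.
have K0 : 0 <= K by rewrite addr_ge0// divr_ge0// ltW.
exists K => // m n; elim: n => [|n IH] r.
  rewrite /=; under [fun _ => _]eq_fun do rewrite powR1.
  by rewrite Ex_cst lee_fin lerDl divr_ge0// ltW.
pose v x := f (Wm m (rcons r false) x) `^ (- q) * 1.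
pose w x := below_half (U m n (rcons r false) x) *
  (f (Wm m (rcons r true) x) `^ (- q) * U m n (rcons r true) x `^ (- q)).
have mbh : measurable_fun setT ((fun x => below_half (U m n (rcons r false) x)) :
    wtype Wm (subtree m (rcons r false)) -> R).
  apply: (measurableT_comp measurable_below_half).
  exact: (measurable_wtypeS (@descendants_subtree m (rcons r false))
    (@measurable_casc1 m n (rcons r false))).
have Ev : (Ex P v <= (F (- q))%:E)%E.
  by rewrite /v Ex_branch// Ex_cst mule1 FE.
have Ew : (Ex P w <= (th * (F (- q) * K))%:E)%E.
  have mg := measurable_branch (mfp (- q)) (@mUp m n (rcons r true) (- q)).
  rewrite /w /Ex (expectation_disjoint mWm iW (@subtree_disjoint m r) mbh mg)//; last first.
    by move=> x; rewrite mulr_ge0.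
  rewrite EFinM; apply: lee_pmul.
  - by apply: Ex_ge0.
  - by apply: Ex_ge0 => x; rewrite mulr_ge0.
  - exact: Hth.
  - rewrite -/(Ex P (fun x => f (Wm m (rcons r true) x) `^ (- q) *
        U m n (rcons r true) x `^ (- q))%R).
    by rewrite Ex_branch// FE EFinM lee_wpmul2l.
have := @Ex_le_lin2 _ _ _ P 0 (2 `^ q) 1 _ _ (fun x => U m n.+1 r x `^ (- q)) v w
  (@measurable_powR_casc1 m n.+1 r (- q)) _ _ _ _ _ _ _ _ _ Ev Ew.
move=> H; apply: (le_trans (H _ _ _ _ _ _ _ _ _)) => //.
- exact: measurable_branch_powR.
- apply: measurable_funM; first exact: (measurable_wtype mWm mbh).
  exact: measurable_branch_powR.
- by move=> x; rewrite mulr_ge0.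
- by move=> x; rewrite !mulr_ge0.
- move=> x; rewrite add0r mul1r /v /w mulr1 /=.
  set a0 := f _; set a1 := f _; set b0 := casc _ _ _ _ _ _ _; set b1 := casc _ _ _ _ _ _ _.
  have a00 : 0 < a0 by exact: f0.
  have a10 : 0 < a1 by exact: f0.
  have b00 : 0 < b0 by exact: casc1_gt0.
  have b10 : 0 < b1 by exact: casc1_gt0.
  have qn : - q <= 0 by rewrite oppr_le0 ltW.
  have ab0 : 0 < a0 * b0 by exact: mulr_gt0.
  have ab1 : 0 < a1 * b1 by exact: mulr_gt0.
  rewrite below_halfE -(powRM _ (ltW a10) (ltW b10)); case: (leP b0 2^-1) => bh.
    rewrite mul1r (@le_trans _ _ ((a1 * b1) `^ (- q)))//.
      by apply: le0_powR_le => //; rewrite lerDr ltW.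
    by rewrite lerDr mulr_ge0.
  rewrite mul0r addr0.
  have -> : 2 `^ q = 2^-1 `^ (- q).
    by rewrite -powR_inv1// -powRrM mulrN mulN1r opprK.
  have h2 : 0 <= 2^-1 :> R by [].
  rewrite -(powRM _ h2 (ltW a00)); apply: le0_powR_le => //; first by rewrite mulr_gt0.
  rewrite (@le_trans _ _ (a0 * b0))//; last by rewrite lerDl ltW.
  by rewrite mulrC ler_wpM2l// ltW.
rewrite lee_fin add0r mul1r mulrA -/B -/c.
by lra.
Qed.

(** From [(a + b) ^ 2 >= a * b], the power of order [- 2 q] of the sum is at most a product of two
    independent powers of order [- q]. Depth [n] at order [- q] thus controls depth [n + 1] at order
    [- 2 q] directly. *)
Lemma bounded_moment_double q : 0 <= q -> bounded_moment (- q) ->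
  bounded_moment (- (q * 2)).
Proof.
move=> q0 [K K0 HK]; have Fq0 := F0 (- q); exists (1 + (F (- q) * K) ^+ 2) => [|m [|n] r].
- by rewrite addr_ge0// exprn_ge0// mulr_ge0.
- rewrite /=; under [fun _ => _]eq_fun do rewrite powR1.
  by rewrite Ex_cst lee_fin lerDl exprn_ge0// mulr_ge0.
pose w x := (f (Wm m (rcons r false) x) `^ (- q) * U m n (rcons r false) x `^ (- q))
  * (f (Wm m (rcons r true) x) `^ (- q) * U m n (rcons r true) x `^ (- q)).
have Ew : (Ex P w <= ((F (- q) * K) ^+ 2)%:E)%E.
  rewrite /w Ex_branches// FE expr2 EFinM.
  have H i : ((F (- q))%:E * Ex P (fun x => U m n (rcons r i) x `^ (- q))%R <=
      (F (- q) * K)%:E)%E.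
    by rewrite EFinM lee_wpmul2l.
  have G i : (0 <= (F (- q))%:E * Ex P (fun x => U m n (rcons r i) x `^ (- q))%R)%E.
    by rewrite mule_ge0// Ex_ge0.
  exact: lee_pmul.
rewrite (@le_trans _ _ ((F (- q) * K) ^+ 2)%:E)//; last by rewrite lee_fin lerDr.
apply: le_trans Ew; apply: Ex_le => //.
- exact: measurable_powR_casc1.
- by apply: measurable_funM; exact: measurable_branch_powR.
move=> x; rewrite /w /= -!powRM ?(ltW (f0 _))// ?mulr_ge0// ?(ltW (f0 _))//.
set a := f _ * _; set b := f _ * _.
have a0 : 0 < a by rewrite mulr_gt0// casc1_gt0.
have b0 : 0 < b by rewrite mulr_gt0// casc1_gt0.
have -> : (a + b) `^ (- (q * 2)) = ((a + b) ^+ 2) `^ (- q).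
  by rewrite -powR_mulrn ?addr_ge0 ?ltW// -powRrM mulrN mulrC.
apply: le0_powR_le; [by rewrite oppr_le0|by rewrite mulr_gt0|].
by rewrite expr2; nra.
Qed.

Lemma bounded_moments Q p : 1 < Q -> (forall q, 1 < q <= Q -> 2 * F q < 1) ->
  p <= Q -> bounded_moment p.
Proof.
move=> Q1 FQ pQ; have [p00|p00] := leP 0 p.
  by apply: (bounded_moment_gt1 FQ); rewrite p00.
have BQ : bounded_moment Q.
  by apply: (bounded_moment_gt1 FQ); rewrite lexx andbT ltW// (lt_trans ltr01).
have [q q0 Hq] := bounded_moment_neg_small Q1 BQ.
have H N : bounded_moment (- (q * 2 ^+ N)).
  elim: N => [|N IH]; first by rewrite expr0 mulr1.
  rewrite exprSr mulrA; apply: bounded_moment_double => //.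
  by rewrite mulr_ge0// ?exprn_ge0// ltW.
pose N := (Num.truncn (- p / q)).+1.
apply: bounded_moment_interp (H N); apply/orP; right.
rewrite (ltW p00) andbT lerNl -ler_pdivrMl// mulrC.
rewrite (le_trans (ltW (truncnS_gt _)))// -natrX ler_nat.
exact/ltnW/ltn_expl.
Qed.

End moments.

(** * Tangents of concave functions and the optimal order *)

Section legendre.
Set Implicit Arguments.
Unset Strict Implicit.
Unset Printing Implicit Defensive.
Context {R : realType}.
Implicit Types t : R -> R.

Lemma derive1_expand t (p : R) : derivable t p 1 -> forall e : R, 0 < e -> exists2 dl, 0 < dl &
  forall x : R, `|x| < dl -> `|t (p + x) - t p - derive1 t p * x| <= e * `|x|.
Proof.
move=> tp e e0.
have /cvgrPdist_le /(_ e e0) : h^-1 *: (t (h + p) - t p) @[h --> 0^'] --> derive1 t p.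
  rewrite derive1E.
  have := tp; rewrite /derivable /derive; under eq_fun do rewrite scaler1; by [].
move=> -[dl /= dl0 H]; exists dl => // x xd.
have [->|x0] := eqVneq x 0.
  by rewrite addr0 subrr mulr0 subr0 normr0 mulr0.
have := H x; rewrite /= sub0r normrN => /(_ xd x0).
rewrite -(ler_pM2r (_ : 0 < `|x|)) ?normr_gt0// -normrM.
rewrite (_ : (_ - _) * x = - (t (p + x) - t p - derive1 t p * x)) ?normrN//.
by rewrite [x + p]addrC /GRing.scale /=; field.
Qed.

(** The chord from [1], where [t] vanishes, to [pp] lies below the graph. *)
Lemma concave_gt0 t (pp : R) :
  (forall a b s, 0 <= s <= 1 -> s * t a + (1 - s) * t b <= t (s * a + (1 - s) * b)) ->
  t 1 = 0 -> 0 < t pp -> 1 <= pp -> 1 < pp /\ forall q, 1 < q <= pp -> 0 < t q.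
Proof.
move=> conc t1 tpp pp1.
have Q1 : 1 < pp.
  by rewrite lt_neqAle pp1 andbT; apply/eqP => E; move: tpp; rewrite -E t1 ltxx.
split=> // q /andP[q1 qpp]; pose s := (q - 1) / (pp - 1).
have pp10 : 0 < pp - 1 by rewrite subr_gt0.
have s0 : 0 < s by rewrite divr_gt0// subr_gt0.
have s1 : s <= 1 by rewrite ler_pdivrMr// mul1r lerD2r.
have s01 : 0 <= s <= 1 by rewrite ltW.
have sE : s * (pp - 1) = q - 1 by rewrite divfK// gt_eqF.
have := conc pp 1 s s01; rewrite t1 mulr0 addr0.
have -> : s * pp + (1 - s) * 1 = q by rewrite mulrBr mulr1 in sE; lra.
by apply: lt_le_trans; rewrite mulr_gt0.
Qed.

(** Darboux's argument: the slopes at the ends force a maximiser of [t p - h * p] on [[pm, pp]] to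
    be interior, so the slope there is [h], and concavity makes the tangent bound global. The last
    inequality comes from the hypotheses at the critical exponents when the point is outside
    [(0, 1)], and from the sign of [t] when it is inside. *)
Lemma legendre_point t (pm pp h chi : R) :
  (forall a b s, 0 <= s <= 1 -> s * t a + (1 - s) * t b <= t (s * a + (1 - s) * b)) ->
  (forall p, derivable t p 1) -> pm <= 0 -> 1 <= pp -> t 1 = 0 -> 0 < t pp ->
  derive1 t pp < h -> h < derive1 t pm -> 0 < chi ->
  (forall p, 1 <= p < pp -> - chi < p * derive1 t p - t p) ->
  (forall p, pm < p <= 0 -> - chi < p * derive1 t p - t p) ->
  exists p0, [/\ pm < p0 < pp, derive1 t p0 = h,
     forall p, t p <= t p0 + h * (p - p0) & - chi < p0 * h - t p0].
Proof.
move=> conc dt pm0 pp1 t1 tpp hpp hpm chi0 Hp Hm.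
have pp_gt1 : 1 < pp by rewrite lt_neqAle pp1 andbT; apply/eqP => E; move: tpp; rewrite -E t1 ltxx.
have pmpp : pm < pp by rewrite (le_lt_trans pm0)// (lt_trans ltr01).
pose phi p := t p - h * p.
have phiE : phi = t - (cst h * (@id R)) by apply/funext.
have dh p : derivable (cst h * (@id R)) p 1.
  by apply: derivableM; [exact: derivable_cst|exact: derivable_id].
have dphi p : derivable phi p 1 by rewrite phiE; exact: derivableB.
have phi1 p : derive1 phi p = derive1 t p - h.
  rewrite !derive1E phiE deriveB// deriveM; [|exact: derivable_cst|exact: derivable_id].
  by rewrite derive_cst derive_id scaler0 addr0 [_ *: 1]mulr1.
have [c cab cmax] : exists2 c, c \in `[pm, pp]%R & forall x, x \in `[pm, pp]%R -> phi x <= phi c.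
  apply: EVT_max; first exact: ltW.
  apply: continuous_subspaceT => x.
  exact/differentiable_continuous/derivable1_diffP.
(* With [s] the inward direction at an end [p], a positive inward derivative makes [phi] larger
   slightly inside, so [p] cannot be a maximiser. *)
have away p s : p \in `[pm, pp]%R -> s != 0 ->
    (forall e, 0 < e -> e < pp - pm -> p + s * e \in `[pm, pp]%R) ->
    `|s| = 1 -> 0 < derive1 phi p * s -> phi p < phi c.
  move=> pI s0 sI s1 ds.
  have h0 : 0 < derive1 phi p * s / 2 by rewrite divr_gt0.
  have [dl dl0 Hdl] := derive1_expand (dphi p) h0.
  pose e := Num.min (dl / 2) ((pp - pm) / 2).
  have e0 : 0 < e by rewrite lt_min !divr_gt0// subr_gt0.
  have ed : e < dl by rewrite gt_min (_ : dl / 2 < dl)//; lra.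
  have ep : e < pp - pm by rewrite gt_min; apply/orP; right; lra.
  have := Hdl (s * e); rewrite normrM s1 mul1r (gtr0_norm e0) => /(_ ed) H.
  apply: lt_le_trans (cmax _ (sI e e0 ep)).
  move: H; rewrite ler_norml => /andP[H _].
  have : 0 < derive1 phi p * s / 2 * e by rewrite mulr_gt0.
  lra.
have cpp : c < pp.
  have := itvP cab; rewrite lt_neqAle => ->; rewrite andbT; apply/eqP => E.
  have : phi pp < phi c.
    apply: (@away pp (-1)); rewrite ?in_itv/= ?lexx ?(ltW pmpp)//.
    - by move=> e e0 el; rewrite in_itv/=; lra.
    - by rewrite normrN normr1.
    - by rewrite phi1; lra.
  by rewrite E ltxx.
have cpm : pm < c.
  have := itvP cab; rewrite lt_neqAle => ->; rewrite andbT; apply/eqP => E.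
  have : phi pm < phi c.
    apply: (@away pm 1); rewrite ?in_itv/= ?lexx ?(ltW pmpp)//.
    - by move=> e e0 el; rewrite in_itv/=; lra.
    - by rewrite normr1.
    - by rewrite phi1; lra.
  by rewrite E ltxx.
have dc : derive1 t c = h.
  have : is_derive c 1 phi 0.
    apply: (@derive1_at_max _ phi pm pp) => //; first exact: ltW.
      by rewrite in_itv/= cpm cpp.
    by move=> x; rewrite in_itv/= => /andP[x1 x2]; apply: cmax; rewrite in_itv/= !ltW.
  move=> H; have := phi1 c; rewrite derive1E derive_val => /eqP.
  by rewrite eq_sym subr_eq0 => /eqP.
have tang p : t p <= t c + h * (p - c).
  rewrite leNgt; apply/negP => Hlt.
  have K1 : 0 < 1 + `|p - c| by rewrite ltr_pwDl.
  (* Concavity transfers a violation of the tangent bound at [p] to the segment from [c] to [p];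
     close to [c] that segment stays in the interval of maximisation. *)
  have [s /andP[s0 s1] sI] : exists2 s : R, 0 < s <= 1 & s * p + (1 - s) * c \in `[pm, pp]%R.
    pose z := Num.min (c - pm) (pp - c).
    have z0 : 0 < z by rewrite lt_min !subr_gt0 cpm.
    have zp : 0 < 1 + `|p - c| + z by rewrite addr_gt0.
    exists (z / (1 + `|p - c| + z)).
      by rewrite divr_gt0//= ler_pdivrMr// mul1r lerDr ltW.
    set s := z / _.
    have sE : s * (1 + `|p - c| + z) = z by rewrite /s divfK// gt_eqF.
    have s0 : 0 < s by rewrite divr_gt0.
    have : `|s * (p - c)| <= z by rewrite normrM (gtr0_norm s0); nra.
    rewrite ler_norml => /andP[H1 H2].
    have z1 : z <= c - pm by rewrite ge_min lexx.
    have z2 : z <= pp - c by rewrite ge_min lexx orbT.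
    by rewrite in_itv/=; apply/andP; split; lra.
  have s01 : 0 <= s <= 1 by rewrite (ltW s0).
  have := conc p c s s01; have := cmax _ sI; rewrite /phi.
  have : 0 < s * (t p - (t c + h * (p - c))) by rewrite mulr_gt0// subr_gt0.
  nra.
exists c; split => //; first by rewrite cpm.
have [c0|c0] := leP c 0.
  by have := Hm c; rewrite cpm c0 dc; apply.
have [c1|c1] := leP 1 c.
  by have := Hp c; rewrite c1 cpp dc; apply.
(* Between [0] and [1], concavity with [t 1 = 0 < t pp] forces this sign. The tangent bound at [pp]
   then gives [h > 0], so [c * h - t c >= 0]. *)
have tc : t c <= 0.
  pose s := (1 - c) / (pp - c).
  have cc : 0 < pp - c by rewrite subr_gt0.
  have sE : s * (pp - c) = 1 - c by rewrite /s divfK// gt_eqF.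
  have s0 : 0 < s by rewrite divr_gt0// subr_gt0.
  have s1 : s < 1 by rewrite ltr_pdivrMr// mul1r; lra.
  have := conc pp c s; rewrite (ltW s0) (ltW s1) => /(_ isT).
  have -> : s * pp + (1 - s) * c = 1 by lra.
  have : 0 < s * t pp by rewrite mulr_gt0.
  rewrite t1; nra.
have := tang pp; nra.
Qed.

End legendre.

(** * Finiteness, concavity and differentiability of [tau] *)

Section scaling_function.
Set Implicit Arguments.
Unset Strict Implicit.
Unset Printing Implicit Defensive.
Context {R : realType} {d : measure_display} {Om : measurableType d}
  (P : probability Om R) (W : Om -> R).

(* The weights are only almost surely positive; [posw] makes them positive
   everywhere without changing their law. *)
Definition posw (x : R) : R := if 0 < x then x else 1.

Lemma posw_gt0 x : 0 < posw x.
Proof. by rewrite /posw; case: ifP. Qed.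

Lemma measurable_posw : measurable_fun setT posw.
Proof.
by apply: measurable_fun_ifT => //; apply: measurable_fun_ltr.
Qed.

Hypothesis aW : assumptionsA P W.
Let mW : measurable_fun setT W. Proof. by case: aW. Qed.
Let p0 (x s : R) : 0 <= x `^ s. Proof. exact: powR_ge0. Qed.

Lemma ae_weight_gt0 : {ae P, forall x, 0 < W x}.
Proof.
have [_ [_ _ _ PW _]] := aW.
have mA : measurable [set x | 0 < W x].
  have := mW measurableT (measurable_itv `]0, +oo[%R).
  rewrite setTI; congr measurable; apply/seteqP; split => x /=;
  by rewrite in_itv /= andbT.
exists (~` [set x | 0 < W x]); split => //; first exact: measurableC.
by rewrite probability_setC// [P _]PW subee.
Qed.

Let mWp p : measurable_fun setT (fun x => posw (W x) `^ p).
Proof.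
apply: measurable_powRf; exact: (measurableT_comp measurable_posw mW).
Qed.

Lemma Ex_posw p : Ex P (fun x => posw (W x) `^ p) = (Emom P W p)%:E.
Proof.
have [_ [_ _ _ _ /(_ p) Wp]] := aW.
have E : Ex P (fun x => posw (W x) `^ p) = (\int[P]_x (W x `^ p)%:E)%E.
  apply: ge0_ae_eq_integral => //.
  - exact/measurable_EFinP.
  - by apply/measurable_EFinP; exact: measurable_powRf.
  - by move=> x _; rewrite lee_fin.
  - by move=> x _; rewrite lee_fin.
  - by apply: filterS ae_weight_gt0 => x Wx _; rewrite /posw Wx.
have : (0 <= \int[P]_x (W x `^ p)%:E)%E by apply: integral_ge0 => x _; rewrite lee_fin.
rewrite E /Emom; move: (\int[P]_x _)%E Wp => I Ioo I0.
by rewrite fineK// ge0_fin_numE.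
Qed.

Lemma Ex_posw_lin (a b : R) p q : 0 <= a -> 0 <= b ->
  Ex P (fun x => a * posw (W x) `^ p + b * posw (W x) `^ q) =
  (a * Emom P W p + b * Emom P W q)%:E.
Proof.
move=> a0 b0; rewrite ExD; try (by move=> x; rewrite mulr_ge0);
  try exact: measurable_scale.
by rewrite !ExZ// !Ex_posw.
Qed.

Lemma Emom_ge0 p : 0 <= Emom P W p.
Proof. by rewrite -lee_fin -Ex_posw; apply: Ex_ge0. Qed.

Lemma Emom_gt0 p : 0 < Emom P W p.
Proof.
(* Integrating [1 <= t y + 1 / (t y)] for [y = W^p] bounds [1] by [t E[W^p] + E[W^(-p)] / t]; this
   [t] makes the last term less than one. *)
pose t := Emom P W (- p) + 1.
have t0 : 0 < t by rewrite ltr_pwDr// Emom_ge0.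
have : (1%:E <= (t * Emom P W p + t^-1 * Emom P W (- p))%:E)%E.
  have t0' := ltW t0.
  rewrite -Ex_posw_lin ?invr_ge0// -(Ex_cst P 1).
  apply: Ex_le => //.
    by apply: measurable_funD; exact: measurable_scale.
  move=> x; set y := posw (W x) `^ p.
  have y0 : 0 < y by rewrite powR_gt0// posw_gt0.
  have -> : posw (W x) `^ (- p) = y^-1 by rewrite powRN.
  rewrite -invfM; have ty : 0 < t * y by rewrite mulr_gt0.
  have [h|h] := leP 1 (t * y).
    by rewrite (le_trans h)// lerDl invr_ge0 ltW.
  rewrite -[leLHS]add0r lerD ?ltW//.
  by rewrite -[ltLHS]invr1 ltf_pV2 ?posrE.
rewrite lee_fin; rewrite /t in t0 *; move: (Emom P W p) (Emom P W (- p)) t0 => M M' t0 H.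
have : (M' + 1)^-1 * M' < 1 by rewrite mulrC ltr_pdivrMr// mul1r ltrDl.
by rewrite -(pmulr_rgt0 _ t0); lra.
Qed.

Lemma Emom1 : Emom P W 1 = 1.
Proof.
have [_ [EW _ _ _ _]] := aW.
apply: EFin_inj; rewrite -Ex_posw -[RHS]EW.
apply: ae_eq_integral => //.
- exact/measurable_EFinP.
- exact/measurable_EFinP.
- by apply: filterS ae_weight_gt0 => x Wx _; rewrite /posw Wx powRr1// ltW.
Qed.

Lemma Emom_logconvex a b s : 0 <= s <= 1 ->
  Emom P W (s * a + (1 - s) * b) <= Emom P W a `^ s * Emom P W b `^ (1 - s).
Proof.
move=> s01; have /andP[s0 s1] := s01.
have Ma := Emom_gt0 a; have Mb := Emom_gt0 b.
have HE := @Ex_posw_lin (s / Emom P W a) ((1 - s) / Emom P W b) a b.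
have HM := Ex_posw (s * a + (1 - s) * b).
move: (Emom P W a) (Emom P W b) (Emom P W (s * a + (1 - s) * b)) Ma Mb HE HM.
move=> A B C A0 B0 HE HM.
have D0 : 0 < A `^ s * B `^ (1 - s) by rewrite mulr_gt0 ?powR_gt0.
rewrite -[leRHS]mulr1 -ler_pdivrMl// -lee_fin EFinM -HM.
rewrite -ExZ//; last by rewrite invr_ge0 ltW.
have E1 : Ex P (fun x => s / A * posw (W x) `^ a + (1 - s) / B * posw (W x) `^ b) = 1%:E.
  rewrite HE ?divr_ge0 ?subr_ge0 ?(ltW A0) ?(ltW B0)//.
  by rewrite !divfK ?gt_eqF//; congr EFin; lra.
rewrite -E1.
apply: Ex_le => //.
- exact: measurable_scale.
- by apply: measurable_funD; exact: measurable_scale.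
- by move=> x; rewrite mulr_ge0// invr_ge0 ltW.
by move=> x; apply: weighted_young => //; exact: posw_gt0.
Qed.

Let ln2 : 0 < ln 2 :> R. Proof. by rewrite ln_gt0// ltr1n. Qed.

Lemma tau_concave a b s : 0 <= s <= 1 ->
  s * tau P W a + (1 - s) * tau P W b <= tau P W (s * a + (1 - s) * b).
Proof.
move=> s01; rewrite /tau /log2.
have := ln_le_weighted (Emom_gt0 a) (Emom_gt0 b) (Emom_gt0 _) (Emom_logconvex a b s01).
move: (Emom P W a) (Emom P W b) (Emom P W (s * a + (1 - s) * b)) => A B C.
move: (ln A) (ln B) (ln C) => La Lb Lc H.
have : Lc / ln 2 <= s * (La / ln 2) + (1 - s) * (Lb / ln 2).
  by rewrite ler_pdivrMr// mulrDl -!mulrA mulVf ?mulr1// gt_eqF.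
lra.
Qed.

Lemma tau1 : tau P W 1 = 0.
Proof. by rewrite /tau Emom1 /log2 ln1 mul0r; lra. Qed.

Lemma EmomE p : Emom P W p = 2 `^ (p - 1 - tau P W p).
Proof.
rewrite /tau /powR pnatr_eq0 /= /log2.
move: (Emom P W p) (Emom_gt0 p) => M M0.
have -> : (p - 1 - (p - ln M / ln 2 - 1)) * ln 2 = ln M.
  by field; rewrite gt_eqF.
by rewrite lnK.
Qed.

Lemma derivable_Emom (p : R) : derivable (Emom P W) p 1.
Proof.
pose f (p : R) y := posw (W y) `^ p.
have f0 q y : 0 <= f q y by exact: powR_ge0.
have -> : Emom P W = (fun p => \int[P]_(y in setT) f p y)%R.
  by apply/funext => q; rewrite /Rintegral -[X in fine X]/(Ex P (f q)) Ex_posw.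
have fE q y : f q y = expR (q * ln (posw (W y))).
  by rewrite /f /powR gt_eqF// posw_gt0.
have df (q : R) y : is_derive q 1 (f^~ y) (f q y * ln (posw (W y))).
  have -> : f^~ y = expR \o (fun q => q * ln (posw (W y))).
    by apply/funext => q'; rewrite fE.
  rewrite fE; apply: is_derive1_comp.
  have : is_derive q 1 ((@id R) * cst (ln (posw (W y)))) (ln (posw (W y))).
    by apply: is_derive_eq; rewrite scaler0 add0r [_ *: 1]mulr1.
  by [].
(* Dominating function: the derivative in [q] is at most [x ^ (q + 1) + x ^ (q - 1)] in absolute
   value, and for [q] within [1] of [p] both orders lie between [p - 2] and [p + 2]. *)
pose G y := 2 * posw (W y) `^ (p - 2) + 2 * posw (W y) `^ (p + 2).
have intf q : P.-integrable setT (EFin \o f q).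
  apply/integrableP; split; first by apply/measurable_EFinP; exact: mWp.
  rewrite (eq_integral (fun x => (f q x)%:E)); last first.
    by move=> x _ /=; rewrite ger0_norm.
  by rewrite -/(Ex P (f q)) Ex_posw ltry.
have G0 y : 0 <= G y by rewrite addr_ge0// mulr_ge0.
apply: (@derivable_under_integral _ _ _ P f setT _ p (p - 1) (p + 1) _ _ _ G) => //.
- by rewrite /= in_itv/=; lra.
- apply/integrableP; split.
    by apply/measurable_EFinP; apply: measurable_funD; exact: measurable_scale.
  rewrite (eq_integral (fun x => (G x)%:E)); last first.
    by move=> x _ /=; rewrite ger0_norm.
  by rewrite -/(Ex P G) Ex_posw_lin// ltry.
move=> q y; rewrite /= in_itv/= => /andP[q1 q2] _.
rewrite /partial1of2 derive1E (@derive_val _ _ _ _ _ _ _ (df q y)).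
rewrite /f /G; set x := posw (W y); have x0 : 0 < x by exact: posw_gt0.
have lnx : `|ln x| <= x + x^-1.
  have H (z : R) : 0 < z -> ln z <= z.
    move=> z0; have z1 : -1 < z - 1 by lra.
    have := le_ln1Dx z1.
    have -> : 1 + (z - 1) = z by ring.
    lra.
  have xi : 0 < x^-1 by rewrite invr_gt0.
  have h1 := H _ x0; have h2 := H _ xi; rewrite lnV ?posrE// in h2.
  by rewrite ler_norml; apply/andP; split; lra.
rewrite normrM ger0_norm//.
have B (z : R) : p - 2 <= z <= p + 2 -> x `^ z <= x `^ (p - 2) + x `^ (p + 2).
  move=> /andP[z1 z2]; have [x1|x1] := leP x 1.
    by rewrite (@le_trans _ _ (x `^ (p - 2))) ?ger_powR ?x0// lerDl.
  by rewrite (@le_trans _ _ (x `^ (p + 2))) ?ler_powR ?(ltW x1)// lerDr.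
have xz : x `^ q * (x + x^-1) = x `^ (q + 1) + x `^ (q - 1).
  rewrite mulrDr !powRD ?(gt_eqF x0) ?implybT// powRr1 ?(ltW x0)//.
  by rewrite powR_inv1// ltW.
have := ler_wpM2l (p0 x q) lnx; rewrite xz.
have b1 := B (q + 1); have b2 := B (q - 1).
have {}b1 : x `^ (q + 1) <= x `^ (p - 2) + x `^ (p + 2) by apply: b1; lra.
have {}b2 : x `^ (q - 1) <= x `^ (p - 2) + x `^ (p + 2) by apply: b2; lra.
lra.
Qed.

Lemma derivable_tau (p : R) : derivable (tau P W) p 1.
Proof.
have M0 := Emom_gt0 p.
have -> : tau P W = (@id R) - ((@ln R \o Emom P W) * cst (ln 2)^-1) - cst 1 by apply/funext.
have dl : derivable (@ln R \o Emom P W) p 1.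
  have /derivableP h := @derivable_Emom p.
  exact: (@ex_derive _ _ _ _ _ _ _ (is_derive1_comp (is_derive1_ln M0) h)).
apply: derivableB; last exact: derivable_cst.
apply: derivableB; first exact: derivable_id.
by apply: derivableM; [exact: dl|exact: derivable_cst].
Qed.

End scaling_function.

(** * From moment bounds to almost sure bounds *)

Section almost_sure.
Set Implicit Arguments.
Unset Strict Implicit.
Unset Printing Implicit Defensive.
Context {R : realType} {d : measure_display} {Om : measurableType d}
  (P : probability Om R).

Lemma limn_esup_le_near (u : (\bar R)^nat) b :
  (\forall n \near \oo, (u n <= b)%E) -> (limn_esup u <= b)%E.
Proof.
move=> ub; apply: (@le_trans _ _ (ereal_sup (u @` [set n | (u n <= b)%E]))).
  by apply: ereal_inf_lbound; exists [set n | (u n <= b)%E].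
by apply: ge_ereal_sup => _ [n /= un <-].
Qed.

Lemma limn_einf_ge_near (u : (\bar R)^nat) b :
  (\forall n \near \oo, (b <= u n)%E) -> (b <= limn_einf u)%E.
Proof.
move=> ub; rewrite /limn_einf leeNr; apply: limn_esup_le_near.
by apply: filterS ub => n; rewrite leeN2.
Qed.

Lemma limn_einf_le_near (u : (\bar R)^nat) b :
  (\forall n \near \oo, (u n <= b)%E) -> (limn_einf u <= b)%E.
Proof. by move=> ub; apply: (le_trans (limn_einf_sup _)); exact: limn_esup_le_near. Qed.

Lemma le_limn_esup (u v : (\bar R)^nat) : (forall n, (u n <= v n)%E) ->
  (limn_esup u <= limn_esup v)%E.
Proof.
move=> uv; apply: le_ereal_inf_tmp => _ [V FV <-].
apply: (@le_trans _ _ (ereal_sup (u @` V))).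
  by apply: ereal_inf_lbound; exists V.
apply: ge_ereal_sup => _ [n Vn <-]; apply: (le_trans (uv n)).
by apply: ereal_sup_ubound; exists n.
Qed.

Lemma le_limn_einf (u v : (\bar R)^nat) : (forall n, (u n <= v n)%E) ->
  (limn_einf u <= limn_einf v)%E.
Proof. by move=> uv; rewrite leeN2; apply: le_limn_esup => n; rewrite leeN2. Qed.

Lemma cvg_limn_esup_einf (u : (\bar R)^nat) l : (limn_esup u <= l)%E ->
  (l <= limn_einf u)%E -> u @ \oo --> l.
Proof.
move=> ul lu.
have ? : limn_esup u = l by apply/eqP; rewrite eq_le ul (le_trans lu)// limn_einf_sup.
have ? : limn_einf u = l by apply/eqP; rewrite eq_le lu (le_trans (limn_einf_sup _)).
have H1 : einfs u @ \oo --> l.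
  have := @cvg_einfs_sup _ u.
  by rewrite -(cvg_lim _ (@cvg_einfs_sup _ u))// -limn_einf_lim; congr (_ --> _).
have H2 : esups u @ \oo --> l.
  have := @cvg_esups_inf _ u.
  by rewrite -(cvg_lim _ (@cvg_esups_inf _ u))// -limn_esup_lim; congr (_ --> _).
apply: squeeze_cvge H1 H2; apply: nearW => n; apply/andP; split.
  by apply: ereal_inf_lbound; exists n => /=.
by apply: ereal_sup_ubound; exists n => /=.
Qed.

Lemma measurable_limn_einf d' (T' : measurableType d') (u : nat -> T' -> \bar R) :
  (forall n, measurable_fun setT (u n)) ->
  measurable_fun setT (fun x => limn_einf (u ^~ x)).
Proof.
move=> mu; apply: measurableT_comp => //.
by apply: (@measurable_fun_limn_esup _ _ _ _ (fun n x => - u n x)%E) => n; exact: measurableT_comp.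
Qed.

Lemma fatou_le (u : nat -> Om -> R) b : (forall n, measurable_fun setT (u n)) ->
  (forall n x, 0 <= u n x) -> (forall n, (Ex P (u n) <= b)%E) ->
  (\int[P]_x limn_einf (fun n => (u n x)%:E) <= b)%E.
Proof.
move=> mu u0 ub; apply: le_trans.
  apply: (@fatou _ _ _ P setT measurableT (fun n x => (u n x)%:E)).
  - by move=> n; exact/measurable_EFinP.
  - by move=> n x _; rewrite lee_fin.
by apply: limn_einf_le_near; apply: nearW => n; exact: ub.
Qed.

Lemma borel_cantelli (E : nat -> set Om) (C r : R) : 0 <= C -> 0 <= r < 1 ->
  (forall j, measurable (E j)) -> (forall j, P (E j) <= (C * r ^+ j)%:E)%E ->
  {ae P, forall om, \forall j \near \oo, ~ E j om}.
Proof.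
move=> C0 /andP[r0 r1] mE PE.
have PE0 : P (lim_sup_set E) = 0%E.
  apply: lim_sup_set_cvg0 => //.
  apply: (@le_lt_trans _ _ (C * (1 - r)^-1)%:E); last exact: ltry.
  apply: lime_le.
    by apply: is_cvg_ereal_nneg_natsum_cond.
  apply: nearW => n.
  apply: (@le_trans _ _ (series (geometric C r) n)%:E).
    by rewrite /series/= -sumEFin; apply: lee_sum => i _; exact: PE.
  rewrite lee_fin geometric_seriesE ?lt_eqF//= -mulrA ler_wpM2l//.
  rewrite -[leRHS]mul1r ler_wpM2r//.
    by rewrite invr_ge0 subr_ge0 ltW.
  by rewrite gerBl exprn_ge0.
exists (lim_sup_set E); split => //.
  by apply: bigcap_measurable => // n _; apply: bigcup_measurable.
move=> om /= H n _; apply: contrapT => nE; apply: H; exists n => // j /= nj Ej.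
by apply: nE; exists j.
Qed.

Lemma markov_ereal (u : Om -> \bar R) (c K : R) : 0 < c -> measurable_fun setT u ->
  (forall x, 0 <= u x)%E -> (\int[P]_x u x <= K%:E)%E ->
  (P [set x | c%:E <= u x] <= (K / c)%:E)%E.
Proof.
move=> c0 mu u0 uK.
have := @le_integral_comp_abse _ _ _ P setT measurableT u c id (@measurable_id _ _ _)
   (fun _ => id) (fun _ _ _ _ => id) mu c0.
rewrite setTI (eq_integral u); last by move=> x _; rewrite gee0_abs.
have -> : [set x | (c%:E <= `|u x|)%E] = [set x | (c%:E <= u x)%E].
  by apply/seteqP; split => x /=; rewrite gee0_abs.
move=> /le_trans/(_ uK).
by rewrite muleC -lee_pdivlMr// EFinM.
Qed.

(** Giving up [e] in the exponent gains a factor [2 ^ (- j e)] in Markov's inequality, which is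
    summable. *)
Lemma ae_eventually_le (S : nat -> Om -> \bar R) (K a e : R) : 0 < e -> 
  (forall j, measurable_fun setT (S j)) -> (forall j x, 0 <= S j x)%E ->
  (forall j, \int[P]_x S j x <= (K * 2 `^ (j%:R * a))%:E)%E ->
  {ae P, forall om, \forall j \near \oo, (S j om <= (2 `^ (j%:R * (a + e)))%:E)%E}.
Proof.
move=> e0 mS S0 HS.
have K0 : 0 <= K.
  have := HS 0%N; rewrite mul0r powRr0 mulr1 => H.
  by rewrite -lee_fin; apply: le_trans H; apply: integral_ge0.
have := @borel_cantelli (fun j => [set x | ((2 `^ (j%:R * (a + e)))%:E <= S j x)%E])
   K (2 `^ (- e)) K0.
have r01 : 0 <= (2 `^ (- e) : R) < 1.
  by rewrite powR_ge0/= -[ltRHS](powRr0 2) ltr_pow2 oppr_lt0.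
move=> /(_ r01) H; apply: filterS (H _ _) => [om|j|j].
- by apply: filterS => j /= /negP; rewrite -ltNge => /ltW.
- by rewrite -[X in measurable X]setTI; exact: emeasurable_fun_c_infty.
apply: le_trans (markov_ereal _ (mS j) (S0 j) (HS j)) _; first by rewrite powR_gt0.
rewrite lee_fin -mulrA ler_wpM2l//.
rewrite -powR_mulrn ?powR_ge0// -powRrM -powRN -powRD ?pnatr_eq0 ?implybT//.
by rewrite le_eqVlt; apply/orP; left; apply/eqP; congr (_ `^ _); ring.
Qed.

End almost_sure.

(** * Continuous test functions around an interval *)

Section bumps.
Set Implicit Arguments.
Unset Strict Implicit.
Unset Printing Implicit Defensive.
Context {R : realType}.
Implicit Types (s x y a b : R).

(** Weak convergence only tests continuous functions: [outer] and [inner] bracket the indicator of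
    [[a, b]] with slope [s], and [tent] localises at a point. *)
Definition tent s x y := Num.max 0 (1 - s * `|y - x|).
Definition outer s a b y := Num.max 0 (Num.min 1 (Num.min (1 - s * (a - y)) (1 - s * (y - b)))).
Definition inner s a b y := Num.max 0 (Num.min 1 (Num.min (s * (y - a)) (s * (b - y)))).

Let id_cont : continuous (@id R). Proof. by move=> z; exact: cvg_id. Qed.
Let cst_cont (c : R) : continuous (fun _ : R => c). Proof. by move=> z; exact: cvg_cst. Qed.
Let subr_cont (u v : R -> R) : continuous u -> continuous v -> continuous (fun y => u y - v y).
Proof. by move=> cu cv z; apply: cvgB; [exact: cu|exact: cv]. Qed.
Let mulr_cont (c : R) (u : R -> R) : continuous u -> continuous (fun y => c * u y).
Proof. by move=> cu z; apply: cvgM; [exact: cvg_cst|exact: cu]. Qed.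
Let max_cont (u v : R -> R) : continuous u -> continuous v ->
  continuous (fun y => Num.max (u y) (v y)).
Proof. by move=> cu cv z; apply: (@continuous_max R _ u v); [exact: cu|exact: cv]. Qed.
Let min_cont (u v : R -> R) : continuous u -> continuous v ->
  continuous (fun y => Num.min (u y) (v y)).
Proof. by move=> cu cv z; apply: (@continuous_min R _ u v); [exact: cu|exact: cv]. Qed.
Let norm_cont (u : R -> R) : continuous u -> continuous (fun y => `|u y|).
Proof. by move=> cu z; apply: cvg_norm; exact: cu. Qed.

Lemma continuous_tent s x : continuous (tent s x).
Proof.
apply: max_cont => //; apply: subr_cont => //; apply: mulr_cont.
by apply: norm_cont; apply: subr_cont.
Qed.

Lemma continuous_outer s a b : continuous (outer s a b).
Proof.
apply: max_cont => //; apply: min_cont => //; apply: min_cont;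
by apply: subr_cont => //; apply: mulr_cont; apply: subr_cont.
Qed.

Lemma continuous_inner s a b : continuous (inner s a b).
Proof.
apply: max_cont => //; apply: min_cont => //; apply: min_cont;
by apply: mulr_cont; apply: subr_cont.
Qed.

Lemma tent_ge0 s x y : 0 <= tent s x y. Proof. by rewrite le_max lexx. Qed.
Lemma outer_ge0 s a b y : 0 <= outer s a b y. Proof. by rewrite le_max lexx. Qed.
Lemma inner_ge0 s a b y : 0 <= inner s a b y. Proof. by rewrite le_max lexx. Qed.

Lemma tent_le1 s x y : 0 <= s -> tent s x y <= 1.
Proof. by move=> s0; rewrite ge_max ler01/= gerBl mulr_ge0. Qed.

Lemma outer_le1 s a b y : outer s a b y <= 1.
Proof. by rewrite ge_max ler01/= ge_min lexx. Qed.

Lemma inner_le1 s a b y : inner s a b y <= 1.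
Proof. by rewrite ge_max ler01/= ge_min lexx. Qed.

Lemma tent_center s x : tent s x x = 1.
Proof. by rewrite /tent subrr normr0 mulr0 subr0 max_r. Qed.

Lemma tent_eq0 s x y : 0 < s -> s^-1 <= `|y - x| -> tent s x y = 0.
Proof. by move=> s0 h; rewrite /tent max_l// subr_le0 -ler_pdivrMl// mulr1. Qed.

Lemma outer_eq1 s a b y : 0 <= s -> a <= y <= b -> outer s a b y = 1.
Proof.
move=> s0 /andP[ay yb].
have h1 : 1 <= 1 - s * (a - y) by rewrite lerBrDr gerDl mulr_ge0_le0// subr_le0.
have h2 : 1 <= 1 - s * (y - b) by rewrite lerBrDr gerDl mulr_ge0_le0// subr_le0.
by rewrite /outer (@min_l _ _ 1) ?max_r// le_min h1.
Qed.

Lemma inner_eq0 s a b y : 0 <= s -> (y <= a) || (b <= y) -> inner s a b y = 0.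
Proof.
move=> s0 h; rewrite /inner max_l// !ge_min.
by case/orP: h => h; apply/orP; right; apply/orP; [left|right];
   rewrite mulr_ge0_le0// subr_le0.
Qed.

(** The bracketing error is concentrated near the two endpoints, so it is harmless when these carry
    little mass. *)
Lemma outer_le_inner_tent s a b y : 0 <= s ->
  outer s a b y <= inner s a b y + (tent s a y + tent s b y).
Proof.
move=> s0.
have I0 := inner_ge0 s a b y; have ta := tent_ge0 s a y; have tb := tent_ge0 s b y.
have [ya|ay] := leP y a.
  have tE : 1 - s * (a - y) <= tent s a y.
    by rewrite le_max [`|_|]ler0_norm ?subr_le0// opprB lexx orbT.
  rewrite ge_max !addr_ge0//= !ge_min; apply/orP; right; apply/orP; left.
  by lra.
have [by_|yb] := leP b y.
  have tE : 1 - s * (y - b) <= tent s b y.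
    by rewrite le_max [`|_|]ger0_norm ?subr_ge0// lexx orbT.
  rewrite ge_max !addr_ge0//= !ge_min; apply/orP; right; apply/orP; right.
  by lra.
apply: (le_trans (outer_le1 _ _ _ _)).
have h1 : 1 - s * (y - a) <= tent s a y.
  by rewrite le_max [`|_|]gtr0_norm ?subr_gt0// lexx orbT.
have h2 : 1 - s * (b - y) <= tent s b y.
  by rewrite le_max [`|_|]ltr0_norm ?subr_lt0// opprB lexx orbT.
have : Num.min 1 (Num.min (s * (y - a)) (s * (b - y))) <= inner s a b y.
  by rewrite le_max lexx orbT.
by case: (leP (s * (y - a)) (s * (b - y))) => _;
  [case: (leP 1 (s * (y - a)))|case: (leP 1 (s * (b - y)))] => _; lra.
Qed.

End bumps.

(** * Lebesgue integrals over dyadic cells *)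

Section weak_limits.
Set Implicit Arguments.
Unset Strict Implicit.
Unset Printing Implicit Defensive.
Context {R : realType}.
Variable T : R.
Hypothesis T0 : 0 < T.

Local Notation leb := (@lebesgue_measure R).

Lemma measurable_Ijk j k : measurable (Ijk T j k). Proof. exact: measurable_itv. Qed.

Lemma Ijk_length j k : leb (Ijk T j k) = ((2 ^+ j)^-1 * T)%:E.
Proof.
have p : (0 : R) < (2 ^+ j)^-1 * T by rewrite mulr_gt0// invr_gt0 exprn_gt0.
rewrite /Ijk lebesgue_measure_itv/= lte_fin.
have -> : k.+1%:R * (2 ^+ j)^-1 * T = k%:R * (2 ^+ j)^-1 * T + (2 ^+ j)^-1 * T.
  by rewrite -natr1 !mulrDl mul1r.
by rewrite ltrDl p -EFinB addrAC subrr add0r.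
Qed.

Lemma integrable_Ijk (f : R -> R) j k : continuous f -> leb.-integrable (Ijk T j k) (EFin \o f).
Proof.
move=> cf; apply: continuous_compact_integrable; first exact: segment_compact.
exact: continuous_subspaceT.
Qed.

Lemma Rintegral_Ijk_cst j k c : Rintegral leb (Ijk T j k) (fun=> c) = c * ((2 ^+ j)^-1 * T).
Proof.
rewrite Rintegral_cst; last exact: measurable_Ijk.
by congr (_ * _); exact: (congr1 fine (Ijk_length j k)).
Qed.

Lemma Rintegral_Ijk_le (f g : R -> R) j k : continuous f -> continuous g ->
  (forall y, Ijk T j k y -> f y <= g y) ->
  Rintegral leb (Ijk T j k) f <= Rintegral leb (Ijk T j k) g.
Proof.
by move=> cf cg fg; apply: le_Rintegral => //; [exact: measurable_Ijk|
  exact: integrable_Ijk|exact: integrable_Ijk].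
Qed.

(** Closed cells share endpoints; half-open intervals have the same integrals, are disjoint and glue
    together. *)
Lemma sum_Rintegral_Ijk (f : R -> R) n N : continuous f -> (forall y, 0 <= f y) ->
  ((\sum_(k < N) Rintegral leb (Ijk T n k) f)%:E =
   \int[leb]_(y in `[0%R, (N%:R * (2 ^+ n)^-1 * T)%R[%classic) (f y)%:E)%E.
Proof.
move=> cf f0.
have mf D : measurable D -> measurable_fun D (fun y => (f y)%:E).
  move=> mD; apply: (measurable_funS measurableT) => //.
  by apply/measurable_EFinP; exact: continuous_measurable_fun.
elim: N => [|N IH].
  by rewrite big_ord0 !mul0r set_itv_ge ?integral_set0// bnd_simp ltxx.
rewrite big_ord_recr/= EFinD IH.
have c0 (k : nat) : (0 : R) <= k%:R * (2 ^+ n)^-1 * T.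
  by rewrite !mulr_ge0// ?invr_ge0 ?exprn_ge0// ltW.
have cN : (N%:R * (2 ^+ n)^-1 * T : R) <= N.+1%:R * (2 ^+ n)^-1 * T.
  by rewrite !ler_pM2r// ?invr_gt0 ?exprn_gt0// ler_nat.
have -> : (Rintegral leb (Ijk T n N) f)%:E =
   (\int[leb]_(y in `[(N%:R * (2 ^+ n)^-1 * T)%R, (N.+1%:R * (2 ^+ n)^-1 * T)%R[%classic) (f y)%:E)%E.
  rewrite /Rintegral fineK.
    by rewrite integral_itv_bndo_bndc//; exact: mf.
  by apply: (integrable_fin_num _ (integrable_Ijk n N cf)); exact: measurable_itv.
rewrite (@itv_bndbnd_setU _ _ (BLeft 0) (BLeft (N%:R * (2 ^+ n)^-1 * T))
  (BLeft (N.+1%:R * (2 ^+ n)^-1 * T))) ?bnd_simp//.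
rewrite ge0_integral_setU//.
- by apply: mf; exact: measurableU.
- by move=> y _; rewrite lee_fin.
apply/disj_setPS => y [/=]; rewrite !in_itv/= => /andP[_ h1] /andP[h2 _].
by move: h1; rewrite ltNge h2.
Qed.

(** The bound is the length of the support of the tent, whatever the level and the number of
    cells. *)
Lemma sum_Rintegral_tent s x n N : 0 < s ->
  \sum_(k < N) Rintegral leb (Ijk T n k) (tent s x) <= 2 / s.
Proof.
move=> s0; rewrite -lee_fin sum_Rintegral_Ijk; [|exact: continuous_tent|exact: tent_ge0].
have mt D : measurable D -> measurable_fun D (fun y => (tent s x y)%:E).
  move=> mD; apply: (measurable_funS measurableT) => //.
  by apply/measurable_EFinP; apply: continuous_measurable_fun; exact: continuous_tent.
have t0 y : (0 <= (tent s x y)%:E)%E by rewrite lee_fin tent_ge0.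
apply: (@le_trans _ _ (\int[leb]_y (tent s x y)%:E)%E).
  by apply: ge0_subset_integral => //; exact: mt.
apply: (@le_trans _ _ (\int[leb]_y (\1_(`[(x - s^-1)%R, (x + s^-1)%R]%classic) y)%:E)%E).
  apply: ge0_le_integral => //; first exact: mt.
  - by apply/measurable_EFinP; exact: measurable_indic.
  move=> y _; rewrite lee_fin indicE; case: (boolP (y \in _)) => [_|].
    by apply: tent_le1; exact: ltW.
  rewrite notin_setE /= in_itv/= => /negP; rewrite negb_and -!ltNge => h.
  rewrite tent_eq0//; rewrite leNgt; apply/negP; rewrite ltr_distl => /andP[h1 h2].
  by case/orP: h; lra.
rewrite integral_indic// setIT.
apply: (@le_trans _ _ (leb `[(x - s^-1)%R, (x + s^-1)%R]%classic)) => //.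
rewrite lebesgue_measure_itv/= lte_fin.
have si : 0 < s^-1 by rewrite invr_gt0.
case: ifP => _; last by rewrite lee_fin divr_ge0// ltW.
by rewrite -EFinB lee_fin; lra.
Qed.

End weak_limits.

(** * Weak convergence gives convergence of cell masses *)

Section cell_masses.
Set Implicit Arguments.
Unset Strict Implicit.
Unset Printing Implicit Defensive.
Context {R : realType}.
Variable T : R.
Hypothesis T0 : 0 < T.
Variable w : nat -> nat -> R.
Hypothesis w0 : forall n k, 0 <= w n k.
Variable nu : {measure set R -> \bar R}.

Local Notation leb := (@lebesgue_measure R).

Definition step_integral n (f : R -> R) :=
  \sum_(k < 2 ^ n) w n k * Rintegral leb (Ijk T n k) f.

Hypothesis wnu : forall f : R -> R, continuous f -> (exists M : R, forall x, `|f x| <= M) ->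
  (fun n => (step_integral n f)%:E) @ \oo --> (\int[nu]_x (f x)%:E)%E.

(** A quantitative absence of atoms. The expected integral of the tent is of order [2 ^ (- l)], and
    [1/2] of the exponent is given up to Borel-Cantelli. *)
Definition thin_point (x : R) := \forall l \near \oo,
  (\int[nu]_y (tent (2 ^+ l) x y)%:E <= (2 `^ (l%:R * (-1 + 2^-1)))%:E)%E.

Lemma thin_point_le x e : 0 < e -> thin_point x ->
  \forall l \near \oo, (\int[nu]_y (tent (2 ^+ l) x y)%:E <= e%:E)%E.
Proof.
move=> e0 tx; near=> l; apply: (@le_trans _ _ (2 `^ (l%:R * (-1 + 2^-1)))%:E).
  by near: l.
rewrite lee_fin; near: l; apply: near_pow2_le => //; lra.
Unshelve. all: by end_near. Qed.

Let pow2n_gt0 l : (0 : R) < 2 ^+ l. Proof. exact: exprn_gt0. Qed.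

Let mfun (f : R -> R) : continuous f -> measurable_fun setT (fun y => (f y)%:E).
Proof. by move=> cf; apply/measurable_EFinP; exact: continuous_measurable_fun. Qed.

Lemma thin_point_atom x : thin_point x -> nu [set x] = 0%E.
Proof.
move=> tx; apply/eqP; rewrite eq_le measure_ge0 andbT; apply/lee_addgt0Pr => e e0.
rewrite add0e.
have [l Hl] := filter_ex (thin_point_le e0 tx).
apply: le_trans Hl.
rewrite -(setIT [set x]) -integral_indic//.
apply: ge0_le_integral => //.
- by apply/measurable_EFinP; exact: measurable_indic.
- by apply: mfun; exact: continuous_tent.
move=> y _; rewrite lee_fin indicE; case: (boolP (y \in _)) => [|_]; last exact: tent_ge0.
by rewrite inE => /= ->; rewrite tent_center.
Qed.

Definition cell_mass j k n := \sum_(l < 2 ^ n) w (j + n) (k * 2 ^ n + l) * ((2 ^+ (j + n))^-1 * T).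

Let in_cell j n k i l y : (l < 2 ^ n)%N -> Ijk T (j + n) (i * 2 ^ n + l) y ->
  [/\ ((i < k)%N -> y <= k%:R * (2 ^+ j)^-1 * T),
      ((k < i)%N -> k.+1%:R * (2 ^+ j)^-1 * T <= y) &
      (i = k -> k%:R * (2 ^+ j)^-1 * T <= y <= k.+1%:R * (2 ^+ j)^-1 * T)].
Proof.
move=> ln; rewrite /Ijk /= in_itv/= => /andP[y1 y2].
have E (a : nat) : a%:R * (2 ^+ j)^-1 * T = (a * 2 ^ n)%:R * (2 ^+ (j + n))^-1 * T :> R.
  by rewrite natrM natrX exprD; field; rewrite !(gt_eqF (pow2n_gt0 _)).
have L (a b : nat) : (a <= b)%N -> a%:R * (2 ^+ (j + n))^-1 * T <= b%:R * (2 ^+ (j + n))^-1 * T :> R.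
  by move=> ab; rewrite !ler_pM2r// ?invr_gt0// ler_nat.
split=> [ik|ki|ik].
- rewrite E (le_trans y2)// L// -addnS (leq_trans _ (leq_mul ik (leqnn _)))//.
  by rewrite mulSn addnC leq_add2r.
- by rewrite E (le_trans _ y1)// L// (leq_trans (leq_mul ki (leqnn _)))// leq_addr.
- rewrite -ik !E (le_trans _ y1) ?L ?leq_addr//= (le_trans y2)// L//.
  by rewrite -addnS mulSn addnC leq_add2r.
Qed.

Let step_split j n (f : R -> R) : step_integral (j + n) f =
  \sum_(i < 2 ^ j) \sum_(l < 2 ^ n) w (j + n) (i * 2 ^ n + l) *
    Rintegral leb (Ijk T (j + n) (i * 2 ^ n + l)) f.
Proof.
rewrite /step_integral expnD.
by rewrite (big_ordM _ _ _ (fun k => w (j + n) k * Rintegral leb (Ijk T (j + n) k) f)).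
Qed.

Let cell_mass_split j k n : (k < 2 ^ j)%N -> cell_mass j k n =
  \sum_(i < 2 ^ j) \sum_(l < 2 ^ n) w (j + n) (i * 2 ^ n + l) *
    ((i == k :> nat)%:R * ((2 ^+ (j + n))^-1 * T)).
Proof.
move=> kj; rewrite (bigD1 (Ordinal kj))//= [X in _ + X]big1 ?addr0.
  by apply: eq_bigr => l _; rewrite eqxx mul1r.
move=> i; rewrite -val_eqE/= => /negbTE ->.
by rewrite big1// => l _; rewrite mul0r mulr0.
Qed.

(** The step masses of the cell lie between the step integrals of [inner] and [outer], whose limits
    differ by at most the integrals of two tents at thin endpoints. *)
Lemma cell_mass_cvg j k : (k < 2 ^ j)%N ->
  thin_point (k%:R * (2 ^+ j)^-1 * T) -> thin_point (k.+1%:R * (2 ^+ j)^-1 * T) ->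
  (fun n => (cell_mass j k n)%:E) @ \oo --> nu (Ijk T j k).
Proof.
move=> kj; set a := k%:R * _ * _; set b := k.+1%:R * _ * _ => ta tb.
have inner_le (s : R) n : 0 < s -> step_integral (j + n) (inner s a b) <= cell_mass j k n.
  move=> s0; rewrite step_split cell_mass_split//; apply: ler_sum => i _.
  apply: ler_sum => l _; apply: ler_wpM2l => //.
  have c := @continuous_inner _ s a b.
  rewrite -(@Rintegral_Ijk_cst _ _ T0 _ (i * 2 ^ n + l)).
  apply: Rintegral_Ijk_le => //; first by move=> z; exact: cvg_cst.
  move=> y /(@in_cell _ _ k _ _ _ (ltn_ord l))[h1 h2 _].
  have [_|ik] := eqVneq (i : nat) k; first exact: inner_le1.
  rewrite inner_eq0//; first exact: ltW.
  by move: ik; rewrite neq_ltn => /orP[/h1 ->//|/h2 ->]; rewrite orbT.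
have outer_ge (s : R) n : 0 < s -> cell_mass j k n <= step_integral (j + n) (outer s a b).
  move=> s0; rewrite step_split cell_mass_split//; apply: ler_sum => i _.
  apply: ler_sum => l _; apply: ler_wpM2l => //.
  have c := @continuous_outer _ s a b.
  rewrite -(@Rintegral_Ijk_cst _ _ T0 _ (i * 2 ^ n + l)).
  apply: Rintegral_Ijk_le => //; first by move=> z; exact: cvg_cst.
  move=> y /(@in_cell _ _ k _ _ _ (ltn_ord l))[_ _ h3].
  have [ik|ik] := eqVneq (i : nat) k; last exact: outer_ge0.
  by rewrite outer_eq1//; [exact: ltW|exact: h3].
have lim (f : R -> R) : continuous f -> (forall y, 0 <= f y <= 1) ->
    (fun n => (step_integral (j + n) f)%:E) @ \oo --> (\int[nu]_x (f x)%:E)%E.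
  move=> cf f01.
  have := wnu cf; rewrite -(cvg_shiftn j) => H.
  have -> : (fun n => (step_integral (j + n) f)%:E) = [sequence (step_integral (n + j) f)%:E]_n.
    by apply/funext => n /=; rewrite addnC.
  apply: H; exists 1 => x; have /andP[h1 h2] := f01 x.
  by rewrite ger0_norm.
have inner01 s y : 0 <= inner s a b y <= 1 by rewrite inner_ge0 inner_le1.
have outer01 s y : 0 <= outer s a b y <= 1 by rewrite outer_ge0 outer_le1.
have nu_inner (s : R) : 0 < s -> (\int[nu]_y (inner s a b y)%:E <= nu (Ijk T j k))%E.
  move=> s0; rewrite -(setIT (Ijk T j k)) -integral_indic//; last exact: measurable_Ijk.
  apply: ge0_le_integral => //.
  - by move=> y _; rewrite lee_fin inner_ge0.
  - by apply: mfun; exact: continuous_inner.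
  - by apply/measurable_EFinP; apply: measurable_indic; exact: measurable_Ijk.
  move=> y _; rewrite lee_fin indicE; case: (boolP (y \in _)) => [_|]; first exact: inner_le1.
  rewrite notin_setE /Ijk /= in_itv/= => /negP; rewrite negb_and -!ltNge => h.
  by rewrite inner_eq0//; [exact: ltW|case/orP: h => /ltW ->; rewrite ?orbT].
have nu_outer (s : R) : 0 < s -> (nu (Ijk T j k) <= \int[nu]_y (outer s a b y)%:E)%E.
  move=> s0; rewrite -(setIT (Ijk T j k)) -integral_indic//; last exact: measurable_Ijk.
  apply: ge0_le_integral => //.
  - by apply/measurable_EFinP; apply: measurable_indic; exact: measurable_Ijk.
  - by apply: mfun; exact: continuous_outer.
  move=> y _; rewrite lee_fin indicE; case: (boolP (y \in _)) => [|_]; last exact: outer_ge0.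
  by rewrite inE /Ijk /= in_itv/= => h; rewrite outer_eq1// ltW.
have gap (e : R) : 0 < e -> exists2 s : R, 0 < s &
    (\int[nu]_y (outer s a b y)%:E <= \int[nu]_y (inner s a b y)%:E + e%:E)%E.
  move=> e0; have e20 : 0 < e / 2 by rewrite divr_gt0.
  have [l [la lb]] := filter_ex (filterI (thin_point_le e20 ta) (thin_point_le e20 tb)).
  exists (2 ^+ l) => //; set s := 2 ^+ l in la lb *.
  have s0 : 0 < s by exact: exprn_gt0.
  have mt x := mfun (@continuous_tent _ s x).
  have mi := mfun (@continuous_inner _ s a b).
  have t0 x y : (0 <= (tent s x y)%:E)%E by rewrite lee_fin tent_ge0.
  apply: (@le_trans _ _ (\int[nu]_y ((inner s a b y)%:E + ((tent s a y)%:E + (tent s b y)%:E)))%E).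
    apply: ge0_le_integral => //.
    - by move=> y _; rewrite lee_fin outer_ge0.
    - by apply: mfun; exact: continuous_outer.
    - by apply: emeasurable_funD => //; apply: emeasurable_funD.
    by move=> y _; rewrite -!EFinD lee_fin; apply: outer_le_inner_tent; exact: ltW.
  rewrite ge0_integralD//; last 3 first.
  - by move=> y _; rewrite lee_fin inner_ge0.
  - by move=> y _; rewrite adde_ge0.
  - exact: emeasurable_funD.
  rewrite ge0_integralD// leeD2l// [e]splitr EFinD.
  exact: leeD.
apply: cvg_limn_esup_einf.
  apply/lee_addgt0Pr => e e0; have [s s0 Hs] := gap e e0.
  apply: (@le_trans _ _ (limn_esup (fun n => (step_integral (j + n) (outer s a b))%:E))).
    by apply: le_limn_esup => n; rewrite lee_fin outer_ge.
  have [_ ->] := cvg_limn_einf_sup (lim _ (@continuous_outer _ s a b) (outer01 s)).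
  by apply: (le_trans Hs); rewrite leeD2r// nu_inner.
apply/lee_addgt0Pr => e e0; have [s s0 Hs] := gap e e0.
apply: (le_trans (nu_outer s s0)); apply: (le_trans Hs); rewrite leeD2r//.
have [<- _] := cvg_limn_einf_sup (lim _ (@continuous_inner _ s a b) (inner01 s)).
by apply: le_limn_einf => n; rewrite lee_fin inner_le.
Qed.

End cell_masses.

(** * Dyadic points carry no mass; limits of the cell masses *)

Section masses.
Set Implicit Arguments.
Unset Strict Implicit.
Unset Printing Implicit Defensive.
Context {R : realType} {d : measure_display} {Om : measurableType d}
  (P : probability Om R) (W : Om -> R) (Wm : nat -> seq bool -> Om -> R).

Let J := [set i : nat * seq bool | i.2 != [::]].
Let X (i : nat * seq bool) := Wm i.1 i.2.

Hypothesis aW : assumptionsA P W.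
Hypothesis mWm : forall m r, r != [::] -> measurable_fun setT (Wm m r).
Hypothesis eqW : forall m r, r != [::] -> forall B : set R, measurable B ->
  P (Wm m r @^-1` B) = P (W @^-1` B).
Hypothesis iW : mutually_independent P J X.
Variable T : R.
Hypothesis T0 : 0 < T.
Variable mu : nat -> Om -> {measure set R -> \bar R}.
Hypothesis mulim : {ae P, forall om, forall m, cascade_weak_limit T Wm om m (mu m om)}.

Let mW : measurable_fun setT W. Proof. by case: aW. Qed.

Local Notation leb := (@lebesgue_measure R).

Lemma ae_foralls (Q : seq bool -> Om -> Prop) :
  (forall r, {ae P, forall om, Q r om}) -> {ae P, forall om, forall r, Q r om}.
Proof.
move=> H.
have : {ae P, forall om, forall n, if unpickle n is Some r then Q r om else True}.
  apply: (@ae_foralln _ _ _ P (fun n om => if unpickle n is Some r then Q r om else True)).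
  by move=> n; case: (unpickle n) => [r|]; [exact: H|exact: aeW].
apply: filterS => om Hom r.
have : if unpickle (pickle r) is Some r then Q r om else True := Hom (pickle r).
by rewrite pickleK.
Qed.

Lemma ae_weights_gt0 : {ae P, forall om, forall m r, r != [::] -> 0 < Wm m r om}.
Proof.
apply: ae_foralln => m; apply: ae_foralls => r.
have [->|r0] := eqVneq r [::]; first exact: aeW.
have E : [set x | 0 < Wm m r x] = Wm m r @^-1` `]0, +oo[%classic.
  by apply/seteqP; split => x /=; rewrite in_itv/= andbT.
have mE : measurable [set x | 0 < Wm m r x].
  by rewrite E -[X in measurable X]setTI; apply: mWm.
exists (~` [set x | 0 < Wm m r x]); split; first exact: measurableC.
  have [_ [_ _ _ PW _]] := aW.
  rewrite probability_setC// E eqW//.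
  have -> : W @^-1` `]0, +oo[%classic = [set x | 0 < W x].
    by apply/seteqP; split => x /=; rewrite in_itv/= andbT.
  by rewrite [P _]PW subee.
by move=> om /= H h; apply: H.
Qed.

Definition path_weight m (r : seq bool) om :=
  \prod_(i <- iota 1 (size r)) posw (Wm m (take i r) om).

(** The factor [1/2] is the halving of length at each generation; it makes the mean of the total
    mass [1]. *)
Definition total_mass m n r om := casc Wm (fun x => posw x / 2) (fun _ _ => 1) m n r om.

Definition approx_mass m j k n om :=
  (2 ^+ j)^-1 * T * path_weight m (word j k) om * total_mass m n (word j k) om.

Lemma path_weight_gt0 m r om : 0 < path_weight m r om.
Proof. by apply: prodr_gt0 => i _; exact: posw_gt0. Qed.

Lemma cweightE om m n k : (forall m r, r != [::] -> 0 < Wm m r om) ->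
  cweight Wm om m n k = path_weight m (word n k) om.
Proof.
move=> H; rewrite /cweight /path_weight size_word; apply: eq_big_seq => i.
rewrite mem_iota add1n ltnS => /andP[i0 i1].
rewrite /posw H//; rewrite -size_eq0 size_take size_word.
by case: ltnP => [_|ni]; rewrite -lt0n// (leq_trans i0).
Qed.

Lemma cell_massE om m j k n : (forall m r, r != [::] -> 0 < Wm m r om) ->
  cell_mass T (cweight Wm om m) j k n = approx_mass m j k n om.
Proof.
move=> H; rewrite /cell_mass /approx_mass /total_mass casc_sum mulr_sumr.
apply: eq_bigr => l _; rewrite cweightE// /path_weight word_cat// size_cat !size_word.
rewrite iotaD big_cat/= big_split/= mulr1.
have -> : \prod_(i <- iota 1 j) posw (Wm m (take i (word j k ++ word n l)) om) =
          \prod_(i <- iota 1 j) posw (Wm m (take i (word j k)) om).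
  apply: eq_big_seq => i; rewrite mem_iota add1n ltnS => /andP[_ ij].
  by rewrite takel_cat// size_word.
have -> : \prod_(i <- iota (1 + j) n) posw (Wm m (take i (word j k ++ word n l)) om) =
          \prod_(i <- iota 1 n) posw (Wm m (word j k ++ take i (word n l)) om).
  rewrite addnC iotaDl big_map; apply: eq_bigr => i _.
  by rewrite take_cat size_word ltnNge leq_addr/= addKn.
have -> : \prod_(i <- iota 1 n) (2^-1 : R) = (2 ^+ n)^-1.
  by rewrite big_const_seq count_predT size_iota -exprVn -Monoid.iteropE.
rewrite exprD; set A := \prod_(i <- iota 1 j) _; set B := \prod_(i <- _) _.
by field; rewrite !expf_neq0.
Qed.

(** As [E W = 1], the step measures have Lebesgue measure as mean, and for it a tent of slope
    [2 ^ l] has integral at most [2 * 2 ^ (- l)]. *)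
Lemma ae_thin_point m x : {ae P, forall om, thin_point (mu m om) x}.
Proof.
pose g l (r : seq bool) (om : Om) := Rintegral leb (Ijk T (size r) (bar r)) (tent (2 ^+ l) x).
(* Borel-Cantelli is applied to this lower limit, which is measurable by construction; weak
   convergence identifies it afterwards with the integral against [mu m om]. *)
pose S l om := limn_einf (fun n => (casc Wm posw (g l) m n [::] om)%:E).
have p2 l : (0 : R) < 2 ^+ l by exact: exprn_gt0.
have g0 l r om : 0 <= g l r om.
  rewrite /g -[leLHS](mul0r ((2 ^+ size r)^-1 * T)) -(@Rintegral_Ijk_cst _ _ T0 _ (bar r)).
  apply: Rintegral_Ijk_le.
  - by move=> z; exact: cvg_cst.
  - exact: continuous_tent.
  - by move=> y _; exact: tent_ge0.
have pw x' : 0 <= posw x' by exact/ltW/posw_gt0.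
have mc l n : measurable_fun setT (casc Wm posw (g l) m n [::]).
  apply: (measurable_wtype mWm (D := descendants m [::])).
  by apply: measurable_casc => [|r]; [exact: measurable_posw|exact: measurable_cst].
have SE l : (\int[P]_om S l om <= (2 * 2 `^ (l%:R * (- 1)))%:E)%E.
  apply: fatou_le => [n|n om|n].
  - exact: mc.
  - exact: casc_ge0.
  rewrite /Ex (expectation_casc mWm mW eqW iW); last 4 first.
  - exact: measurable_posw.
  - exact: pw.
  - by move=> r; exact: measurable_cst.
  - by move=> r om; exact: g0.
  have -> : (\int[P]_om (posw (W om))%:E)%E = 1%:E.
    have := Ex_posw aW 1; rewrite (Emom1 aW) => <-.
    by apply: eq_integral => om _; rewrite powRr1.
  rewrite -EFin_expe expr1n mul1e.
  rewrite (eq_bigr (fun k : 'I_(2 ^ n) => (Rintegral leb (Ijk T n k) (tent (2 ^+ l) x))%:E)); last first.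
    move=> k _; rewrite /g cat0s size_word bar_word//.
    exact: Ex_cst.
  rewrite sumEFin lee_fin (le_trans (sum_Rintegral_tent T0 _ _ _ (p2 l)))//.
  by rewrite ler_pM2l// mulrN1 powRN powR_mulrn.
have e0 : (0 : R) < 2^-1 by [].
have := ae_eventually_le e0 _ _ SE => H.
have {}H : {ae P, forall om, \forall l \near \oo, (S l om <= (2 `^ (l%:R * (-1 + 2^-1)))%:E)%E}.
  apply: H => [l|l om].
    by apply: measurable_limn_einf => n; apply/measurable_EFinP.
  by apply: limn_einf_ge_near; apply: nearW => n; rewrite lee_fin casc_ge0.
have pos := ae_weights_gt0.
apply: filterS3 H pos mulim => om Hom pos_om lim; rewrite /thin_point.
apply: filterS Hom => l; apply: le_trans.
have bd : exists M : R, forall y, `|tent (2 ^+ l) x y| <= M.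
  by exists 1 => y; rewrite ger0_norm ?tent_ge0// tent_le1// ltW.
have L := lim m (tent (2 ^+ l) x) (@continuous_tent _ _ _) bd.
rewrite /S (_ : (fun n => _) = (fun n => (\sum_(k < 2 ^ n) cweight Wm om m n k *
    Rintegral leb (Ijk T n k) (tent (2 ^+ l) x))%:E)); last first.
  apply/funext => n; rewrite casc_sum; congr EFin; apply: eq_bigr => k _.
  by rewrite cweightE// /path_weight size_word /g cat0s size_word bar_word.
by have [-> _] := cvg_limn_einf_sup L.
Qed.

Lemma ae_mass_cvg : {ae P, forall om, forall m j k, (k < 2 ^ j)%N ->
  (fun n => (approx_mass m j k n om)%:E) @ \oo -->
  mutilde T (fun m => mu m om) (Ijk T j (m * 2 ^ j + k))}.
Proof.
have thin : {ae P, forall om, forall m j k, thin_point (mu m om) (k%:R * (2 ^+ j)^-1 * T)}.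
  by do 3 (apply: ae_foralln => ?); exact: ae_thin_point.
have pos := ae_weights_gt0.
apply: filterS3 thin pos mulim => om th {}pos lim m j k kj.
have p2 : (0 : R) < 2 ^+ j by exact: exprn_gt0.
have -> : mutilde T (fun m => mu m om) (Ijk T j (m * 2 ^ j + k)) = mu m om (Ijk T j k).
  have I0 (a : nat) : (0 : R) <= a%:R * (2 ^+ j)^-1 * T.
    by rewrite !mulr_ge0 ?invr_ge0 ?(ltW T0)// ltW.
  have IT (a : nat) : (a <= 2 ^ j)%N -> a%:R * (2 ^+ j)^-1 * T <= T.
    move=> aj; rewrite -[leRHS]mul1r ler_pM2r// ler_pdivrMr// mul1r -natrX ler_nat//.
  have E (a : nat) : (m * 2 ^ j + a)%:R * (2 ^+ j)^-1 * T = m%:R * T + a%:R * (2 ^+ j)^-1 * T.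
    by rewrite natrD natrM natrX; field; rewrite gt_eqF.
  rewrite /mutilde (@nneseriesD1 _ _ m)//=.
  (* Another cascade [m'] meets the closed cell at most in its own endpoint [0] or [T], and neither
     is an atom. *)
  rewrite eseries0 ?adde0.
    congr (mu m om _); apply/seteqP; split => x /=; rewrite /Ijk /= !in_itv/=.
      rewrite -addnS !E => -[/andP[h1 h2] _]; apply/andP; split; lra.
    move=> /andP[h1 h2]; rewrite -addnS !E; split; first by apply/andP; split; lra.
    by rewrite (le_trans (I0 k) h1) (le_trans h2 (IT _ kj)).
  move=> m' _ /= mm'.
  have z0 : mu m' om [set 0] = 0%E.
    by apply: thin_point_atom; have := th m' 0%N 0%N; rewrite !mul0r.
  have zT : mu m' om [set T] = 0%E.
    by apply: thin_point_atom; have := th m' 0%N 1%N; rewrite expr0 invr1 !mul1r.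
  apply: (@subset_measure0 _ _ _ (mu m' om) _ ([set 0] `|` [set T])).
  - apply: measurableI => //.
    rewrite -[X in measurable X]setTI; apply: (@measurable_funD _ _ _ _ id (cst (m'%:R * T))) => //.
    exact: measurable_Ijk.
  - exact: measurableU.
  - move=> x [/=]; rewrite /Ijk /= !in_itv/= -addnS !E => /andP[h1 h2] /andP[x0 xT].
    have := I0 k; have := IT _ kj => i1 i2.
    move: mm'; rewrite neq_ltn => /orP[lt|lt].
      right; apply/eqP; rewrite eq_le xT/=.
      have : m'.+1%:R * T <= m%:R * T by rewrite ler_pM2r// ler_nat.
      by rewrite -natr1 mulrDl mul1r; lra.
    left; apply/eqP; rewrite eq_le x0 andbT.
    have : m.+1%:R * T <= m'%:R * T by rewrite ler_pM2r// ler_nat.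
    by rewrite -natr1 mulrDl mul1r; lra.
  - have h : mu m' om ([set 0] `|` [set T]) = mu m' om [set 0] by exact: measureU0.
    exact: (etrans h z0).
have := @cell_mass_cvg _ T T0 (cweight Wm om m) _ (mu m om) (lim m) j k kj (th _ _ _) (th _ _ _).
under [fun n => _]eq_fun do rewrite cell_massE//.
by apply => n l; rewrite cweightE// ltW// path_weight_gt0.
Qed.

End masses.

(** * Moment sums over all cells of the [N_T] cascades *)

Section moment_sums.
Set Implicit Arguments.
Unset Strict Implicit.
Unset Printing Implicit Defensive.
Context {R : realType} {d : measure_display} {Om : measurableType d}
  (P : probability Om R) (W : Om -> R) (Wm : nat -> seq bool -> Om -> R).

Let J := [set i : nat * seq bool | i.2 != [::]].
Let X (i : nat * seq bool) := Wm i.1 i.2.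

Hypothesis aW : assumptionsA P W.
Hypothesis mWm : forall m r, r != [::] -> measurable_fun setT (Wm m r).
Hypothesis eqW : forall m r, r != [::] -> forall B : set R, measurable B ->
  P (Wm m r @^-1` B) = P (W @^-1` B).
Hypothesis iW : mutually_independent P J X.
Variable chi : R.

Let mW : measurable_fun setT W. Proof. by case: aW. Qed.
Let p0 (x s : R) : 0 <= x `^ s. Proof. exact: powR_ge0. Qed.

Definition NT j := Num.truncn (2 `^ (j%:R * chi)).

Lemma NT_le j : (NT j)%:R <= 2 `^ (j%:R * chi).
Proof. by rewrite /NT truncn_le// powR_ge0. Qed.

Lemma measurable_poswX p : measurable_fun setT (fun x : R => posw x `^ p).
Proof. apply: measurable_powRf; exact: measurable_posw. Qed.

Lemma prodr_powR (I : eqType) (s : seq I) (F : I -> R) p : (forall i, 0 < F i) ->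
  \prod_(i <- s) F i `^ p = (\prod_(i <- s) F i) `^ p.
Proof.
move=> F0; elim: s => [|i s IH]; first by rewrite !big_nil powR1.
by rewrite !big_cons IH powRM// ltW// prodr_gt0.
Qed.

Lemma casc_path p g m j om : casc Wm (fun x => posw x `^ p) g m j [::] om =
  \sum_(k < 2 ^ j) path_weight Wm m (word j k) om `^ p * g (word j k) om.
Proof.
rewrite casc_sum; apply: eq_bigr => k _; rewrite cat0s; congr (_ * _).
by rewrite /path_weight size_word prodr_powR// => i; exact: posw_gt0.
Qed.

Lemma Ex_sum_le (u : nat -> Om -> R) (b : R) N : (forall m, measurable_fun setT (u m)) ->
  (forall m x, 0 <= u m x) -> (forall m, (Ex P (u m) <= b%:E)%E) ->
  (Ex P (fun x => \sum_(m < N) u m x)%R <= (N%:R * b)%:E)%E.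
Proof.
move=> mu u0 ub; elim: N => [|N IH].
  under [fun x => _]eq_fun do rewrite big_ord0.
  by rewrite Ex_cst mul0r.
under [fun x => _]eq_fun do rewrite big_ord_recr/=.
rewrite ExD//.
- by rewrite -natr1 mulrDl mul1r EFinD leeD.
- by apply: measurable_sum.
- by move=> x; exact: sumr_ge0.
Qed.

Lemma Ex_casc_le p (g : seq bool -> Om -> R) (b : R) m j :
  (forall r, measurable_fun setT (g r : wtype Wm (descendants m r) -> R)) ->
  (forall r x, 0 <= g r x) -> (forall r, (Ex P (g r) <= b%:E)%E) ->
  (Ex P (casc Wm (fun x => posw x `^ p)%R g m j [::]) <=
     (2 `^ (j%:R * (p - tau P W p)) * b)%:E)%E.
Proof.
move=> mg g0 gb.
rewrite /Ex (expectation_casc mWm mW eqW iW)//; last exact: measurable_poswX.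
have -> : (\int[P]_x (posw (W x) `^ p)%:E)%E = (2 `^ (p - 1 - tau P W p))%:E.
  by have := Ex_posw aW p; rewrite (EmomE aW).
apply: (@le_trans _ _ ((2 `^ (p - 1 - tau P W p))%:E ^+ j * (\sum_(k < 2 ^ j) b%:E))%E).
  by apply: lee_wpmul2l; [rewrite -EFin_expe lee_fin exprn_ge0|apply: lee_sum => k _; exact: gb].
rewrite sumEFin sumr_const card_ord -EFin_expe -EFinM lee_fin.
move: (tau P W p) => t.
rewrite -[b *+ _]mulr_natl mulrA natrX -!powR_mulrn ?powR_ge0// -powRrM -pow2D.
by rewrite le_eqVlt; apply/orP; left; apply/eqP; congr (2 `^ _ * _); ring.
Qed.

(** The leaf function [g] is a power of the total mass in the upper bound; in the lower bound it is
    the indicator of good cells, or [1] for path weights alone. *)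
Definition moment_sum p (g : nat -> seq bool -> Om -> R) j om :=
  \sum_(m < NT j) casc Wm (fun x => posw x `^ p) (g m) m j [::] om.

Lemma moment_sum_ge0 p g j om : (forall m r x, 0 <= g m r x) -> 0 <= moment_sum p g j om.
Proof. by move=> g0; apply: sumr_ge0 => m _; apply: casc_ge0. Qed.

Lemma measurable_moment_sum p (g : nat -> seq bool -> Om -> R) j :
  (forall m r, measurable_fun setT (g m r : wtype Wm (descendants m r) -> R)) ->
  measurable_fun setT (moment_sum p g j).
Proof.
move=> mg; apply: measurable_sum => m.
apply: (measurable_wtype mWm (D := descendants m [::])).
by apply: measurable_casc => //; exact: measurable_poswX.
Qed.

Lemma Ex_moment_sum p (g : nat -> seq bool -> Om -> R) (b : R) j : 0 <= b ->
  (forall m r, measurable_fun setT (g m r : wtype Wm (descendants m r) -> R)) ->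
  (forall m r x, 0 <= g m r x) -> (forall m r, (Ex P (g m r) <= b%:E)%E) ->
  (Ex P (moment_sum p g j) <= (b * 2 `^ (j%:R * (chi + p - tau P W p)))%:E)%E.
Proof.
move=> b0 mg g0 gb.
apply: (@le_trans _ _ ((NT j)%:R * (2 `^ (j%:R * (p - tau P W p)) * b))%:E).
  apply: (@Ex_sum_le (fun m => casc Wm (fun x => posw x `^ p) (g m) m j [::])).
  - move=> m; apply: (measurable_wtype mWm (D := descendants m [::])).
    by apply: measurable_casc => //; exact: measurable_poswX.
  - by move=> m x; apply: casc_ge0.
  - by move=> m; exact: Ex_casc_le.
move: (tau P W p) => t.
rewrite lee_fin mulrA [leRHS]mulrC ler_wpM2r//.
have -> : j%:R * (chi + p - t) = j%:R * chi + j%:R * (p - t) by ring.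
by rewrite pow2D ler_wpM2r// NT_le.
Qed.

Section total_mass_moments.
Variable Q : R.
Hypothesis Q1 : 1 < Q.
Hypothesis tauQ : forall q, 1 < q <= Q -> 0 < tau P W q.

Let half_posw (x : R) := posw x / 2.

Lemma Ex_half_posw q : Ex P (fun x => half_posw (W x) `^ q) = (2 `^ (- 1 - tau P W q))%:E.
Proof.
have -> : (fun x => half_posw (W x) `^ q) = (fun x => 2^-1 `^ q * posw (W x) `^ q).
  by apply/funext => x; rewrite mulrC powRM// ltW// posw_gt0.
rewrite ExZ//; last by apply: measurable_powRf; exact: (measurableT_comp measurable_posw mW).
rewrite (Ex_posw aW) (EmomE aW) -EFinM; congr EFin; move: (tau P W q) => t.
have -> : 2^-1 `^ q = 2 `^ (- q) :> R.
  by rewrite -powR_inv1// -powRrM mulN1r.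
by rewrite -pow2D; congr (2 `^ _); ring.
Qed.

Lemma total_mass_moment p : p <= Q -> bounded_moment P Wm half_posw p.
Proof.
move=> pQ.
have mh : measurable_fun setT half_posw by apply: measurable_funM => //; exact: measurable_posw.
have h0 x : 0 < half_posw x by rewrite divr_gt0// posw_gt0.
apply: (bounded_moments mWm mW eqW iW mh h0 Ex_half_posw _ Q1) => //.
- have := Ex_half_posw 1; rewrite (tau1 aW) subr0 powR_inv1// => <-.
  by congr Ex; apply/funext => x /=; rewrite powRr1// ltW.
- move=> q /tauQ tq.
  have -> : 2 * 2 `^ (-1 - tau P W q) = 2 `^ (- tau P W q).
    rewrite -{1}(@powRr1 _ 2)// -pow2D; congr (2 `^ _).
    by move: (tau P W q) => t; ring.
  by rewrite -[ltRHS](powRr0 2) ltr_pow2 oppr_lt0.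
Qed.

Lemma measurable_total_mass m n r :
  measurable_fun setT (total_mass Wm m n r : wtype Wm (descendants m r) -> R).
Proof.
apply: measurable_casc => [|s]; last exact: measurable_cst.
by apply: measurable_funM => //; exact: measurable_posw.
Qed.

Lemma total_mass_gt0 m n r om : 0 < total_mass Wm m n r om.
Proof. by apply: casc_gt0 => // x; rewrite divr_gt0// posw_gt0. Qed.

(** The index [l] runs through countably many error exponents, so one almost sure event serves them
    all. *)
Lemma ae_mass_moments p : p <= Q -> {ae P, forall om, forall l : nat, \forall j \near \oo,
  (limn_einf (fun n => (moment_sum p (fun m r x => total_mass Wm m n r x `^ p) j om)%:E) <=
   (2 `^ (j%:R * (chi + p - tau P W p + l.+1%:R^-1)))%:E)%E}.
Proof.
move=> pQ; apply: ae_foralln => l.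
have [K K0 HK] := total_mass_moment pQ.
have mg n m r : measurable_fun setT
    ((fun x => total_mass Wm m n r x `^ p) : wtype Wm (descendants m r) -> R).
  by apply: measurable_powRf; exact: measurable_total_mass.
have ms j n : measurable_fun setT (moment_sum p (fun m r x => total_mass Wm m n r x `^ p) j).
  exact: measurable_moment_sum.
have s0 j n om : 0 <= moment_sum p (fun m r x => total_mass Wm m n r x `^ p) j om.
  by apply: moment_sum_ge0.
apply: (@ae_eventually_le _ _ _ P _ K) => [|j|j om|j].
- by rewrite invr_gt0.
- by apply: measurable_limn_einf => n; apply/measurable_EFinP.
- by apply: limn_einf_ge_near; apply: nearW => n; rewrite lee_fin.
- apply: fatou_le => // n; apply: Ex_moment_sum => // m r.
  exact: HK.
Qed.

(** Path weights are controlled at every real order, which matters because the order [p + eta] of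
    the lower bound may exceed [Q]. *)
Lemma ae_path_moments p : {ae P, forall om, forall l : nat, \forall j \near \oo,
  moment_sum p (fun _ _ _ => 1) j om <=
   2 `^ (j%:R * (chi + p - tau P W p + l.+1%:R^-1))}.
Proof.
apply: ae_foralln => l.
have mg m r : measurable_fun setT ((fun=> 1) : wtype Wm (descendants m r) -> R).
  exact: measurable_cst.
have := @ae_eventually_le _ _ _ P
  (fun j om => (moment_sum p (fun _ _ _ => 1) j om)%:E) 1 (chi + p - tau P W p) (l.+1%:R^-1).
move=> H; apply: (filterS _ (H _ _ _ _)) => [om|||j om|j].
- by apply: filterS => j; rewrite lee_fin.
- by rewrite invr_gt0.
- by move=> j; apply/measurable_EFinP; exact: measurable_moment_sum.
- by rewrite lee_fin moment_sum_ge0.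
- by apply: Ex_moment_sum => // m r; rewrite Ex_cst.
Qed.

End total_mass_moments.
End moment_sums.

(** * Upper bound for the number of cells in a window *)

Section upper_bound.
Set Implicit Arguments.
Unset Strict Implicit.
Unset Printing Implicit Defensive.
Context {R : realType} {d : measure_display} {Om : measurableType d}
  (Wm : nat -> seq bool -> Om -> R).
Variables (T chi h : R) (om : Om) (mu : nat -> {measure set R -> \bar R}).
Hypothesis T0 : 0 < T.

Definition in_window j (e : R) (A : \bar R) : bool :=
  `[< ((2 `^ (- (j%:R * (h + e))))%:E <= A)%E /\ (A <= (2 `^ (- (j%:R * (h - e))))%:E)%E >].

Lemma Cj_sum j e : Cj T chi h mu j e = (\sum_(m < NT chi j) \sum_(k < 2 ^ j)
  in_window j e (mutilde T mu (Ijk T j (m * 2 ^ j + k))))%N.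
Proof.
rewrite -(big_ordM _ _ _ (fun K => in_window j e (mutilde T mu (Ijk T j K)) : nat)).
rewrite /Cj -sum1_count big_mkcond/= /Nj -/(NT chi j).
rewrite -(big_mkord xpredT (fun K => in_window j e (mutilde T mu (Ijk T j K)) : nat)).
by rewrite /index_iota subn0; apply: eq_bigr => K _; rewrite /in_window; case: asbool.
Qed.

Hypothesis mass_cvg : forall m j k, (k < 2 ^ j)%N ->
  (fun n => (approx_mass Wm T m j k n om)%:E) @ \oo -->
  mutilde T mu (Ijk T j (m * 2 ^ j + k)).

(** Only the limit is known to lie in the window; its approximations do so up to a factor [2], hence
    the shifts by [1]. *)
Lemma near_window (u : nat -> R) (A : \bar R) a b : (fun n => (u n)%:E) @ \oo --> A ->
  ((2 `^ a)%:E <= A)%E -> (A <= (2 `^ b)%:E)%E ->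
  \forall n \near \oo, 2 `^ (a - 1) <= u n /\ u n <= 2 `^ (b + 1).
Proof.
move=> uA aA Ab.
have Af : A \is a fin_num.
  by rewrite fin_numElt (lt_le_trans _ aA) ?ltNyr// (le_lt_trans Ab) ?ltry.
move: uA aA Ab; rewrite -(fineK Af); move: (fine A) => r uA; rewrite !lee_fin => ar rb.
have {}uA : u @ \oo --> r by exact: (fine_cvg uA).
near=> n; split; near: n.
  by apply: (cvgr_ge _ uA); rewrite (lt_le_trans _ ar)// ltr_pow2 gtrBl.
by apply: (cvgr_le _ uA); rewrite (le_lt_trans rb)// ltr_pow2 ltrDl.
Unshelve. all: by end_near. Qed.

Let th := log2 T.

Let path_mass m j k n := path_weight Wm m (word j k) om * total_mass Wm m n (word j k) om.

Lemma approx_massE m j k n :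
  approx_mass Wm T m j k n om = 2 `^ (th - j%:R) * path_mass m j k n.
Proof.
rewrite /approx_mass /path_mass mulrA; congr (_ * _ * _).
by rewrite pow2D pow2_log2// powRN powR_mulrn// mulrC.
Qed.

(** Exponent of a lower bound for the [p]-th power of path weight times total mass on a cell of the
    window. Dividing the cell mass by its length accounts for [j p] and [th]; the absolute values
    cover both signs of [p], and the last term also absorbs the factor [2] of [near_window]. *)
Definition window_exponent p j e : R :=
  - (j%:R * (p * h + `|p| * e)) + j%:R * p - `|p| * (1 + `|th|).

Lemma count_le_moments p j e : 0 <= e ->
  (((Cj T chi h mu j e)%:R * 2 `^ window_exponent p j e)%:E <=
   limn_einf (fun n => (moment_sum Wm chi p (fun m r x => total_mass Wm m n r x `^ p) j om)%:E))%E.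
Proof.
move=> e0; apply: limn_einf_ge_near.
(* For fixed [j] there are finitely many cells, so bounds that hold eventually in [n] hold for all
   of them at once. *)
have H : \forall n \near \oo, forall (m : 'I_(NT chi j)) (k : 'I_(2 ^ j)),
    in_window j e (mutilde T mu (Ijk T j (m * 2 ^ j + k))) ->
    2 `^ window_exponent p j e <= path_mass m j k n `^ p.
  apply: filter_forall => m; apply: filter_forall => k.
  case: (boolP (in_window _ _ _)) => [/asboolP[h1 h2]|_]; last by apply: nearW.
  have := near_window (@mass_cvg m j k (ltn_ord k)) h1 h2; apply: filterS => n [].
  rewrite approx_massE => {}h1 {}h2 _.
  have E c : 2 `^ c = 2 `^ (th - j%:R) * 2 `^ (c - (th - j%:R)) :> R.
    by rewrite -pow2D; congr (2 `^ _); ring.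
  rewrite E ler_pM2l ?pow2_gt0// in h1; rewrite [leRHS]E ler_pM2l ?pow2_gt0// in h2.
  have pm := ler_norm p; have tm := ler_norm th.
  have pn := ler_norm (- p); have tn := ler_norm (- th).
  rewrite !normrN in pn tn.
  have j0 : 0 <= j%:R :> R by [].
  have je : 0 <= j%:R * e by rewrite mulr_ge0.
  apply: (powR_ge_window h1 h2); rewrite /window_exponent.
    have a1 : `|p| * (j%:R * e) >= p * (j%:R * e) by rewrite ler_wpM2r.
    have a2 : `|p| * (1 + `|th|) >= p * (1 + th).
      apply: (le_trans (ler_norm _)); rewrite normrM ler_wpM2l//.
      by rewrite (le_trans (ler_normD _ _))// normr1.
    by lra.
  have a1 : `|p| * (j%:R * e) >= - p * (j%:R * e) by rewrite ler_wpM2r.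
  have a2 : `|p| * (1 + `|th|) >= p * (th - 1).
    apply: (le_trans (ler_norm _)); rewrite normrM ler_wpM2l//.
    by rewrite (le_trans (ler_normB _ _))// normr1 addrC.
  by lra.
apply: filterS H => n H.
rewrite lee_fin Cj_sum natr_sum mulr_suml /moment_sum; apply: ler_sum => m _.
rewrite casc_path natr_sum mulr_suml; apply: ler_sum => k _.
rewrite -powRM; [|exact/ltW/path_weight_gt0|exact/ltW/total_mass_gt0].
case: (boolP (in_window _ _ _)) => [/H|_]; first by rewrite mul1r.
by rewrite mul0r powR_ge0.
Qed.

Lemma limsup_rate_le (t p e : R) : 0 <= e ->
  (forall l : nat, \forall j \near \oo,
    (limn_einf (fun n => (moment_sum Wm chi p (fun m r x => total_mass Wm m n r x `^ p) j om)%:E) <=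
     (2 `^ (j%:R * (chi + p - t + l.+1%:R^-1)))%:E)%E) ->
  (limn_esup (rate T chi h mu e) <= (chi + (p * h - t) + `|p| * e)%:E)%E.
Proof.
move=> e0 H; apply/lee_addgt0Pr => dl dl0.
pose C := `|p| * (1 + `|th|).
have [l Hl] : exists l : nat, l.+1%:R^-1 <= dl / 2.
  have dl20 : 0 < (dl / 2)^-1 by rewrite invr_gt0 divr_gt0.
  exists (Num.truncn (dl / 2)^-1).
  by rewrite -[leRHS]invrK lef_pV2 ?posrE// ltW// truncnS_gt.
apply: limn_esup_le_near; near=> j.
have j0 : 0 < j%:R :> R by rewrite ltr0n; near: j; exists 1%N.
have jC : C / (dl / 2) <= j%:R by near: j; exact: nbhs_infty_ger.
have Hj : (limn_einf (fun n => (moment_sum Wm chi p (fun m r x => total_mass Wm m n r x `^ p) j om)%:E) <=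
     (2 `^ (j%:R * (chi + p - t + l.+1%:R^-1)))%:E)%E by near: j; exact: H.
have := le_trans (count_le_moments p j e0) Hj.
rewrite lee_fin /rate /log2n; case: eqP => [_ _|/eqP c0].
  by rewrite gt0_muleNy ?lte_fin ?invr_gt0// leNye.
move: (Cj T chi h mu j e) c0 => c c0 Hc.
have c0' : 0 < c%:R :> R by rewrite ltr0n lt0n.
rewrite -EFinM -EFinD lee_fin -ler_pdivlMl ?invr_gt0// invrK.
move: Hc; rewrite -{1}(pow2_log2 c0') -pow2D ler_pow2 /window_exponent.
move: (l.+1%:R^-1) Hl => dd Hl Hc.
have {}Hc : log2 c%:R <= j%:R * (chi + (p * h - t) + `|p| * e + dd) + C.
  by rewrite /C; move: (log2 _) Hc => x; lra.
apply: (le_trans Hc).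
have H1 : C <= j%:R * (dl / 2) by rewrite -ler_pdivrMr// divr_gt0.
have H2 : j%:R * dd <= j%:R * (dl / 2) by rewrite ler_pM2l.
by lra.
Unshelve. all: by end_near. Qed.

End upper_bound.

(** * Concentration of the tilted masses of independent cascades *)

Section good_masses.
Set Implicit Arguments.
Unset Strict Implicit.
Unset Printing Implicit Defensive.
Context {R : realType} {d : measure_display} {Om : measurableType d}
  (P : probability Om R) (W : Om -> R) (Wm : nat -> seq bool -> Om -> R).

Let J := [set i : nat * seq bool | i.2 != [::]].
Let X (i : nat * seq bool) := Wm i.1 i.2.

Hypothesis aW : assumptionsA P W.
Hypothesis mWm : forall m r, r != [::] -> measurable_fun setT (Wm m r).
Hypothesis eqW : forall m r, r != [::] -> forall B : set R, measurable B ->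
  P (Wm m r @^-1` B) = P (W @^-1` B).
Hypothesis iW : mutually_independent P J X.
Variables (chi Q : R).
Hypothesis chi0 : 0 < chi.
Hypothesis Q1 : 1 < Q.
Hypothesis tauQ : forall q, 1 < q <= Q -> 0 < tau P W q.

Let mW : measurable_fun setT W. Proof. by case: aW. Qed.
Let pR0 (x s : R) : 0 <= x `^ s. Proof. exact: powR_ge0. Qed.

(* On a good cell the rescaled mass below it stays in a fixed compact subset of
   the positive half-line, so the mass of the cell is comparable to its path weight. *)
Definition good_set (K : R) m r : set Om :=
  [set om | (limn_einf (fun n => (total_mass Wm m n r om + (total_mass Wm m n r om)^-1)%:E) <= K%:E)%E].

Definition good K m r om : R := \1_(good_set K m r) om.

Lemma good_ge0 K m r om : 0 <= good K m r om.
Proof. by rewrite /good indicE. Qed.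

Lemma good_le1 K m r om : good K m r om <= 1.
Proof. by rewrite /good indicE lern1 leq_b1. Qed.

Let measurable_spread m n r : measurable_fun setT
  ((fun om => total_mass Wm m n r om + (total_mass Wm m n r om)^-1)
    : wtype Wm (descendants m r) -> R).
Proof.
have mt := @measurable_total_mass _ _ _ Wm m n r.
apply: (measurable_funD mt).
have -> : (fun om => (total_mass Wm m n r om)^-1) = (fun om => total_mass Wm m n r om `^ (-1)).
  by apply/funext => om; rewrite powR_inv1// ltW// total_mass_gt0.
exact: measurable_powRf.
Qed.

Let measurable_good_set K m r :
  measurable (good_set K m r : set (wtype Wm (descendants m r))).
Proof.
rewrite -[X in measurable X]setTI; apply: emeasurable_fun_infty_c => //.
by apply: measurable_limn_einf => n; apply/measurable_EFinP; exact: measurable_spread.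
Qed.

Lemma measurable_good K m r :
  measurable_fun setT (good K m r : wtype Wm (descendants m r) -> R).
Proof. by apply: measurable_indic; exact: measurable_good_set. Qed.

Lemma Ex_good_ge : exists2 K, 0 < K & forall m r, ((2^-1)%:E <= Ex P (good K m r))%E.
Proof.
have [K1 K10 HK1] := total_mass_moment aW mWm eqW iW Q1 tauQ (ltW Q1).
have m1Q : -1 <= Q by rewrite (le_trans _ (ltW Q1))// (le_trans (lerN10 R)).
have [K2 K20 HK2] := total_mass_moment aW mWm eqW iW Q1 tauQ m1Q.
(* The lower limit of [Y + 1 / Y] has mean at most [K1 + K2], so Markov's inequality makes a cell
   bad with probability at most [1/2]; the added [1] keeps [K] positive. *)
pose K := 2 * (K1 + K2) + 1.
have K0 : 0 < K by rewrite ltr_wpDl// mulr_ge0// addr_ge0.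
exists K => // m r.
pose u n om := total_mass Wm m n r om + (total_mass Wm m n r om)^-1.
have mt n := measurable_wtype mWm (@measurable_total_mass _ _ _ Wm m n r).
have mu n : measurable_fun setT (u n) := measurable_wtype mWm (@measurable_spread m n r).
have t0 n om := total_mass_gt0 Wm m n r om.
have u0 n om : 0 <= u n om by rewrite addr_ge0 ?invr_ge0 ?ltW.
have uK : (\int[P]_om limn_einf (fun n => (u n om)%:E) <= (K1 + K2)%:E)%E.
  apply: fatou_le => // n.
  have -> : u n = (fun om => total_mass Wm m n r om `^ 1 + total_mass Wm m n r om `^ (-1)).
    by apply/funext => om; rewrite /u powRr1 ?powR_inv1 ?ltW.
  rewrite ExD; try (by move=> om); try (by apply: measurable_powRf; exact: mt).
  by rewrite EFinD; apply: leeD; [exact: HK1|exact: HK2].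
have mG : measurable (good_set K m r).
  apply: (sigma_algebra_measurable _ (@measurable_good_set K m r)).
  by apply: cylinders_measurable => i; exact: mWm.
have ml : measurable_fun setT (fun om => limn_einf (fun n => (u n om)%:E)).
  by apply: measurable_limn_einf => n; exact/measurable_EFinP.
have l0 om : (0 <= limn_einf (fun n => (u n om)%:E))%E.
  by apply: limn_einf_ge_near; apply: nearW => n; rewrite lee_fin.
have bad : (P (~` good_set K m r) <= (2^-1)%:E)%E.
  apply: (@le_trans _ _ (P [set om | (K%:E <= limn_einf (fun n => (u n om)%:E))%E])).
    apply: le_measure; rewrite ?inE.
    - exact: measurableC.
    - by rewrite -[X in measurable X]setTI; exact: emeasurable_fun_c_infty.
    - by move=> om /negP; rewrite -ltNge => /ltW.
  apply: (le_trans (markov_ereal K0 ml l0 uK)).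
  by rewrite lee_fin ler_pdivrMr// /K; lra.
rewrite /Ex /good integral_indic// setIT.
apply: (@le_trans _ _ (P (good_set K m r))) => //.
have : P (good_set K m r) \is a fin_num by exact: fin_num_measure.
have := bad; rewrite probability_setC//; move: (P (good_set K m r)).
case=> // x; rewrite -EFinB !lee_fin => hx _.
by lra.
Qed.

(** The power [q] replaces the usual square because only a moment slightly above the first is
    available. Below [1] the bound comes from [exp (- y) <= 1 / (1 + y)], from [1] on from
    [y <= y ^ q]. *)
Lemma expN_le (y q : R) : 0 <= y -> 1 < q <= 2 -> expR (- y) <= 1 - y + y `^ q.
Proof.
move=> y0 /andP[q1 q2].
have [y1|y1] := leP 1 y.
  have : y <= y `^ q by exact: le1r_powR (ltW q1).
  have : expR (- y) <= 1 by rewrite -expR0 ler_expR oppr_le0.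
  by lra.
have [->|yn0] := eqVneq y 0.
  by rewrite oppr0 expR0 addr0 lerDl.
have yp : 0 < y by rewrite lt_neqAle eq_sym yn0.
have h1 : y ^+ 2 <= y `^ q.
  by rewrite -powR_mulrn// ger_powR// yp ltW.
have h2 : expR (- y) <= (1 + y)^-1.
  by rewrite expRN lef_pV2 ?posrE ?expR_gt0 ?addr_gt0// expR_ge1Dx.
have h3 : (1 + y)^-1 <= 1 - y + y ^+ 2.
  rewrite -[leLHS]mul1r ler_pdivrMr ?addr_gt0//.
  have : 0 <= y * y * y by rewrite !mulr_ge0.
  by rewrite expr2; lra.
by lra.
Qed.

Lemma Ex_prod_le (u : nat -> Om -> R) (b : R) N :
  (forall m, measurable_fun setT (u m : wtype Wm (descendants m [::]) -> R)) ->
  (forall m x, 0 <= u m x) -> (forall m, (Ex P (u m) <= b%:E)%E) ->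
  (Ex P (fun x => \prod_(m < N) u m x)%R <= (b ^+ N)%:E)%E.
Proof.
move=> mu u0 ub.
have b0 : 0 <= b by rewrite -lee_fin (le_trans _ (ub 0%N))// Ex_ge0.
pose D N := [set i : nat * seq bool | (i.1 < N)%N].
have mP n : measurable_fun setT ((fun x => \prod_(m < n) u m x) : wtype Wm (D n) -> R).
  elim: n => [|n IH].
    have -> : (fun x => \prod_(m < 0) u m x) = cst 1.
      by apply/funext => x; rewrite big_ord0.
    exact: measurable_cst.
  have -> : (fun x => \prod_(m < n.+1) u m x) = (fun x => (\prod_(m < n) u m x) * u n x).
    by apply/funext => x; rewrite big_ord_recr.
  apply: measurable_funM.
    by apply: measurable_wtypeS IH => i /= h; rewrite /D /= ltnS ltnW.
  by apply: measurable_wtypeS (mu n) => i [/= e _ _]; rewrite /D /= e.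
elim: N => [|N IH].
  under [fun x => _]eq_fun do rewrite big_ord0.
  by rewrite Ex_cst expr0.
under [fun x => _]eq_fun do rewrite big_ord_recr/=.
rewrite /Ex (expectation_disjoint mWm iW (D1 := D N) (D2 := descendants N [::])).
- rewrite exprSr EFinM; apply: lee_pmul.
  + by apply: Ex_ge0 => x; exact: prodr_ge0.
  + exact: Ex_ge0.
  + exact: IH.
  + exact: ub.
- by move=> i [/= h [e _ _]]; move: h; rewrite /D /= e ltnn.
- exact: mP.
- exact: mu.
- by move=> x; exact: prodr_ge0.
- exact: u0.
Qed.

Lemma half_le_NT j : 2 `^ (j%:R * chi) / 2 <= (NT chi j)%:R.
Proof.
set x := 2 `^ _; have x1 : 1 <= x.
  by rewrite -[leLHS](powRr0 2) ler_pow2 mulr_ge0// ltW.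
have N1 : (1 <= NT chi j)%N by rewrite truncn_gt0.
have := truncnS_gt x; rewrite -natr1 => H.
have : 1 <= (NT chi j)%:R :> R by rewrite ler1n.
rewrite ler_pdivrMr//; rewrite /NT -/x; lra.
Qed.

Variables (p q chi' K : R).
Hypothesis q12 : 1 < q <= 2.
Hypothesis chi'0 : 0 < chi'.
Hypothesis chi'chi : chi' < chi.
Hypothesis tau_pq : q * tau P W p - tau P W (p * q) < (q - 1) * chi'.
Hypothesis goodK : forall m r, ((2^-1)%:E <= Ex P (good K m r))%E.

(** This is [1 / (2 E[W^p])]: the tilted weight [f] has mean [1/2], and its cascade with leaf value
    [1] has mean [1]. *)
Let c : R := 2 `^ (tau P W p - p).
Let f (x : R) := c * posw x `^ p.
Let f0 x : 0 < f x. Proof. by rewrite mulr_gt0 ?powR_gt0 ?posw_gt0. Qed.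
Let mf : measurable_fun setT f.
Proof. by apply: measurable_scale; exact: measurable_poswX. Qed.

Let tilt := fun m j om => casc Wm f (good K m) m j [::] om.

Let Exf s : Ex P (fun x => f (W x) `^ s) =
  (2 `^ (s * tau P W p - 1 - tau P W (p * s)))%:E.
Proof.
have -> : (fun x => f (W x) `^ s) = (fun x => c `^ s * posw (W x) `^ (p * s)).
  by apply/funext => x; rewrite /f powRM ?powR_ge0// -(powRrM (posw _)).
rewrite ExZ//; last by apply: measurable_powRf; exact: (measurableT_comp measurable_posw mW).
rewrite (Ex_posw aW) (EmomE aW) -EFinM /c -powRrM -pow2D; congr (2 `^ _)%:E.
by move: (tau P W p) (tau P W (p * s)) => a b; ring.
Qed.

Let Exf1 : Ex P (f \o W) = (2^-1)%:E.
Proof.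
have := Exf 1; rewrite mulr1 mul1r addrAC subrr add0r powR_inv1// => <-.
by congr Ex; apply/funext => x /=; rewrite powRr1// ltW.
Qed.

Let measurable_tilt m j : measurable_fun setT (tilt m j : wtype Wm (descendants m [::]) -> R).
Proof. by apply: measurable_casc => // r; exact: measurable_good. Qed.

Let tilt_ge0 m j om : 0 <= tilt m j om.
Proof. by apply: casc_ge0 => *; [exact: ltW|exact: good_ge0]. Qed.

Let Ex_tilt_ge m j : ((2^-1)%:E <= Ex P (tilt m j))%E.
Proof.
have fge x : 0 <= f x by exact: ltW.
rewrite /Ex (expectation_casc mWm mW eqW iW j [::] mf fge (@measurable_good K m)
  (@good_ge0 K m)).
rewrite [(\int[P]_x (f (W x))%:E)%E]Exf1.
apply: (@le_trans _ _ ((2^-1)%:E ^+ j * (\sum_(k < 2 ^ j) (2^-1)%:E))%E).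
  rewrite sumEFin sumr_const card_ord -EFin_expe -EFinM lee_fin -[_ *+ (2 ^ j)]mulr_natl.
  by rewrite mulrA natrX exprVn mulVf ?mul1r// expf_neq0.
by apply: lee_wpmul2l; [rewrite -EFin_expe lee_fin exprn_ge0|apply: lee_sum => k _; exact: goodK].
Qed.

(** Twice the [q]-th moment of [f] is [2 ^ (q tau p - tau (p q))], below [2 ^ ((q - 1) chi')] by
    [tau_pq], and the cross term has order [q / 2 <= 1], covered by the mean. Replacing the
    indicator of good cells by [1] only increases the mass. *)
Let Ex_tilt_moment : exists2 C, 0 < C &
  forall m j, (Ex P (fun x => tilt m j x `^ q)%R <= (C * 2 `^ (j%:R * ((q - 1) * chi')))%:E)%E.
Proof.
have /andP[q1 q2] := q12; have q0 : 0 < q by exact: lt_trans q1.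
have B1 := bounded_moment1 mWm mW eqW iW mf f0 Exf1.
have q21 : (0 <= q / 2 <= 1) || (1 <= q / 2 <= 0) by apply/orP; left; apply/andP; split; lra.
have [K1 K10 HK1] := bounded_moment_interp mWm mf f0 q21 B1.
have [||C C0 HC] := @casc1_moment_growth _ _ _ _ _ _ mWm mW eqW iW _ mf f0 q
  (2 `^ ((q - 1) * chi')) _ _ K1 q0 _ (Exf q) _ (Exf (q / 2)) HK1.
- by rewrite -[leLHS](powRr0 2) ler_pow2 mulr_ge0// ?ltW// subr_gt0.
- rewrite -{1}(@powRr1 _ 2)// -pow2D ltr_pow2.
  by move: tau_pq; move: (tau P W p) (tau P W (p * q)) => a b; lra.
exists (C + 1) => [|m j]; first by rewrite ltr_wpDl.
apply: (@le_trans _ _ (C * (2 `^ ((q - 1) * chi')) ^+ j)%:E); last first.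
  by rewrite lee_fin -powR_mulrn// -powRrM [_ * j%:R]mulrC ler_wpM2r// lerDl.
apply: le_trans (HC m j [::]).
have mT := measurable_wtype mWm (@measurable_tilt m j).
apply: Ex_le => //.
- exact: measurable_powRf.
- exact: (measurable_powR_casc1 mWm mf).
move=> x; apply: ge0_ler_powR; [exact: ltW|by rewrite nnegrE| |].
  by rewrite nnegrE; apply: casc_ge0 => // y; exact: ltW.
by apply: ler_casc => [y|r]; [exact: ltW|exact: good_le1].
Qed.

(** In the Laplace transform at [la] the mean gains [la / 2] per cascade, the moment of order [q]
    costs [la / 8] and the threshold [1/4] costs [la / 4]. What remains is [exp (- la N / 8)], where
    [la N] is at least of order [2 ^ (j (chi - chi'))]. *)
Lemma ae_good_mass : {ae P, forall om, \forall j \near \oo,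
  (NT chi j)%:R / 4 * 2 `^ (j%:R * (p - tau P W p)) <= moment_sum Wm chi p (good K) j om}.
Proof.
have /andP[q1 q2] := q12.
have [C C0 HC] := Ex_tilt_moment.
have q10 : 0 < q - 1 by rewrite subr_gt0.
(* Chosen so that [la ^ q] times the moment bound is exactly [la / 8]. *)
pose k0 := (8 * C) `^ (- (q - 1)^-1).
have k00 : 0 < k0 by apply: powR_gt0; rewrite mulr_gt0.
pose la j := k0 * 2 `^ (- (j%:R * chi')).
have la0 j : 0 < la j by rewrite mulr_gt0// pow2_gt0.
have laE j : la j `^ q * (C * 2 `^ (j%:R * ((q - 1) * chi'))) = la j / 8.
  rewrite -(mulr_powRB1 (ltW (la0 j)) (lt_trans ltr01 q1)) -mulrA; congr (_ * _).
  rewrite powRM ?powR_ge0// ?(ltW k00)// -!powRrM mulNr mulVf ?gt_eqF//.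
  rewrite powR_inv1 ?mulr_ge0 ?(ltW C0)// mulrACA -pow2D.
  have -> : - (j%:R * chi') * (q - 1) + j%:R * ((q - 1) * chi') = 0 by ring.
  by rewrite powRr0 mulr1; field; rewrite gt_eqF.
have mT m j := measurable_wtype mWm (@measurable_tilt m j).
have me m j (l : R) : measurable_fun setT ((fun x => expR (- (l * tilt m j x)))
    : wtype Wm (descendants m [::]) -> R).
  apply: (measurableT_comp (@measurable_expR R)).
  have -> : (fun x => - (l * tilt m j x)) = (fun x => (- l) * tilt m j x).
    by apply/funext => x; rewrite mulNr.
  exact: measurable_scale.
have Ee m j : (Ex P (fun x => expR (- (la j * tilt m j x)))%R <= (expR (- (3 / 8 * la j)))%:E)%E.
  (* The negative term of [expN_le] is moved to the left, so that all integrands stay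
     nonnegative. *)
  have H : (Ex P (fun x => expR (- (la j * tilt m j x)) + la j * tilt m j x)%R <=
      (1 + la j `^ q * (C * 2 `^ (j%:R * ((q - 1) * chi'))))%:E)%E.
    apply: Ex_le_lin1 (HC m j) => //.
    - apply: measurable_funD; first exact: (measurable_wtype mWm (me m j _)).
      exact: measurable_scale.
    - exact: measurable_powRf.
    - by move=> x; rewrite addr_ge0 ?expR_ge0// mulr_ge0// ltW.
    move=> x; rewrite -powRM// ?(ltW (la0 j))//.
    have lt0 : 0 <= la j * tilt m j x by rewrite mulr_ge0// ltW.
    by have := expN_le lt0 q12; lra.
  rewrite ExD in H; last 4 first.
  - exact: (measurable_wtype mWm (me m j _)).
  - exact: measurable_scale.
  - by move=> x; exact: expR_ge0.
  - by move=> x; rewrite mulr_ge0// ltW.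
  rewrite ExZ// in H; last exact: ltW.
  have H2 : ((la j / 2)%:E <= (la j)%:E * Ex P (tilt m j))%E.
    by rewrite EFinM; apply: lee_wpmul2l; [rewrite lee_fin ltW|exact: Ex_tilt_ge].
  have H3 := le_trans (leeD2l _ H2) H; rewrite laE in H3.
  apply: (@le_trans _ _ (1 - 3 / 8 * la j)%:E).
    rewrite -(@leeD2rE _ (la j / 2)%:E)// (le_trans H3)// -EFinD lee_fin.
    by lra.
  by rewrite lee_fin; have := @expR_ge1Dx R (- (3 / 8 * la j)).
pose bad j := [set om | \sum_(m < NT chi j) tilt m j om < (NT chi j)%:R / 4].
have mbad j : measurable (bad j).
  have ms : measurable_fun setT (fun om => \sum_(m < NT chi j) tilt m j om).
    by apply: measurable_sum => m.
  have := ms measurableT _ (measurable_itv `]-oo, (NT chi j)%:R / 4[%R); rewrite setTI.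
  by congr measurable; apply/seteqP; split => x /=; rewrite in_itv.
have Pbad j : (P (bad j) <= (16 / k0 * (2 `^ (chi' - chi)) ^+ j)%:E)%E.
  set N := NT chi j.
  pose u om := \prod_(m < N) expR (- (la j * tilt m j om)).
  have mu : measurable_fun setT u.
    by apply: measurable_prod => m _; exact: (measurable_wtype mWm (me m j _)).
  have uE om : u om = expR (- (la j * \sum_(m < N) tilt m j om)).
    by rewrite mulr_sumr -sumrN expR_sum.
  have Eu := @Ex_prod_le (fun m x => expR (- (la j * tilt m j x))) _ N
    (fun m => me m j _) (fun m x => expR_ge0 _) (fun m => Ee m j).
  have mu' : measurable_fun setT (fun om => (u om)%:E) by exact/measurable_EFinP.
  have := markov_ereal (expR_gt0 (- (la j * (N%:R / 4)))) mu' _ Eu.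
  move=> /(_ _) Hm.
  apply: (@le_trans _ _ (P [set om | ((expR (- (la j * (N%:R / 4))))%:E <= (u om)%:E)%E])).
    apply: le_measure; rewrite ?inE//.
      by rewrite -[X in measurable X]setTI; exact: emeasurable_fun_c_infty.
    by move=> om /= h; rewrite lee_fin uE ler_expR lerN2 ler_pM2l// ltW.
  apply: (le_trans (Hm _)); first by move=> om; rewrite lee_fin prodr_ge0// => m _; exact: expR_ge0.
  rewrite lee_fin -expRN opprK -expRM_natl -expRD.
  have -> : N%:R * - (3 / 8 * la j) + la j * (N%:R / 4) = - (la j * N%:R / 8).
    by field.
  have y0 : 0 < k0 / 16 * 2 `^ (j%:R * (chi - chi')) by rewrite !mulr_gt0// ?pow2_gt0// invr_gt0.
  have yle : k0 / 16 * 2 `^ (j%:R * (chi - chi')) <= la j * N%:R / 8.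
    have := half_le_NT j; rewrite -(ler_pM2l (la0 j)) -/N => h.
    have -> : k0 / 16 * 2 `^ (j%:R * (chi - chi')) = la j * (2 `^ (j%:R * chi) / 2) / 8.
      rewrite /la (_ : j%:R * (chi - chi') = - (j%:R * chi') + j%:R * chi); last by ring.
      by rewrite pow2D; field.
    by rewrite ler_wpM2r.
  (* The decay is doubly exponential in [j]; the crude bound [exp (- y) <= 1 / y] already gives a
     geometric series. *)
  apply: (@le_trans _ _ (expR (- (k0 / 16 * 2 `^ (j%:R * (chi - chi')))))).
    by rewrite ler_expR lerN2.
  have -> : 16 / k0 * 2 `^ (chi' - chi) ^+ j = (k0 / 16 * 2 `^ (j%:R * (chi - chi')))^-1.
    rewrite -powR_mulrn// -powRrM invfM invf_div; congr (_ * _).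
    by rewrite -powRN; congr (2 `^ _); ring.
  rewrite expRN lef_pV2 ?posrE ?expR_gt0//.
  by apply: (le_trans _ (expR_ge1Dx _)); rewrite lerDr.
have r01 : 0 <= (2 `^ (chi' - chi) : R) < 1.
  by rewrite powR_ge0/= -[ltRHS](powRr0 2) ltr_pow2 subr_lt0.
have C160 : 0 <= 16 / k0 by rewrite divr_ge0// ltW.
apply: filterS (borel_cantelli C160 r01 mbad Pbad) => om; apply: filterS => j.
rewrite /bad /= => /negP; rewrite -leNgt => h.
have -> : moment_sum Wm chi p (good K) j om =
    2 `^ (j%:R * (p - tau P W p)) * \sum_(m < NT chi j) tilt m j om.
  rewrite /moment_sum mulr_sumr; apply: eq_bigr => m _.
  rewrite /tilt !casc_sum mulr_sumr; apply: eq_bigr => k _.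
  rewrite mulrA; congr (_ * _).
  rewrite /f big_split/= big_const_seq count_predT size_iota -Monoid.iteropE -/(GRing.exp c j).
  rewrite mulrA /c -powR_mulrn// -powRrM -pow2D.
  have -> : j%:R * (p - tau P W p) + (tau P W p - p) * j%:R = 0.
    by move: (tau P W p) => t; ring.
  by rewrite powRr0 mul1r.
by rewrite mulrC ler_pM2l// pow2_gt0.
Qed.

End good_masses.

(** * Lower bound for the number of cells in a window *)

Section lower_bound.
Set Implicit Arguments.
Unset Strict Implicit.
Unset Printing Implicit Defensive.
Context {R : realType} {d : measure_display} {Om : measurableType d}
  (Wm : nat -> seq bool -> Om -> R).
Variables (T chi h K : R) (om : Om) (mu : nat -> {measure set R -> \bar R}).
Hypothesis T0 : 0 < T.
Hypothesis chi0 : 0 < chi.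
Hypothesis K0 : 0 < K.

Lemma limn_einf_le_frequently (u : (\bar R)^nat) b :
  (forall N, exists2 n, (N <= n)%N & (u n <= b)%E) -> (limn_einf u <= b)%E.
Proof.
move=> H; rewrite /limn_einf leeNl; apply: le_ereal_inf_tmp => _ [V [N _ NV] <-].
have [n Nn un] := H N.
apply: (@le_trans _ _ (- u n)%E); first by rewrite leeN2.
by apply: ereal_sup_ubound; exists n => //; exact: NV.
Qed.

Lemma limn_esup_ge_frequently (u : (\bar R)^nat) b :
  (forall N, exists2 n, (N <= n)%N & (b <= u n)%E) -> (b <= limn_esup u)%E.
Proof.
move=> H; apply: le_ereal_inf_tmp => _ [V [N _ NV] <-].
have [n Nn un] := H N; apply: (le_trans un).
by apply: ereal_sup_ubound; exists n => //; exact: NV.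
Qed.

Hypothesis mass_cvg : forall m j k, (k < 2 ^ j)%N ->
  (fun n => (approx_mass Wm T m j k n om)%:E) @ \oo -->
  mutilde T mu (Ijk T j (m * 2 ^ j + k)).

Let th := log2 T.
Let ka := log2 (K + 1).
Let K10 : 0 < K + 1. Proof. exact: addr_gt0. Qed.

(** A lower limit of at most [K] only provides infinitely many [n] with [Y + 1 / Y <= K + 1]. That
    is enough, because the approximate masses converge. *)
Lemma good_cell_mass m j k a b : (k < 2 ^ j)%N -> good_set Wm K m (word j k) om ->
  2 `^ a <= path_weight Wm m (word j k) om -> path_weight Wm m (word j k) om <= 2 `^ b ->
  ((2 `^ (th - j%:R + a - ka))%:E <= mutilde T mu (Ijk T j (m * 2 ^ j + k)))%E /\
  (mutilde T mu (Ijk T j (m * 2 ^ j + k)) <= (2 `^ (th - j%:R + b + ka))%:E)%E.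
Proof.
move=> kj gd pa pb.
have freq N : exists2 n, (N <= n)%N & total_mass Wm m n (word j k) om +
    (total_mass Wm m n (word j k) om)^-1 <= K + 1.
  apply: contrapT => H.
  have : ((K + 1)%:E <= limn_einf (fun n => (total_mass Wm m n (word j k) om +
      (total_mass Wm m n (word j k) om)^-1)%:E))%E.
    apply: limn_einf_ge_near; exists N => // n /= Nn; rewrite lee_fin leNgt.
    by apply/negP => lt; apply: H; exists n => //; exact: ltW.
  by move=> /le_trans/(_ gd); rewrite lee_fin gerDl ler10.
have bounds N : exists2 n, (N <= n)%N &
    2 `^ (th - j%:R + a - ka) <= approx_mass Wm T m j k n om /\
    approx_mass Wm T m j k n om <= 2 `^ (th - j%:R + b + ka).
  have [n Nn Hn] := freq N; exists n => //; rewrite approx_massE//.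
  set Y := total_mass _ _ _ _ _ in Hn *; have Y0 : 0 < Y by exact: total_mass_gt0.
  have Yi0 : 0 < Y^-1 by rewrite invr_gt0.
  have Y1 : Y <= 2 `^ ka by rewrite pow2_log2//; lra.
  have Y2 : 2 `^ (- ka) <= Y.
    rewrite powRN pow2_log2// -[leRHS]invrK lef_pV2 ?posrE//; lra.
  rewrite -(addrA (th - j%:R) a) -(addrA (th - j%:R) b) !(pow2D (th - j%:R)).
  rewrite !ler_pM2l ?pow2_gt0// !pow2D; split; apply: ler_pM => //.
  - exact/ltW/path_weight_gt0.
  - exact: ltW.
have [i1 i2] := cvg_limn_einf_sup (@mass_cvg m j k kj); split.
  rewrite -i2; apply: limn_esup_ge_frequently => N.
  by have [n Nn [h1 _]] := bounds N; exists n => //; rewrite lee_fin.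
rewrite -i1; apply: limn_einf_le_frequently => N.
by have [n Nn [_ h2]] := bounds N; exists n => //; rewrite lee_fin.
Qed.

Lemma moment_sum1 p (g : nat -> seq bool -> Om -> R) j : moment_sum Wm chi p g j om =
  \sum_(m < NT chi j) \sum_(k < 2 ^ j) path_weight Wm m (word j k) om `^ p * g m (word j k) om.
Proof. by apply: eq_bigr => m _; rewrite casc_path. Qed.

(* A cell is either in the window, or its path weight is too large or too small for
   exponent [h], in which case it is controlled by a moment of order [p + eta] or [p - eta]. *)
Lemma good_moment_le p eta e j : 0 < e -> 0 < eta ->
  ka - th <= j%:R * (e / 2) -> ka + th <= j%:R * (e / 2) ->
  moment_sum Wm chi p (good Wm K) j om <=
    (Cj T chi h mu j e)%:R * 2 `^ (j%:R * (p - p * h + `|p| * (e / 2))) +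
    2 `^ (- eta * (j%:R - j%:R * (h - e / 2))) * moment_sum Wm chi (p + eta) (fun _ _ _ => 1) j om +
    2 `^ (eta * (j%:R - j%:R * (h + e / 2))) * moment_sum Wm chi (p - eta) (fun _ _ _ => 1) j om.
Proof.
move=> e0 eta0 j1 j2.
rewrite !moment_sum1 Cj_sum natr_sum mulr_suml !mulr_sumr -!big_split/=; apply: ler_sum => m _.
rewrite natr_sum mulr_suml !mulr_sumr -!big_split/=; apply: ler_sum => k _.
rewrite !mulr1; set x := path_weight _ _ _ _; have x0 : 0 < x by exact: path_weight_gt0.
(* A path weight [2 ^ x] corresponds to a mass of about [2 ^ (x - j)]. The thresholds use [e / 2],
   and the other half of the window absorbs [T] and the bounds on the total mass. *)
set xp := j%:R - j%:R * (h - e / 2); set xm := j%:R - j%:R * (h + e / 2).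
set A := _%:R * _.
have A0 : 0 <= A by rewrite mulr_ge0 ?powR_ge0.
have B0 : 0 <= 2 `^ (- eta * xp) * x `^ (p + eta) by rewrite mulr_ge0 ?powR_ge0.
have C0 : 0 <= 2 `^ (eta * xm) * x `^ (p - eta) by rewrite mulr_ge0 ?powR_ge0.
have gx : x `^ p * good Wm K m (word j k) om <= x `^ p.
  by rewrite ler_piMr ?powR_ge0// good_le1.
have xE : x = 2 `^ log2 x by rewrite pow2_log2.
have [hx|hx] := ltP (2 `^ xp) x.
  suff : x `^ p <= 2 `^ (- eta * xp) * x `^ (p + eta) by lra.
  move: hx; rewrite xE ltr_pow2 -!powRrM -pow2D ler_pow2 => hx.
  have : 0 <= eta * (log2 x - xp) by rewrite mulr_ge0 ?subr_ge0 ?ltW.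
  by lra.
have [hx'|hx'] := ltP x (2 `^ xm).
  suff : x `^ p <= 2 `^ (eta * xm) * x `^ (p - eta) by lra.
  move: hx'; rewrite xE ltr_pow2 -!powRrM -pow2D ler_pow2 => hx'.
  have : 0 <= eta * (xm - log2 x) by rewrite mulr_ge0 ?subr_ge0 ?ltW.
  by lra.
rewrite /good indicE; case: (boolP (om \in _)) => [|_]; last by rewrite mulr0 !addr_ge0.
rewrite inE mulr1 => gd.
have [a1 a2] := good_cell_mass (ltn_ord k) gd hx' hx.
suff : x `^ p <= A by lra.
rewrite /A; case: (boolP (in_window _ _ _ _)) => [_|/asboolP[]]; last first.
  split.
    by apply: le_trans a1; rewrite lee_fin ler_pow2 /xm; lra.
  by apply: (le_trans a2); rewrite lee_fin ler_pow2 /xp; lra.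
rewrite mul1r; apply: (powR_le_window hx' hx); rewrite /xm /xp.
  have : - p * (j%:R * (e / 2)) <= `|p| * (j%:R * (e / 2)).
    rewrite ler_wpM2r//; last by rewrite -normrN ler_norm.
    by rewrite mulr_ge0// divr_ge0// ltW.
  by lra.
have : p * (j%:R * (e / 2)) <= `|p| * (j%:R * (e / 2)).
  rewrite ler_wpM2r//; last exact: ler_norm.
  by rewrite mulr_ge0// divr_ge0// ltW.
by lra.
Qed.

(** Beyond the thresholds at [e / 2] the moments of orders [p + eta] and [p - eta] gain
    [eta * (e / 2)] in the exponent. The tangent error and the almost sure error take at most
    [eta * (e / 8)] each, so these cells lose a factor [2 ^ (- j eta e / 4)] against the tilted
    mass. *)
Lemma liminf_rate_ge (p t tp tm eta e : R) (l : nat) : 0 < e -> 0 < eta ->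
  t + h * eta - eta * (e / 8) <= tp -> t - h * eta - eta * (e / 8) <= tm ->
  l.+1%:R^-1 <= eta * (e / 8) ->
  (\forall j \near \oo, (NT chi j)%:R / 4 * 2 `^ (j%:R * (p - t)) <=
     moment_sum Wm chi p (good Wm K) j om) ->
  (\forall j \near \oo, moment_sum Wm chi (p + eta) (fun _ _ _ => 1) j om <=
     2 `^ (j%:R * (chi + (p + eta) - tp + l.+1%:R^-1))) ->
  (\forall j \near \oo, moment_sum Wm chi (p - eta) (fun _ _ _ => 1) j om <=
     2 `^ (j%:R * (chi + (p - eta) - tm + l.+1%:R^-1))) ->
  ((chi + (p * h - t) - (`|p| + 1) * e)%:E <= limn_einf (rate T chi h mu e))%E.
Proof.
move=> e0 eta0 Htp Htm; move: (l.+1%:R^-1) => dl Hdl HG HP HM.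
have ee : 0 < eta * (e / 4) by rewrite mulr_gt0// divr_gt0.
apply: limn_einf_ge_near; near=> j.
have j0 : 0 < j%:R :> R by rewrite ltr0n; near: j; exists 1%N.
have e20 : 0 < e / 2 by rewrite divr_gt0.
have j1 : ka - th <= j%:R * (e / 2).
  by rewrite -ler_pdivrMr//; near: j; exact: nbhs_infty_ger.
have j2 : ka + th <= j%:R * (e / 2).
  by rewrite -ler_pdivrMr//; near: j; exact: nbhs_infty_ger.
have j3 : 4 <= j%:R * (e / 2).
  by rewrite -ler_pdivrMr//; near: j; exact: nbhs_infty_ger.
(* The good moment is at least [B / 8], so two error terms of at most [B / 32] leave [B / 16]; the
   factor [2 ^ (- 4)] is then absorbed by [j3]. *)
have j4 : 2 `^ (j%:R * (- (eta * (e / 4)))) <= 32^-1 :> R.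
  by near: j; apply: near_pow2_le; rewrite ?oppr_lt0.
have G : (NT chi j)%:R / 4 * 2 `^ (j%:R * (p - t)) <=
     moment_sum Wm chi p (good Wm K) j om by near: j.
have Mp : moment_sum Wm chi (p + eta) (fun _ _ _ => 1) j om <=
     2 `^ (j%:R * (chi + (p + eta) - tp + dl)) by near: j.
have Mm : moment_sum Wm chi (p - eta) (fun _ _ _ => 1) j om <=
     2 `^ (j%:R * (chi + (p - eta) - tm + dl)) by near: j.
have main := good_moment_le p e0 eta0 j1 j2.
pose B : R := 2 `^ (j%:R * (chi + p - t)).
have B0 : 0 < B by exact: pow2_gt0.
have GB : B / 8 <= moment_sum Wm chi p (good Wm K) j om.
  apply: le_trans G.
  have -> : B / 8 = 2 `^ (j%:R * chi) / 2 / 4 * 2 `^ (j%:R * (p - t)).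
    rewrite /B (_ : j%:R * (chi + p - t) = j%:R * chi + j%:R * (p - t)); last by ring.
    by rewrite pow2D; field.
  by rewrite ler_pM2r ?pow2_gt0// ler_pM2r// half_le_NT.
have small x y M : M <= 2 `^ y -> x + y <= j%:R * (chi + p - t) + j%:R * (- (eta * (e / 4))) ->
    2 `^ x * M <= B / 32.
  move=> My xy; apply: (@le_trans _ _ (2 `^ (x + y))).
    by rewrite pow2D ler_pM2l ?pow2_gt0.
  apply: (@le_trans _ _ (2 `^ (j%:R * (chi + p - t) + j%:R * (- (eta * (e / 4)))))).
    by rewrite ler_pow2.
  by rewrite pow2D -/B ler_pM2l.
have sp : 2 `^ (- eta * (j%:R - j%:R * (h - e / 2))) *
    moment_sum Wm chi (p + eta) (fun _ _ _ => 1) j om <= B / 32.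
  apply: small Mp _.
  have : 0 <= j%:R * (tp - (t + h * eta - eta * (e / 8)) + (eta * (e / 8) - dl)).
    by rewrite mulr_ge0 ?(ltW j0)// addr_ge0// subr_ge0.
  by lra.
have sm : 2 `^ (eta * (j%:R - j%:R * (h + e / 2))) *
    moment_sum Wm chi (p - eta) (fun _ _ _ => 1) j om <= B / 32.
  apply: small Mm _.
  have : 0 <= j%:R * (tm - (t - h * eta - eta * (e / 8)) + (eta * (e / 8) - dl)).
    by rewrite mulr_ge0 ?(ltW j0)// addr_ge0// subr_ge0.
  by lra.
have {main} cnt : B / 16 <= (Cj T chi h mu j e)%:R * 2 `^ (j%:R * (p - p * h + `|p| * (e / 2))).
  by lra.
rewrite /rate /log2n; move: (Cj T chi h mu j e) cnt => c cnt.
case: eqP => [c0|/eqP c0].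
  by move: cnt; rewrite c0 mul0r leNgt divr_gt0.
have c0' : 0 < c%:R :> R by rewrite ltr0n lt0n.
rewrite -EFinM lee_fin ler_pdivlMl//.
have B16 : B / 16 = 2 `^ (j%:R * (chi + p - t) - 4).
  by rewrite /B pow2D powR_invn// -!natrX.
move: cnt; rewrite B16 -{1}(pow2_log2 c0') -pow2D ler_pow2; move: (log2 _) => x cnt.
have : 0 <= j%:R * (`|p| * (e / 2)) by rewrite !mulr_ge0// ltW.
by lra.
Unshelve. all: by end_near. Qed.

End lower_bound.

(** * Choice of nearby orders from the derivative *)

Section exponents.
Set Implicit Arguments.
Unset Strict Implicit.
Unset Printing Implicit Defensive.
Context {R : realType} (t : R -> R) (p : R).
Hypothesis dt : derivable t p 1.

Lemma tangent_gap e : 0 < e -> exists2 eta, 0 < eta &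
  t p + derive1 t p * eta - eta * e <= t (p + eta) /\
  t p - derive1 t p * eta - eta * e <= t (p - eta).
Proof.
move=> e0; have [dl dl0 H] := derive1_expand dt e0.
have eta0 : 0 < dl / 2 by rewrite divr_gt0.
have etal : dl / 2 < dl by rewrite ltr_pdivrMr// mulr_natr mulr2n ltrDl.
exists (dl / 2) => //; move: (dl / 2) eta0 etal => eta eta0 etal.
have := H eta; rewrite gtr0_norm// => /(_ etal); rewrite ler_norml => /andP[h1 _].
have := H (- eta); rewrite normrN gtr0_norm// => /(_ etal); rewrite ler_norml => /andP[h2 _].
by split; lra.
Qed.

(** As a function of [q], [q * t p - t (p * q)] vanishes at [1] with derivative
    [t p - p * derive1 t p < chi], so a [chi'] strictly between this derivative and [chi] works for
    [q] slightly above [1]. *)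
Lemma tilt_exponents chi : 0 < chi -> - chi < p * derive1 t p - t p ->
  exists q chi', [/\ 1 < q <= 2, 0 < chi', chi' < chi & q * t p - t (p * q) < (q - 1) * chi'].
Proof.
move=> chi0 D; set h := derive1 t p in D *.
(* The midpoint between [chi] and that derivative, cut at [0] to keep [chi'] positive. *)
pose chi' := (chi + Num.max (t p - p * h) 0) / 2.
have m0 : 0 <= Num.max (t p - p * h) 0 by rewrite le_max lexx orbT.
have m1 : t p - p * h <= Num.max (t p - p * h) 0 by rewrite le_max lexx.
have m2 : Num.max (t p - p * h) 0 < chi by rewrite gt_max chi0 andbT; lra.
have c0 : 0 < chi' by rewrite divr_gt0// ltr_pwDl.
have c1 : chi' < chi by rewrite ltr_pdivrMr//; lra.
have a0 : 0 < chi' + (p * h - t p).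
  by rewrite /chi'; move: (Num.max _ _) m0 m1 m2 => M m0 m1 m2; lra.
move: chi' c0 c1 a0 => chi' c0 c1 a0.
pose a := chi' + (p * h - t p).
have p1 : 0 < `|p| + 1 by rewrite ltr_wpDl.
have e0 : 0 < a / (2 * (`|p| + 1)) by rewrite divr_gt0// mulr_gt0.
have [dl dl0 H] := derive1_expand dt e0.
(* Keeps [q <= 2] and [|p * s| < dl]; the [1] added to [|p|] covers [p = 0]. *)
pose s := Num.min 1 (dl / (2 * (`|p| + 1))).
have s0 : 0 < s by rewrite lt_min ltr01 divr_gt0// mulr_gt0.
have s1 : s <= 1 by rewrite ge_min lexx.
have s2 : s * (2 * (`|p| + 1)) <= dl.
  by rewrite -ler_pdivlMr ?mulr_gt0// ge_min lexx orbT.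
exists (1 + s), chi'; split => //.
  by apply/andP; split; lra.
have ps : `|p * s| < dl.
  rewrite normrM (gtr0_norm s0).
  have : 0 <= s * `|p| by rewrite mulr_ge0// ltW.
  by lra.
have := H _ ps; rewrite -/h ler_norml => /andP[h1 _].
have bound : a / (2 * (`|p| + 1)) * `|p * s| <= a * s / 2.
  rewrite normrM (gtr0_norm s0).
  have -> : a / (2 * (`|p| + 1)) * (`|p| * s) = a * s / 2 * (`|p| / (`|p| + 1)).
    by field; rewrite gt_eqF.
  apply: ler_piMr; first by rewrite divr_ge0// mulr_ge0// ltW.
  by rewrite ler_pdivrMr// mul1r lerDl.
have : 0 < a * s / 2 by rewrite divr_gt0// mulr_gt0.
rewrite mulrDr mulr1; rewrite /a in bound *.
move: (t (p + p * s)) h1 => tps h1.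
move: (_ / _ * `|_|) bound h1 => z bound h1.
by lra.
Qed.

End exponents.

Lemma Dleg_tangent {R : realType} {d : measure_display} {Om : measurableType d}
    (P : probability Om R) (W : Om -> R) (h p : R) :
  (forall q, tau P W q <= tau P W p + h * (q - p)) ->
  Dleg P W h = (p * h - tau P W p)%:E.
Proof.
have aux (a b q : R) : b <= a + h * (q - p) -> p * h - a <= q * h - b by lra.
move=> tang; apply/eqP; rewrite eq_le; apply/andP; split.
  by apply: ereal_inf_lbound; exists p.
by apply: le_ereal_inf_tmp => _ [q _ <-]; rewrite lee_fin; apply: aux.
Qed.

(** * Letting the width of the window vanish *)

Section rates.
Set Implicit Arguments.
Unset Strict Implicit.
Unset Printing Implicit Defensive.
Context {R : realType}.
Variables (T chi h : R) (mu : nat -> {measure set R -> \bar R}).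

Lemma Cj_le j (e e' : R) : e <= e' -> (Cj T chi h mu j e <= Cj T chi h mu j e')%N.
Proof.
move=> ee; apply: sub_count => k /asboolP[h1 h2]; apply/asboolP; split.
  by apply: le_trans h1; rewrite lee_fin ler_pow2 lerN2 ler_wpM2l// lerD2l.
by apply: (le_trans h2); rewrite lee_fin ler_pow2 lerN2 ler_wpM2l// lerD2l lerN2.
Qed.

Lemma log2n_le m n : (m <= n)%N -> (log2n m <= log2n n :> \bar R)%E.
Proof.
rewrite /log2n; case: eqP => [_ _|/eqP m0 mn]; first exact: leNye.
have m1 : (0 < m)%N by rewrite lt0n.
have n1 : (0 < n)%N by exact: leq_trans mn.
rewrite gtn_eqF// lee_fin /log2 ler_pM2r ?invr_gt0 ?ln2_gt0//.
by rewrite ler_ln ?posrE ?ltr0n// ler_nat.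
Qed.

Lemma rate_le j (e e' : R) : e <= e' -> (rate T chi h mu e j <= rate T chi h mu e' j)%E.
Proof.
move=> ee; apply: lee_wpmul2l; first by rewrite lee_fin invr_ge0.
by apply: log2n_le; exact: Cj_le.
Qed.

(** The lower bound is available only at the widths [1 / (l + 1)], countably many almost sure
    events. The count increases with the width, so small widths serve every larger [e] and yield the
    bound [v] itself. *)
Lemma rate_limits (v c1 c2 : R) : 0 <= c1 -> 0 <= c2 ->
  (forall l : nat, ((v - c1 * l.+1%:R^-1)%:E <= limn_einf (rate T chi h mu l.+1%:R^-1))%E) ->
  (forall e : R, 0 < e -> (limn_esup (rate T chi h mu e) <= (v + c2 * e)%:E)%E) ->
  ((fun e => limn_einf (rate T chi h mu e)) @ 0^'+ --> v%:E) /\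
  ((fun e => limn_esup (rate T chi h mu e)) @ 0^'+ --> v%:E).
Proof.
move=> c10 c20 lo up.
have small (x : R) : 0 < x -> exists l : nat, l.+1%:R^-1 <= x.
  move=> x0; exists (Num.truncn x^-1).
  by rewrite -[leRHS]invrK lef_pV2 ?posrE ?invr_gt0// ltW// truncnS_gt.
have lo' (e : R) : 0 < e -> (v%:E <= limn_einf (rate T chi h mu e))%E.
  move=> e0; apply/lee_addgt0Pr => x x0.
  have [l Hl] : exists l : nat, l.+1%:R^-1 <= Num.min e (x / (c1 + 1)).
    by apply: small; rewrite lt_min e0 divr_gt0// ltr_wpDl.
  move: Hl; rewrite le_min => /andP[le lx].
  have h1 : (limn_einf (rate T chi h mu l.+1%:R^-1) <= limn_einf (rate T chi h mu e))%E.
    by apply: le_limn_einf => j; exact: rate_le.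
  apply: le_trans (leeD2r _ (le_trans (lo l) h1)).
  have y0 : 0 <= l.+1%:R^-1 :> R by rewrite invr_ge0.
  rewrite -EFinD lee_fin; move: (l.+1%:R^-1) lx y0 => y lx y0.
  rewrite ler_pdivlMr ?ltr_wpDl// in lx.
  by lra.
have lim0 : (fun e => (v + c2 * e)%:E) @ 0^'+ --> v%:E.
  apply: cvg_EFin; first by apply: nearW.
  apply: cvg_at_right_filter.
  rewrite -[X in _ --> X]addr0 -[X in _ --> _ + X](mulr0 c2).
  by apply: cvgD; [exact: cvg_cst|apply: cvgM; [exact: cvg_cst|exact: cvg_id]].
split; apply: squeeze_cvge (cvg_cst _) lim0; near=> e.
  have e0 : 0 < e by near: e; exact: nbhs_right_gt.
  by rewrite lo'//= (le_trans (limn_einf_sup _))// up.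
have e0 : 0 < e by near: e; exact: nbhs_right_gt.
by rewrite up// andbT (le_trans (lo' _ e0))// limn_einf_sup.
Unshelve. all: by end_near. Qed.

End rates.

Theorem theorem3p4 (R : realType) (d : measure_display) (Om : measurableType d)
  (P : probability Om R) (W : Om -> R) (Wm : nat -> seq bool -> Om -> R)
  (mu : nat -> Om -> {measure set R -> \bar R}) (T chi h : R) :
  0 < T -> assumptionsA P W ->
  (forall m r, r != [::] -> measurable_fun setT (Wm m r) /\
     forall B : set R, measurable B -> P (Wm m r @^-1` B) = P (W @^-1` B)) ->
  mutually_independent P [set i : nat * seq bool | i.2 != [::]]
    (fun i => Wm i.1 i.2) ->
  {ae P, forall om, forall m, cascade_weak_limit T Wm om m (mu m om)} ->
  0 < chi ->
  (pplus P W chi < +oo)%E -> (-oo < pminus P W chi)%E ->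
  0 < tau P W (fine (pplus P W chi)) ->
  derive1 (tau P W) (fine (pplus P W chi)) < h ->
  h < derive1 (tau P W) (fine (pminus P W chi)) ->
  {ae P, forall om,
     ((fun eps => limn_einf (rate T chi h (fun m => mu m om) eps)) @ 0^'+
        --> (chi%:E + Dleg P W h)%E) /\
     ((fun eps => limn_esup (rate T chi h (fun m => mu m om) eps)) @ 0^'+
        --> (chi%:E + Dleg P W h)%E)}.
Proof.
move=> T0 aW HW iW mulim chi0 ppoo pmoo tpp hpp hpm.
have mWm m r : r != [::] -> measurable_fun setT (Wm m r) by move=> /(HW m)[].
have eqW m r : r != [::] -> forall B : set R, measurable B ->
  P (Wm m r @^-1` B) = P (W @^-1` B) by move=> /(HW m)[].
set pp := fine (pplus P W chi) in tpp hpp *; set pm := fine (pminus P W chi) in hpm *.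
have pp1 : (1%:E <= pplus P W chi)%E by apply: le_ereal_inf_tmp => _ [q [q1 _] <-]; rewrite lee_fin.
have ppE : pplus P W chi = pp%:E.
  by rewrite fineK// fin_numElt ppoo andbT (lt_le_trans _ pp1)// ltNyr.
have pm0 : (pminus P W chi <= 0%:E)%E by apply: ge_ereal_sup => _ [q [q1 _] <-]; rewrite lee_fin.
have pmE : pminus P W chi = pm%:E.
  by rewrite fineK// fin_numElt pmoo/= (le_lt_trans pm0)// ltry.
have {}pp1 : 1 <= pp by rewrite -lee_fin -ppE.
have {}pm0 : pm <= 0 by rewrite -lee_fin -pmE.
have Hp q : 1 <= q < pp -> - chi < q * derive1 (tau P W) q - tau P W q.
  move=> /andP[q1 qpp]; rewrite ltNge; apply/negP => H.
  have : (pplus P W chi <= q%:E)%E by apply: ereal_inf_lbound; exists q.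
  by rewrite ppE lee_fin leNgt qpp.
have Hm q : pm < q <= 0 -> - chi < q * derive1 (tau P W) q - tau P W q.
  move=> /andP[qpm q0]; rewrite ltNge; apply/negP => H.
  have : (q%:E <= pminus P W chi)%E by apply: ereal_sup_ubound; exists q.
  by rewrite pmE lee_fin leNgt qpm.
have [p [/andP[_ ppp] dp tang D]] := legendre_point (tau_concave aW) (derivable_tau aW)
  pm0 pp1 (tau1 aW) tpp hpp hpm chi0 Hp Hm.
have [Q1 tauQ] := concave_gt0 (tau_concave aW) (tau1 aW) tpp pp1.
have DE := Dleg_tangent tang.
have cvg_ae := ae_mass_cvg aW mWm eqW iW T0 mulim.
have up_ae := ae_mass_moments aW mWm eqW iW chi Q1 tauQ (ltW ppp).
have [K K0 goodK] := Ex_good_ge aW mWm eqW iW Q1 tauQ.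
have [q [chi' [q12 c0 c1 tq]]] : exists q chi', [/\ 1 < q <= 2, 0 < chi', chi' < chi &
    q * tau P W p - tau P W (p * q) < (q - 1) * chi'].
  by apply: (tilt_exponents (@derivable_tau _ _ _ _ _ aW p) chi0); rewrite dp.
have good_ae := ae_good_mass aW mWm eqW iW chi0 q12 c0 c1 tq goodK.
(* Both [eta] and the error index depend on the width, so the almost sure event is built for one
   width at a time. *)
have lo_ae (l : nat) : {ae P, forall om,
    ((chi + (p * h - tau P W p) - (`|p| + 1) * l.+1%:R^-1)%:E <=
     limn_einf (rate T chi h (fun m => mu m om) l.+1%:R^-1))%E}.
  have e0 : 0 < l.+1%:R^-1 :> R by rewrite invr_gt0.
  move: (l.+1%:R^-1) e0 => e e0.
  have e80 : 0 < e / 8 by rewrite divr_gt0.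
  have [eta eta0 [tp tm]] := tangent_gap (@derivable_tau _ _ _ _ _ aW p) e80.
  rewrite dp in tp tm.
  have [n Hn] : exists n : nat, n.+1%:R^-1 <= eta * (e / 8).
    have x0 : 0 < (eta * (e / 8))^-1 by rewrite invr_gt0 mulr_gt0.
    exists (Num.truncn (eta * (e / 8))^-1).
    by rewrite -[leRHS]invrK lef_pV2 ?posrE// ltW// truncnS_gt.
  have pae := ae_path_moments aW mWm eqW iW chi (p + eta).
  have mae := ae_path_moments aW mWm eqW iW chi (p - eta).
  apply: filterS3 (filterI cvg_ae good_ae) pae mae => om [cv gd] pa ma.
  exact: (liminf_rate_ge T0 chi0 K0 cv e0 eta0 tp tm Hn gd (pa n) (ma n)).
have {}lo_ae := ae_foralln lo_ae.
rewrite DE -EFinD.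
apply: filterS3 cvg_ae up_ae lo_ae => om cv up lo.
have c10 : 0 <= `|p| + 1 by rewrite addr_ge0.
(* The event behind the upper bound does not depend on the width, so every [e] is allowed. *)
apply: (rate_limits c10 (normr_ge0 p) lo) => e e0.
exact: (limsup_rate_le h T0 cv (ltW e0) up).
Qed.
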